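(* Let $M$ be a smooth manifold modelled on a Banach space $\mathbb{E}$ with atlas $\{(U_\alpha,\psi_\alpha)\}_{\alpha\in I}$, and suppose $M$ is endowed with a linear connection $\nabla$. For $i\ge1$ let $\Phi_\alpha^i:\pi_i^{-1}(U_\alpha)\to\psi_\alpha(U_\alpha)\times\mathbb{E}^i$ be the vector bundle trivializations of $T^iM$ induced by $\nabla$ (defined in the context). Then $T^\infty M$, identified with $\varprojlim T^iM$, admits a smooth Fréchet manifold structure with charts $\varprojlim_i\Phi_\alpha^i$, modelled on the Fréchet space $\mathbb{E}\times\mathbb{F}$, where $\mathbb{F}=\varprojlim\mathbb{E}^i$ (so $\mathbb{E}\times\mathbb{F}\cong\varprojlim\mathbb{E}^{i+1}$), and $\pi_\infty:T^\infty M\to M$ admits a generalized vector bundle structure over $M$ with fibres isomorphic to the Fréchet space $\mathbb{F}$ and structure group $\mathcal{H}^0(\mathbb{F})=\varprojlim\mathcal{H}^0_i(\mathbb{E}^i)$.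
   Context: For $x\in M$ let $C_x$ be the set of smooth curves $\gamma:(-\epsilon,\epsilon)\to M$ with $\gamma(0)=x$; for $k\ge1$, $\gamma_1\approx^k_x\gamma_2$ iff $\gamma_1^{(j)}(0)=\gamma_2^{(j)}(0)$ for $1\le j\le k$ (in a chart), and $\gamma_1\approx^\infty_x\gamma_2$ iff $\gamma_1\approx^k_x\gamma_2$ for all $k\in\mathbb{N}$. For $k\in\mathbb{N}\cup\{\infty\}$, $T^kM=\bigcup_{x\in M}C_x/\approx^k_x$, the class of $\gamma$ is $[\gamma,x]_k$ and $\pi_k:T^kM\to M$, $[\gamma,x]_k\mapsto x$. The connecting maps $\phi^{ji}:T^jM\to T^iM$ ($j\ge i$) are $[\gamma,x]_j\mapsto[\gamma,x]_i$, and $T^\infty M$ is identified with $\varprojlim T^iM$ via $[\gamma,x]_\infty\mapsto([\gamma,x]_i)_{i}$. $\mathbb{E}^i$ is the $i$-fold product of $\mathbb{E}$, and $\rho^{ji}:\mathbb{E}^j\to\mathbb{E}^i$ ($j\ge i$) is the projection onto the first $i$ factors. A linear connection $\nabla$ on $M$ is given by local components $\Gamma_\alpha$: smooth maps $\psi_\alpha(U_\alpha)\to L^2(\mathbb{E},\mathbb{E};\mathbb{E})$, written $(x;\xi,y)\mapsto\Gamma_\alpha(x,\xi)y$, such that on overlaps, with $\psi_{\beta\alpha}=\psi_\beta\circ\psi_\alpha^{-1}$, $d\psi_{\beta\alpha}(x)[\Gamma_\alpha(x,\xi)y]=d^2\psi_{\beta\alpha}(x)(\xi,y)+\Gamma_\beta(\psi_{\beta\alpha}(x),d\psi_{\beta\alpha}(x)\xi)\,d\psi_{\beta\alpha}(x)y$.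 Define $\stackrel{1}{M}_\alpha(x,\xi_1)y=\Gamma_\alpha(x,\xi_1)y$ and, for $i\ge2$, $$\stackrel{i}{M}_\alpha(x,\xi_1,\dots,\xi_i)y=\frac1i\Big(\sum_{l=1}^{i}\partial_l\stackrel{i-1}{M}_\alpha(x,\xi_1,\dots,\xi_{i-1})(y,l\xi_l)+\stackrel{1}{M}_\alpha(x,\xi_1)\big[\stackrel{i-1}{M}_\alpha(x,\xi_1,\dots,\xi_{i-1})y\big]\Big),$$ where $\partial_l(\cdot)(y,v)$ is the derivative, in direction $v$ in the $l$-th of the variables $(x,\xi_1,\dots,\xi_{i-1})$, of $(x,\xi_1,\dots,\xi_{i-1})\mapsto\stackrel{i-1}{M}_\alpha(x,\xi_1,\dots,\xi_{i-1})y$. With $\gamma_\alpha=\psi_\alpha\circ\gamma$, the trivializations are $\Phi_\alpha^k([\gamma,x]_k)=(\gamma_\alpha(0),\gamma_\alpha'(0),z_\alpha^2,\dots,z_\alpha^k)$ with, for $2\le i\le k$, $$z_\alpha^i=\frac1i\Big\{\frac{1}{(i-1)!}\gamma_\alpha^{(i)}(0)+\sum_{j=1}^{i-1}\frac{1}{(i-j-1)!}\stackrel{j}{M}_\alpha\big[\gamma_\alpha(0),\gamma_\alpha'(0),\dots,\tfrac1{j!}\gamma_\alpha^{(j)}(0)\big]\gamma_\alpha^{(i-j)}(0)\Big\}.$$ They make each $\pi_k:T^kM\to M$ a smooth Banach vector bundle with fibre $\mathbb{E}^k$. For $i\in\mathbb{N}$, $\mathcal{H}^0_i(\mathbb{E}^i)$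 is the Banach Lie group of tuples $(l_1,\dots,l_i)$ of continuous linear automorphisms $l_j\in GL(\mathbb{E}^j)$ with $\rho^{jk}\circ l_j=l_k\circ\rho^{jk}$ for all $k\le j\le i$; these form a projective system under truncation of tuples, and $\mathcal{H}^0(\mathbb{F})=\varprojlim\mathcal{H}^0_i(\mathbb{E}^i)$, which acts on $\mathbb{F}$ by linear automorphisms $\varprojlim l_i$ and is contained in the Fréchet space obtained as the projective limit of the Banach spaces of tuples of continuous linear endomorphisms satisfying the same compatibility relations. That $\pi_\infty$ has a generalized vector bundle structure with fibre $\mathbb{F}$ and structure group $\mathcal{H}^0(\mathbb{F})$ means: with $\tau_\alpha^i=(\psi_\alpha^{-1}\times\mathrm{id}_{\mathbb{E}^i})\circ\Phi_\alpha^i:\pi_i^{-1}(U_\alpha)\to U_\alpha\times\mathbb{E}^i$, the limits $\tau_\alpha=\varprojlim\tau_\alpha^i:\pi_\infty^{-1}(U_\alpha)\to U_\alpha\times\mathbb{F}$ are local trivializations (diffeomorphisms over $U_\alpha$), and on overlaps $\tau_\beta\circ\tau_\alpha^{-1}(x,v)=(x,T_{\beta\alpha}(x)v)$ with $T_{\beta\alpha}:U_\alpha\cap U_\beta\to\mathcal{H}^0(\mathbb{F})$ smooth (as a map into the Fréchet space $\varprojlim_i\{(l_1,\dots,l_i)\in\prod_{j=1}^i\mathcal{L}(\mathbb{E}^j,\mathbb{E}^j):\rho^{jk}\circ l_j=l_k\circ\rho^{jk}\text{ for all }k\le j\le i\}$, where $\mathcal{L}(\mathbb{E}^j,\mathbb{E}^j)$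 is the Banach space of continuous linear endomorphisms of $\mathbb{E}^j$ and the connecting maps are truncation of tuples). *)

(* Defs.v *)
From HB Require Import structures.
From mathcomp Require Import all_boot all_order all_algebra.
From mathcomp Require Import all_classical all_reals all_analysis.

Set Implicit Arguments.
Unset Strict Implicit.
Unset Printing Implicit Defensive.

Import Order.TTheory GRing.Theory Num.Theory.
Import numFieldNormedType.Exports.

Local Open Scope classical_set_scope.
Local Open Scope ring_scope.

(* Linear subspaces of a product of modules, given as sets of families. *)
Record subspace (R : realType) (J : Type) (X : J -> lmodType R) := Subspace {
  in_sub :> set (forall j, X j);
  in_sub0 : in_sub (fun=> 0);
  in_subL : forall a x y, in_sub x -> in_sub y ->
    in_sub (fun j => a *: x j + y j) }.

Record subfam (R : realType) (J : Type) (X : J -> lmodType R)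
  (S : subspace X) := Subfam { fam :> forall j, X j; famP : in_sub S fam }.

Section SubfamLmod.
Context (R : realType) (J : Type) (X : J -> lmodType R) (S : subspace X).
Implicit Types x y z : subfam S.

Lemma fam_inj x y : (forall j, fam x j = fam y j) -> x = y.
Proof.
case: x y => x xS [y yS] /= xy.
have e : x = y by apply: functional_extensionality_dep.
by subst y; rewrite (Prop_irrelevance xS yS).
Qed.

Lemma subfam_addP x y : in_sub S (fun j => x j + y j).
Proof.
have := in_subL 1 (famP x) (famP y).
by congr (in_sub _ _); apply: functional_extensionality_dep => j; rewrite scale1r.
Qed.

Lemma subfam_scaleP (a : R) x : in_sub S (fun j => a *: x j).
Proof.
have := in_subL a (famP x) (in_sub0 S).
by congr (in_sub _ _); apply: functional_extensionality_dep => j; rewrite addr0.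
Qed.

Definition subfam_zero : subfam S := Subfam (in_sub0 S).
Definition subfam_add x y : subfam S := Subfam (subfam_addP x y).
Definition subfam_scale (a : R) x : subfam S := Subfam (subfam_scaleP a x).
Definition subfam_opp x : subfam S := subfam_scale (-1) x.

HB.instance Definition _ := gen_eqMixin (subfam S).
HB.instance Definition _ := gen_choiceMixin (subfam S).

Lemma subfam_addA : associative subfam_add.
Proof. by move=> x y z; apply: fam_inj => j /=; rewrite addrA. Qed.
Lemma subfam_addC : commutative subfam_add.
Proof. by move=> x y; apply: fam_inj => j /=; rewrite addrC. Qed.
Lemma subfam_add0 : left_id subfam_zero subfam_add.
Proof. by move=> x; apply: fam_inj => j /=; rewrite add0r. Qed.
Lemma subfam_addN : left_inverse subfam_zero subfam_opp subfam_add.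
Proof. by move=> x; apply: fam_inj => j /=; rewrite scaleN1r addNr. Qed.

HB.instance Definition _ := GRing.isZmodule.Build (subfam S)
  subfam_addA subfam_addC subfam_add0 subfam_addN.

Lemma subfam_scaleA a b x : subfam_scale a (subfam_scale b x) =
  subfam_scale (a * b) x.
Proof. by apply: fam_inj => j /=; rewrite scalerA. Qed.
Lemma subfam_scale1 : left_id 1 subfam_scale.
Proof. by move=> x; apply: fam_inj => j /=; rewrite scale1r. Qed.
Lemma subfam_scaleDr : right_distributive subfam_scale +%R.
Proof. by move=> a x y; apply: fam_inj => j /=; rewrite scalerDr. Qed.
Lemma subfam_scaleDl x : {morph subfam_scale^~ x : a b / a + b}.
Proof. by move=> a b; apply: fam_inj => j /=; rewrite scalerDl. Qed.

HB.instance Definition _ := GRing.Zmodule_isLmodule.Build R (subfam S)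
  subfam_scaleA subfam_scale1 subfam_scaleDr subfam_scaleDl.

Lemma famD x y j : fam (x + y) j = fam x j + fam y j. Proof. by []. Qed.
Lemma famZ (a : R) x j : fam (a *: x) j = a *: fam x j. Proof. by []. Qed.

End SubfamLmod.

Section SubprodTvs.
Context (R : realType) (J : Type) (X : J -> tvsType R).

(* subprod S carries the initial topology of the coordinate maps, that is the
   subspace topology of the product topology. *)
Definition subprod (S : subspace (fun j => X j : lmodType R)) := subfam S.

Variable S : subspace (fun j => X j : lmodType R).

HB.instance Definition _ := GRing.Lmodule.on (subprod S).

Definition coord_topology (j : J) :=
  initial_topology (fun x : subprod S => fam x j : X j).

HB.instance Definition _ := Topological.copy (subprod S)
  (sup_topology (fun j => Topological.class (coord_topology j))).

Lemma cvg_subprod (F : set_system (subprod S)) (x : subprod S) : Filter F ->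
  (forall j, (fun y : subprod S => fam y j : X j) @ F --> (fam x j : X j)) ->
  F --> x.
Proof.
move=> FF h; apply/cvg_sup => j A [B [[C oC <-] Cx] BA].
apply: filterS BA _; apply: (h j); exact: open_nbhs_nbhs.
Qed.

Lemma coord_continuous j : continuous (fun x : subprod S => fam x j : X j).
Proof.
move=> x; have : nbhs x --> x by [].
move/cvg_sup => /(_ j) h.
apply: (cvg_trans (cvg_app _ h)).
exact: initial_continuous.
Qed.

Lemma subprod_add_continuous :
  continuous (fun x : subprod S * subprod S => x.1 + x.2).
Proof.
move=> [x y]; apply: cvg_subprod => j.
have c1 : (fun p : subprod S * subprod S => fam p.1 j : X j) @ (x, y) -->
    (fam x j : X j).
  apply: (@cvg_comp _ _ _ fst (fun z : subprod S => fam z j : X j) _ (nbhs x)).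
    exact: cvg_fst.
  exact: coord_continuous.
have c2 : (fun p : subprod S * subprod S => fam p.2 j : X j) @ (x, y) -->
    (fam y j : X j).
  apply: (@cvg_comp _ _ _ snd (fun z : subprod S => fam z j : X j) _ (nbhs y)).
    exact: cvg_snd.
  exact: coord_continuous.
have := cvg_comp _ _ (cvg_pair c1 c2)
  (@add_continuous (X j) (fam x j : X j, fam y j : X j)).
exact.
Qed.

Lemma subprod_scale_continuous :
  continuous (fun z : R^o * subprod S => z.1 *: z.2).
Proof.
move=> [a y]; apply: cvg_subprod => j.
have c1 : (fun p : R^o * subprod S => p.1) @ (a, y) --> (a : R^o).
  exact: cvg_fst.
have c2 : (fun p : R^o * subprod S => fam p.2 j : X j) @ (a, y) -->
    (fam y j : X j).
  apply: (@cvg_comp _ _ _ snd (fun z : subprod S => fam z j : X j) _ (nbhs y)).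
    exact: cvg_snd.
  exact: coord_continuous.
have := cvg_comp _ _ (cvg_pair c1 c2)
  (@scale_continuous R (X j) (a : R^o, fam y j : X j)).
exact.
Qed.

Lemma subprod_locally_convex : exists2 B : set_system (subprod S),
  (forall b, b \in B -> convex_set b) & basis B.
Proof.
exists [set b | open b /\ convex_set b].
  by move=> b /set_mem [].
split; first by move=> b [].
move=> x.
have FF : Filter (filter_from
    [set U : set (subprod S) | (open U /\ convex_set U) /\ U x] id).
  apply: filter_from_filter.
    exists setT; split=> //; split; first exact: openT.
    by move=> ? ? ? _ _; rewrite inE.
  move=> U V [[oU cU] Ux] [[oV cV] Vx]; exists (U `&` V) => //.
  split=> //; split; first exact: openI.
  move=> y z l; rewrite !in_setI => /andP[yU yV] /andP[zU zV].
  by rewrite cU // cV.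
apply: cvg_subprod => j A /= Ax.
have [B cB [oB /(_ (fam x j : X j) A Ax) [b [Bb bx] bA]]] :=
  @locally_convex R (X j).
exists ((fun y : subprod S => fam y j : X j) @^-1` b) => //.
split; last exact: bx.
split; first by apply: open_comp => [y _|]; [exact: coord_continuous|exact: oB].
move=> y z l; rewrite !inE /= => yb zb.
by have /set_mem := cB _ (mem_set Bb) _ _ l (mem_set yb) (mem_set zb).
by move=> y /bA.
Qed.

HB.instance Definition _ := PreTopologicalLmod_isTvs.Build R (subprod S)
  subprod_add_continuous subprod_scale_continuous subprod_locally_convex.
HB.instance Definition _ := PreTopologicalNmodule_isTopologicalNmodule.Build
  (subprod S) subprod_add_continuous.
HB.instance Definition _ := TopologicalNmodule_isTopologicalLmodule.Build R
  (subprod S) subprod_scale_continuous.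
HB.instance Definition _ :=
  Uniform_isTvs.Build R (subprod S) subprod_locally_convex.

End SubprodTvs.

Section BoundedOperators.
Context (R : realType) (V W : normedModType R).

Definition clin_set : set (forall _ : V, W) :=
  [set f | linear (f : V -> W) /\ continuous (f : V -> W)].

Lemma clin_set0 : clin_set (fun=> 0).
Proof.
split; first by move=> a x y; rewrite scaler0 addr0.
by move=> x; exact: cvg_cst.
Qed.

Lemma clin_setL a f g : clin_set f -> clin_set g ->
  clin_set (fun x => a *: f x + g x).
Proof.
move=> [lf cf] [lg cg]; split.
  move=> b x y; rewrite lf lg !scalerDr !scalerA addrACA [a * b]mulrC.
  by [].
move=> x; apply: (@cvgD _ _ _ _ _ (fun z => a *: f z) g).
  by apply: cvgZr; exact: cf.
exact: cg.
Qed.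

Definition clin_subspace : subspace (fun _ : V => W : lmodType R) :=
  Subspace clin_set0 clin_setL.

(* The Banach space L(V, W) of continuous linear maps; its norm is the
   operator norm. *)
Definition clin := subfam clin_subspace.

Definition opnorm (f : clin) : R :=
  sup [set `|fam f x : W| | x in [set x : V | `|x| <= 1]].

Definition clin_linear (f : clin) : {linear V -> W} :=
  HB.pack (fam f : V -> W)
    (GRing.isLinear.Build R V W *:%R (fam f : V -> W) (proj1 (famP f))).

Lemma clin_bound (f : clin) : exists M, forall x : V, `|fam f x : W| <= M * `|x|.
Proof.
have [_ cf] := famP f.
have := @continuous_linear_bounded _ _ _ 0 (clin_linear f) (cf 0).
by move=> /linear_boundedP /pinfty_ex_gt0 [M _ hM]; exists M.
Qed.

Lemma opnorm_has_sup (f : clin) :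
  has_sup [set `|fam f x : W| | x in [set x : V | `|x| <= 1]].
Proof.
split; first by exists `|fam f 0 : W|; exists 0 => //=; rewrite normr0.
have [M hM] := clin_bound f; exists `|M| => _ [x /= x1 <-].
apply: (le_trans (hM x)); apply: (le_trans (ler_norm _)).
by rewrite normrM normr_id ler_piMr.
Qed.

Lemma opnorm_ub (f : clin) (x : V) : `|x| <= 1 -> `|fam f x : W| <= opnorm f.
Proof. by move=> x1; apply: (sup_upper_bound (opnorm_has_sup f)); exists x. Qed.

Lemma opnorm_le (f : clin) (M : R) :
  (forall x : V, `|x| <= 1 -> `|fam f x : W| <= M) -> opnorm f <= M.
Proof.
move=> h; apply: ge_sup; first by have [] := opnorm_has_sup f.
by move=> _ [x /= x1 <-]; exact: h.
Qed.

Lemma opnormD (f g : clin) : opnorm (f + g) <= opnorm f + opnorm g.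
Proof.
apply: opnorm_le => x x1; rewrite famD; apply: (le_trans (ler_normD _ _)).
by apply: lerD; exact: opnorm_ub.
Qed.

Lemma opnormZ (a : R) (f : clin) : opnorm (a *: f) = `|a| * opnorm f.
Proof.
have le b g : opnorm (b *: g) <= `|b| * opnorm g.
  by apply: opnorm_le => x x1; rewrite famZ normrZ ler_wpM2l // opnorm_ub.
apply/eqP; rewrite eq_le le /=.
have [->|a0] := eqVneq a 0.
  rewrite normr0 mul0r; apply: le_trans (opnorm_ub _ (x := 0) _) => //.
  by rewrite normr0.
rewrite -ler_pdivlMl ?normr_gt0 // -normfV.
by apply: le_trans (le _ _); rewrite scalerA mulVf // scale1r.
Qed.

Lemma opnorm0_eq0 (f : clin) : opnorm f = 0 -> f = 0.
Proof.
move=> f0; apply: fam_inj => x.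
have z y : `|y| <= 1 -> fam f y = 0.
  by move=> /(opnorm_ub f); rewrite f0 normr_le0 => /eqP.
have [->|x0] := eqVneq x 0; first by apply: z; rewrite normr0.
have xE : x = `|x| *: (`|x|^-1 *: x).
  by rewrite scalerA divff ?normr_eq0 // scale1r.
rewrite xE; have /= -> := linearZ_LR (clin_linear f) `|x| (`|x|^-1 *: x).
rewrite z ?scaler0 // normrZ normfV normr_id mulVf ?normr_eq0 //.
Qed.

HB.instance Definition _ := GRing.Lmodule.on clin.
HB.instance Definition _ := Lmodule_isNormed.Build R clin
  opnormD opnormZ opnorm0_eq0.

End BoundedOperators.

Section Power.
Context (R : realType) (E : normedModType R).

(* E^n with the maximum norm *)
Definition npow (n : nat) := {ffun 'I_n -> E}.

Variable n : nat.
HB.instance Definition _ := GRing.Lmodule.on (npow n).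

Definition npow_norm (x : npow n) : R := \big[Num.max/0]_(k < n) `|x k|.

Lemma npow_normD (x y : npow n) : npow_norm (x + y) <= npow_norm x + npow_norm y.
Proof.
apply: bigmax_le => [|k _].
  by apply: addr_ge0; exact: bigmax_ge_id.
rewrite ffunE; apply: (le_trans (ler_normD _ _)).
by apply: lerD; exact: (le_bigmax _ (fun k => `|_ k|)).
Qed.

Lemma npow_normZ (a : R) (x : npow n) : npow_norm (a *: x) = `|a| * npow_norm x.
Proof.
rewrite /npow_norm; elim/big_rec2: _ => [|k u v _ ->]; first by rewrite mulr0.
by rewrite ffunE normrZ maxr_pMr.
Qed.

Lemma npow_norm0_eq0 (x : npow n) : npow_norm x = 0 -> x = 0.
Proof.
move=> x0; apply/ffunP => k; rewrite ffunE; apply/eqP.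
by rewrite -normr_le0 -x0; exact: (le_bigmax _ (fun k => `|x k|)).
Qed.

HB.instance Definition _ := Lmodule_isNormed.Build R (npow n)
  npow_normD npow_normZ npow_norm0_eq0.

End Power.

Section Limits.
Context (R : realType) (E : normedModType R).

(* The projection rho^{nm} : E^n -> E^m onto the first m factors. *)
Definition rho (n m : nat) (h : (m <= n)%N) (x : npow E n) : npow E m :=
  [ffun k => x (widen_ord h k)].

(* plim_npow s is the projective limit of E^(s+0), E^(s+1), ..., with the
   projective limit topology. *)
Definition plim_npow_set (s : nat) : set (forall n, npow E (s + n)) :=
  [set v | forall n m (h : (s + m <= s + n)%N), rho h (v n) = v m].

Lemma plim_npow_set0 s : @plim_npow_set s (fun=> 0).
Proof. by move=> n m h; apply/ffunP => k; rewrite !ffunE. Qed.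

Lemma plim_npow_setL s a x y : @plim_npow_set s x -> @plim_npow_set s y ->
  @plim_npow_set s (fun n => a *: x n + y n).
Proof.
move=> xS yS n m h; rewrite -(xS n m h) -(yS n m h).
by apply/ffunP => k; rewrite !ffunE.
Qed.

Definition plim_npow_subspace (s : nat) :
    subspace (fun n => npow E (s + n) : lmodType R) :=
  Subspace (@plim_npow_set0 s) (@plim_npow_setL s).

Definition plim_npow (s : nat) : tvsType R :=
  subprod (X := fun n => npow E (s + n)) (plim_npow_subspace s).

(* The Frechet space F: its n-th component lies in E^(n+1). *)
Definition Fspace : tvsType R := plim_npow 1.

Definition coordF (s : nat) (v : plim_npow s) (n : nat) : npow E (s + n) := fam v n.

(* The space of tuples (l_1, ..., l_i), i = n.+1, of continuous linear
   endomorphisms, l_(j+1) being the component of index j : 'I_n.+1. *)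
Definition end_tuple_set (n : nat) :
    set (forall j : 'I_n.+1, clin (npow E j.+1) (npow E j.+1)) :=
  [set l | forall (j k : 'I_n.+1) (h : (k.+1 <= j.+1)%N) x,
    rho h (l j x) = l k (rho h x)].

Lemma end_tuple_set0 n : @end_tuple_set n (fun=> 0).
Proof. by move=> j k h x; apply/ffunP => i; rewrite !ffunE. Qed.

Lemma end_tuple_setL n a x y : @end_tuple_set n x -> @end_tuple_set n y ->
  @end_tuple_set n (fun j => a *: x j + y j).
Proof.
move=> xS yS j k h v; rewrite !famD !famZ -(xS j k h v) -(yS j k h v).
by apply/ffunP => i; rewrite !ffunE.
Qed.

Definition end_tuple (n : nat) : tvsType R :=
  subprod (X := fun j : 'I_n.+1 => clin (npow E j.+1) (npow E j.+1))
    (Subspace (@end_tuple_set0 n) (@end_tuple_setL n)).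

Definition tuple_end n (l : end_tuple n) (j : 'I_n.+1) :
  clin (npow E j.+1) (npow E j.+1) := fam l j.

(* The projective limit of these spaces under truncation of tuples. *)
Definition plim_end_set : set (forall n, end_tuple n) :=
  [set t | forall n m (h : (m.+1 <= n.+1)%N) (j : 'I_m.+1),
    tuple_end (t n) (widen_ord h j) = tuple_end (t m) j].

Lemma plim_end_set0 : plim_end_set (fun=> 0).
Proof. by []. Qed.

Lemma plim_end_setL a x y : plim_end_set x -> plim_end_set y ->
  plim_end_set (fun n => a *: x n + y n).
Proof.
move=> xS yS n m h j.
have e k (i : 'I_k.+1) : tuple_end (a *: x k + y k) i =
  a *: tuple_end (x k) i + tuple_end (y k) i by [].
by rewrite !e (xS n m h j) (yS n m h j).
Qed.

Definition plim_end : tvsType R :=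
  subprod (X := end_tuple) (Subspace plim_end_set0 plim_end_setL).

Definition trunc (t : plim_end) (n : nat) : end_tuple n := fam t n.

Definition in_GL (V : normedModType R) (l : clin V V) : Prop :=
  exists l' : clin V V, (forall x, l (l' x) = x) /\ (forall x, l' (l x) = x).

(* H^0_i(E^i), i = n.+1 *)
Definition H0 (n : nat) : set (end_tuple n) :=
  [set l | forall j, in_GL (tuple_end l j)].

(* H^0(F) *)
Definition H0lim : set plim_end := [set t | forall n, @H0 n (trunc t n)].

(* The action on F: v = (v_i)_i is mapped to (l_i v_i)_i. *)
Lemma act_subproof (t : plim_end) (v : Fspace) :
  @plim_npow_set 1 (fun n => tuple_end (trunc t n) ord_max (coordF v n)).
Proof.
move=> n m h.
have <- : rho h (coordF v n) = coordF v m := famP v n m h.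
have <- : tuple_end (trunc t n) (widen_ord h ord_max) =
   tuple_end (trunc t m) ord_max := famP t n m h ord_max.
exact: (famP (trunc t n) ord_max (widen_ord h ord_max) h).
Qed.

Definition act (t : plim_end) (v : Fspace) : Fspace :=
  Subfam (S := plim_npow_subspace 1) (act_subproof t v).

End Limits.

Section Smooth.
Context (R : realType).

Definition frechet_space (X : tvsType R) : Prop :=
  [/\ hausdorff_space X, countable_uniformity X &
      forall F : set_system X, ProperFilter F -> cauchy F ->
        exists x : X, F --> x].

(* Differentiability on an open set U in the sense of Leslie: df (x, .) is the
   derivative of f at x, and the difference quotients converge jointly in the
   step and the direction. *)
Definition has_derivative (X Y : tvsType R) (U : set X) (f : X -> Y)
    (df : X * X -> Y) : Prop :=
  forall x, U x -> linear (fun v => df (x, v)) /\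
    forall v, (fun p : R * X => p.1^-1 *: (f (x + p.1 *: p.2) - f x))
      @ filter_prod 0^' (nbhs v) --> df (x, v).

(* f is of class C^n on the open set U. On locally convex spaces this is the
   usual calculus (Leslie, Michal-Bastiani, Hamilton); on Banach spaces C^oo
   agrees with the C^oo maps of Frechet-differential calculus. *)
Fixpoint Cn (n : nat) (X Y : tvsType R) (U : set X) (f : X -> Y) : Prop :=
  (forall x, U x -> continuous_at x f) /\
  match n with
  | 0 => True
  | n'.+1 => exists df : X * X -> Y, has_derivative U f df /\
      @Cn n' (X * X)%type Y (U `*` [set: X]) df
  end.

Definition smooth_on (X Y : tvsType R) (U : set X) (f : X -> Y) : Prop :=
  forall n, Cn n U f.

(* A family of charts; chart a is only meaningful on dom a. *)
Record atlas (X : tvsType R) (M : Type) := Atlas {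
  ix : Type;
  dom : ix -> set M;
  chart : ix -> M -> X }.

Definition vec_atlas (X : tvsType R) : atlas X X :=
  @Atlas X X unit (fun=> setT) (fun=> id).

Definition prod_atlas (X Y : tvsType R) (M N : Type) (A : atlas X M)
    (B : atlas Y N) : atlas (X * Y)%type (M * N) :=
  @Atlas (X * Y)%type (M * N) (ix A * ix B)
    (fun ab => dom ab.1 `*` dom ab.2)
    (fun ab m => (chart ab.1 m.1, chart ab.2 m.2)).

Section Maps.
Context (X Y : tvsType R) (M N : Type) (A : atlas X M) (B : atlas Y N).

Definition rep_dom (S : set M) (f : M -> N) (a : ix A) (b : ix B) : set M :=
  S `&` dom a `&` f @^-1` dom b.

(* The local representative chart b \o f \o (chart a)^-1 of f, defined on
   chart a @` rep_dom S f a b. *)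
Definition local_rep (S : set M) (f : M -> N) (a : ix A) (b : ix B) (e : X) : Y :=
  xget 0 [set y | exists m, [/\ rep_dom S f a b m, chart a m = e
                              & y = chart b (f m)]].

Definition smooth_map (S : set M) (f : M -> N) : Prop :=
  forall a b, open (chart a @` rep_dom S f a b) /\
    smooth_on (chart a @` rep_dom S f a b) (local_rep S f a b).

End Maps.

Definition diffeo (X Y : tvsType R) (M N : Type) (A : atlas X M) (B : atlas Y N)
    (S : set M) (S' : set N) (f : M -> N) : Prop :=
  [/\ set_bij S S' f, smooth_map A B S f &
      exists g : N -> M, (forall m, S m -> g (f m) = m) /\ smooth_map B A S' g].

(* M is a manifold modelled on X with atlas A; as in Lang, the topology of M is
   the one defined by the atlas (atlas_open), and no separation is assumed. *)
Definition smooth_atlas (X : tvsType R) (M : Type) (A : atlas X M) : Prop :=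
  [/\ forall m, exists a : ix A, dom a m,
      forall a : ix A, {in dom a &, injective (chart a)},
      forall a : ix A, open (chart a @` dom a) &
      smooth_map A A setT id].

(* The open sets of the topology that an atlas defines. *)
Definition atlas_open (X : tvsType R) (M : Type) (A : atlas X M) (O : set M) :=
  forall a : ix A, open (chart a @` (O `&` dom a)).

Definition atlas_hausdorff (X : tvsType R) (M : Type) (A : atlas X M) : Prop :=
  forall x y, x <> y -> exists O O' : set M,
    [/\ atlas_open A O, atlas_open A O', O x, O' y & O `&` O' = set0].

End Smooth.

(* The quotient of T by the relation r, as a set of classes [set d | r c d]. *)
Section Quotient.
Context (T : Type) (r : T -> set T).

Definition quot := {K : set T | exists c, K = r c}.
Definition qclass (c : T) : quot := exist _ (r c) (ex_intro _ c erefl).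
Definition qrep (K : quot) : T := proj1_sig (cid (proj2_sig K)).
End Quotient.

Section TangentBundles.
Context (R : realType) (E : completeNormedModType R) (M : Type)
  (A : atlas E M).

Local Notation transition a b := (@local_rep R E E M M A A setT id a b).

(* Gam a x xi y is Gamma_a(x, xi) y; L^2(E, E; E) is L(E, L(E, E)). *)
Definition linear_connection (Gam : ix A -> E -> clin E (clin E E)) : Prop :=
  (forall a, smooth_on (chart a @` dom a) (Gam a)) /\
  forall a b m, dom a m -> dom b m -> forall xi y : E,
    let psi := transition a b in let x := chart a m in
    'D_(Gam a x xi y) psi x =
    'D_xi (fun z => 'D_y psi z) x + Gam b (psi x) ('D_xi psi x) ('D_y psi x).

Definition update (u : nat -> E) (l : nat) (w : E) : nat -> E :=
  fun k => if k == l then w else u k.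

(* connM G n u y is M^i(x, xi_1, ..., xi_i) y for i = n.+1, where the variables
   x, xi_1, xi_2, ... are u 0, u 1, u 2, ...; the entries of u after the i-th
   are not used. The l-th variable of M^(i-1) is u l.-1. *)
Fixpoint connM (G : E -> clin E (clin E E)) (n : nat) (u : nat -> E) (y : E) : E :=
  if n is n'.+1 then
    n.+1%:R^-1 *:
      (\sum_(1 <= l < n.+2)
         'D_(l%:R *: u l) (fun w => connM G n' (update u l.-1 w) y) (u l.-1)
       + G (u 0) (u 1) (connM G n' u y))
  else G (u 0) (u 1) y.

Definition taylor (g : R -> E) (j : nat) : E := j`!%:R^-1 *: derive1n j g 0.

(* z^i for the curve g = gamma_a; for i = 1 this is g'(0). *)
Definition zcoord (G : E -> clin E (clin E E)) (g : R -> E) (i : nat) : E :=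
  i%:R^-1 *: ((i.-1)`!%:R^-1 *: derive1n i g 0 +
    \sum_(1 <= j < i) (i - j - 1)`!%:R^-1 *:
      connM G j.-1 (taylor g) (derive1n (i - j) g 0)).

(* Smooth curves c : ]-eps, eps[ -> M, of base point c 0; the values outside the interval are
   irrelevant. *)
Record curve := Curve {
  curve_eps : R;
  curve_eps_gt0 : 0 < curve_eps;
  curve_fun :> R -> M;
  curve_smooth : smooth_map (vec_atlas R^o) A
    [set t : R^o | - curve_eps < t < curve_eps] curve_fun }.

Definition jet_eq (k : nat) (c : curve) : set curve :=
  [set d | c 0 = d 0 /\ exists2 a : ix A, dom a (c 0) &
    forall j, (1 <= j <= k)%N ->
      derive1n j (chart a \o c) 0 = derive1n j (chart a \o d) 0].

Definition jet_eq_oo (c : curve) : set curve :=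
  [set d | forall k, (1 <= k)%N -> jet_eq k c d].

Definition Tk (k : nat) := quot (jet_eq k).
Definition Too := quot jet_eq_oo.

(* qrep picks a representative curve. The maps below do not depend on it (for
   Phi and tau: on the fibres over dom a). *)
Definition pi_oo (w : Too) : M := qrep w 0.

Definition conn_map (j i : nat) (w : Tk j) : Tk i := qclass _ (qrep w).

(* The projective limit of T^1 M, T^2 M, ...: the component n is in T^(n+1) M. *)
Definition plim_T : set (forall n, Tk n.+1) :=
  [set t | forall j i, (i <= j)%N -> conn_map i.+1 (t j) = t i].

Definition to_plim_T (w : Too) (n : nat) : Tk n.+1 := qclass _ (qrep w).

Variable Gam : ix A -> E -> clin E (clin E E).

(* Phi_a^k on pi_k^-1 (dom a) *)
Definition Phi (a : ix A) (k : nat) (w : Tk k) : E * npow E k :=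
  (chart a (qrep w 0), [ffun i : 'I_k => zcoord (Gam a) (chart a \o qrep w) i.+1]).

(* tau_a^k = ((chart a)^-1 x id) o Phi_a^k *)
Definition tau (a : ix A) (k : nat) (w : Tk k) : M * npow E k :=
  ('pinv_(fun=> qrep w 0) (dom a) (chart a) (Phi a w).1, (Phi a w).2).

(* On D, f : Too -> Y * F is the projective limit of the maps f_k. *)
Definition is_plim (Y : Type) (D : set Too)
    (fk : forall k, Tk k -> Y * npow E k) (f : Too -> Y * Fspace E) : Prop :=
  forall w, D w -> forall n,
    ((f w).1, coordF (f w).2 n) = fk n.+1 (to_plim_T w n).

End TangentBundles.

(* The generalized vector bundle structure with fibre F and structure group
   H^0(F) on p : Tot -> M given by the trivializations tau a. *)
Definition gen_vector_bundle (R : realType) (E : completeNormedModType R)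
    (M Tot : Type) (A : atlas E M) (B : atlas (E * Fspace E)%type Tot)
    (p : Tot -> M) (tau : ix A -> Tot -> M * Fspace E) : Prop :=
  (forall a,
    diffeo B (prod_atlas A (vec_atlas (Fspace E)))
      (p @^-1` dom a) (dom a `*` setT) (tau a) /\
    forall w, dom a (p w) -> (tau a w).1 = p w) /\
  forall a b, exists t : M -> plim_end E,
    [/\ smooth_map A (vec_atlas (plim_end E)) (dom a `&` dom b) t,
        forall x, dom a x -> dom b x -> H0lim (t x) &
        forall x v w, dom a x -> dom b x -> p w = x ->
          tau a w = (x, v) -> tau b w = (x, act (t x) v)].

Definition lin_homeo (R : realType) (X Y : tvsType R) : Prop :=
  exists (f : {linear X -> Y}) (g : {linear Y -> X}),
    [/\ cancel f g, cancel g f, continuous f & continuous g].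

(* Main.v *)
From HB Require Import structures.
Require Import Defs.
From mathcomp Require Import all_boot all_order all_algebra.
From mathcomp Require Import all_classical all_reals all_analysis.
From mathcomp Require Import lra zify.

(** Along a curve g in a chart, let
    nabla y = y' + Gamma (g, g') y be the covariant derivative. The recursion that
    defines the operators M^i is a Leibniz rule for nabla (connA_cder), and it
    yields z^i = nabla^(i-1) g' / i! (zsum_cder, zcoord_zsum). The transformation
    rule of Gamma says that the derivative dpsi of a transition map psi intertwines
    the covariant derivatives of two charts; hence z^i transforms by dpsi, for every
    i (zsum_covariant, zcoord_covariant). The transition map between two limit
    charts is therefore (x, v) |-> (psi x, (dpsi (x) v_k)_k): it is linear in the
    fibre and acts by the same operator on all coordinates, so that it is compatible
    with all projections and belongs to the structure group (Phi_oo_transition,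
    cocycle_H0).

    Each limit chart is bijective for two reasons. First, z^i is the Taylor
    coefficient of order i of the curve plus a function of the lower ones
    (zcoord_taylor), so that a jet of infinite order and its sequence of
    z-coordinates determine each other. Second, every sequence of elements of E is
    the sequence of derivatives at 0 of a smooth curve (borel). Borel's lemma is also
    what identifies jets of infinite order with compatible sequences of finite jets
    (to_plim_T_bij).

    Smoothness into F or into the limit of operator tuples is a matter of
    coordinates, as these spaces are closed subspaces of products with the initial
    topology (Cn_initial). The coordinates of the cocycle take values in Banach
    spaces of operators, and smoothness in the directional sense has to be upgraded
    to smoothness for the operator norm: a smooth map g (x, v) that is linear in v
    is smooth as an operator-valued function of x (Cn_curry), by the mean value
    inequality and local convexity. *)

Set Implicit Arguments.
Unset Strict Implicit.
Unset Printing Implicit Defensive.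
Import Order.TTheory GRing.Theory Num.Theory.
Import numFieldNormedType.Exports.
Local Open Scope classical_set_scope.
Local Open Scope ring_scope.

(** * Linear identities in abelian groups *)

(** The tactic zmod below decides identities that hold in every abelian group: both
sides are reflected as formal sums, and the integer coefficients of each atom
are compared by computation. *)
Inductive zexp := ZAtom of nat | ZAdd of zexp & zexp | ZOpp of zexp | ZZero.

Fixpoint zeval (V : zmodType) (l : seq V) (e : zexp) : V :=
  match e with
  | ZAtom i => nth 0 l i
  | ZAdd a b => zeval l a + zeval l b
  | ZOpp a => - zeval l a
  | ZZero => 0
  end.

Fixpoint zcoef (i : nat) (e : zexp) : int :=
  match e with
  | ZAtom j => if j == i then 1 else 0
  | ZAdd a b => zcoef i a + zcoef i b
  | ZOpp a => - zcoef i a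
  | ZZero => 0
  end.

Lemma zevalE (V : zmodType) (l : seq V) (e : zexp) :
  zeval l e = \sum_(i < size l) l`_i *~ zcoef i e.
Proof.
elim: e => [j|a IHa b IHb|a IHa|] /=.
- have [jl|lj] := ltnP j (size l).
    rewrite (bigD1 (Ordinal jl)) //= eqxx mulr1z big1 ?addr0 // => i ij.
    by rewrite ifF ?mulr0z //; apply/negbTE; apply: contra ij => /eqP ji; apply/eqP/val_inj.
  rewrite nth_default // big1 // => i _; rewrite ifF ?mulr0z //.
  by apply/negbTE; apply: contraTneq lj => ->; rewrite -ltnNge.
- by rewrite IHa IHb -big_split; apply: eq_bigr => i _; rewrite /= mulrzDr.
- by rewrite IHa -sumrN; apply: eq_bigr => i _; rewrite mulrNz.
- by rewrite big1 // => i _; rewrite mulr0z.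
Qed.

Lemma zeval_eq (V : zmodType) (l : seq V) (a b : zexp) :
  all (fun i => zcoef i a == zcoef i b) (iota 0 (size l)) -> zeval l a = zeval l b.
Proof.
move=> /allP h; rewrite !zevalE; apply: eq_bigr => i _.
by rewrite (eqP (h i _)) // mem_iota add0n ltn_ord.
Qed.

Ltac zmod_index x l :=
  match l with
  | ?y :: _ => let _ := match goal with _ => unify x y end in constr:(O)
  | _ :: ?l' => let n := zmod_index x l' in constr:(S n)
  end.
Ltac zmod_atoms l e :=
  lazymatch e with
  | (?a + ?b)%R => let l := zmod_atoms l a in zmod_atoms l b
  | (- ?a)%R => zmod_atoms l a
  | 0%R => l
  (* an atom is added to the list only when zmod_index does not find it there *)
  | _ => match l with
         | _ => let n := zmod_index e l in l
         | _ => constr:(e :: l)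
         end
  end.
Ltac zmod_reify l e :=
  lazymatch e with
  | (?a + ?b)%R => let a := zmod_reify l a in let b := zmod_reify l b in
                   constr:(ZAdd a b)
  | (- ?a)%R => let a := zmod_reify l a in constr:(ZOpp a)
  | 0%R => constr:(ZZero)
  | _ => let n := zmod_index e l in constr:(ZAtom n)
  end.
Ltac zmod :=
  lazymatch goal with
  | |- @eq ?V ?x ?y =>
    (* the atoms are compared up to unification, since the same operation can
       be reached through several canonical structures *)
    let l := zmod_atoms (@nil V) x in let l := zmod_atoms l y in
    let a := zmod_reify l x in let b := zmod_reify l y in
    refine (@zeval_eq _ l a b _); by vm_compute
  end.

(** * Calculus in topological vector spaces *)

Lemma openX (S T : topologicalType) (A : set S) (B : set T) :
  open A -> open B -> open (A `*` B).
Proof.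
move=> oA oB; rewrite openE => -[x y] [/= Ax By].
by exists (A, B) => //; split; exact: open_nbhs_nbhs.
Qed.

Section Calculus.
Context (R : realType).
Implicit Types (X Y Z : tvsType R).

(** The base point of a difference quotient stays under control while the step
tends to 0 and the direction v varies; this makes has_derivative local. *)
Lemma cvg_line X (x v : X) :
  (fun p : R * X => x + p.1 *: p.2) @ filter_prod 0^' (nbhs v) --> x.
Proof.
have h : (fun p : R^o * X => x + p.1 *: p.2) @ ((0 : R^o), v) --> x.
  rewrite -[X in _ --> X]addr0 -[X in _ --> x + X](scale0r v).
  have c : (fun p : R^o * X => (x, p.1 *: p.2)) @ ((0 : R^o), v) -->
      (x, (0 : R^o) *: v).
    apply: cvg_pair; first exact: cvg_cst.
    exact: (@scale_continuous R X (0 : R^o, v)).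
  exact: cvg_comp c (@add_continuous X (x, 0 *: v)).
apply: cvg_trans h => A [[P Q] [/= P0 Qv] PQA].
exists (P, Q) => //; split => //; exact: nbhs_dnbhs P0.
Qed.

Lemma near_line X (U : set X) (x v : X) : nbhs x U ->
  \forall p \near filter_prod (0 : R)^' (nbhs v), U (x + p.1 *: p.2).
Proof. by move=> Ux; exact: (@cvg_line X x v U Ux). Qed.

Lemma near_line_neq0 X (v : X) :
  \forall p \near filter_prod (0 : R)^' (nbhs v), p.1 != 0.
Proof.
exists ([set t | t != 0], setT) => /=; last by move=> p [].
split; last exact: filterT.
by rewrite /= /dnbhs /within /=; near=> t.
Unshelve. all: by end_near. Qed.

Lemma Cn_cont n X Y (U : set X) (f : X -> Y) :
  Cn n U f -> forall x, U x -> {for x, continuous f}.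
Proof. by case: n => [|n] []. Qed.

Lemma Cn_sub n X Y (U V : set X) (f : X -> Y) :
  V `<=` U -> Cn n U f -> Cn n V f.
Proof.
elim: n X U V f => [|n IH] X U V f VU [cf h].
  by split => // x /VU /cf.
split; first by move=> x /VU /cf.
case: h => df [hd C]; exists df; split; first by move=> x /VU; exact: hd.
by apply: IH C => -[x v] /= [/VU].
Qed.

Lemma Cn_pred n X Y (U : set X) (f : X -> Y) : Cn n.+1 U f -> Cn n U f.
Proof.
elim: n X U f => [|n IH] X U f [cf [df [hd C]]]; split => //.
by exists df; split=> //; exact: IH.
Qed.

Lemma has_derivative_eq X Y (U : set X) (f g : X -> Y) df : open U ->
  (forall x, U x -> f x = g x) -> has_derivative U f df -> has_derivative U g df.
Proof.
move=> oU fg hd x Ux; have [l c] := hd x Ux; split=> // v.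
apply: cvg_trans (c v); apply: near_eq_cvg.
have := near_line v (open_nbhs_nbhs (conj oU Ux)).
by apply: filterS => p Up; rewrite !fg.
Qed.

Lemma Cn_eq n X Y (U : set X) (f g : X -> Y) : open U ->
  (forall x, U x -> f x = g x) -> Cn n U f -> Cn n U g.
Proof.
move=> oU fg.
have ceq : (forall x, U x -> {for x, continuous f}) ->
    forall x, U x -> {for x, continuous g}.
  move=> cf x Ux; rewrite /prop_for /continuous_at -fg //.
  apply: cvg_trans (cf x Ux); apply: near_eq_cvg.
  have := open_nbhs_nbhs (conj oU Ux).
  by apply: filterS => y Uy; rewrite fg.
case: n => [|n] [cf h]; split => //; try exact: ceq.
by case: h => df [hd C]; exists df; split=> //; exact: has_derivative_eq hd.
Qed.

Lemma has_derivative_lin X Y (U : set X) (f : {linear X -> Y}) :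
  continuous f -> has_derivative U f (fun p => f p.2).
Proof.
move=> cf x Ux; split=> [a u v|v]; first by rewrite /= linearP.
apply: cvg_trans (_ : f (p.2 : X) @[p --> filter_prod (0 : R)^' (nbhs v)] --> f v).
  apply: near_eq_cvg; apply: filterS (near_line_neq0 v) => -[t h] /= t0.
  by rewrite [f (_ + _)]linearD addrAC subrr add0r linearZ /= scalerA mulVf ?scale1r.
by apply: (@cvg_comp _ _ _ snd f _ (nbhs v)); [exact: cvg_snd|exact: cf].
Qed.

Lemma Cn_lin n X Y (U : set X) (f : {linear X -> Y}) : continuous f -> Cn n U f.
Proof.
elim: n X U f => [|n IH] X U f cf; split => //; try by move=> x _; exact: cf.
exists (fun p => f p.2); split; first exact: has_derivative_lin.
pose f2 : {linear (X * X)%type -> Y} := f \o snd.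
have -> : (fun p : X * X => f p.2) = f2 by [].
by apply: IH => p; apply: (@cvg_comp _ _ _ snd f _ (nbhs p.2)); [exact: cvg_snd|exact: cf].
Qed.

Lemma Cn_linear n X Y (U : set X) (f : X -> Y) :
  linear f -> continuous f -> Cn n U f.
Proof.
move=> lf cf.
pose F : {linear X -> Y} := HB.pack f (GRing.isLinear.Build R X Y *:%R f lf).
exact: (@Cn_lin n X Y U F).
Qed.

Lemma Cn_id n X (U : set X) : Cn n U id.
Proof. by apply: Cn_linear => // x; exact: cvg_id. Qed.

Lemma Cn_fst n X Y (U : set (X * Y)) : Cn n U fst.
Proof. by apply: Cn_linear => // x; exact: cvg_fst. Qed.

Lemma Cn_snd n X Y (U : set (X * Y)) : Cn n U snd.
Proof. by apply: Cn_linear => // x; exact: cvg_snd. Qed.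

Lemma Cn_cst n X Y (U : set X) (y : Y) : Cn n U (fun=> y).
Proof.
case: n => [|n]; split => //; try by move=> x _; exact: cvg_cst.
exists (fun=> 0); split; last first.
  by apply: Cn_linear => [a u v|x]; [rewrite scaler0 addr0|exact: cvg_cst].
move=> x _; split=> [a u v|v]; first by rewrite scaler0 addr0.
by under eq_fun do rewrite subrr scaler0; exact: cvg_cst.
Qed.

Lemma has_derivative_pair X Y Z (U : set X) (f : X -> Y) (g : X -> Z) df dg :
  has_derivative U f df -> has_derivative U g dg ->
  has_derivative U (fun x => (f x, g x)) (fun p => (df p, dg p)).
Proof.
move=> hf hg x Ux; have [lf cf] := hf x Ux; have [lg cg] := hg x Ux.
split=> [a u v|v]; first by rewrite lf lg.
exact: (cvg_pair (cf v) (cg v)).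
Qed.

Lemma Cn_pair n X Y Z (U : set X) (f : X -> Y) (g : X -> Z) :
  Cn n U f -> Cn n U g -> Cn n U (fun x => (f x, g x)).
Proof.
elim: n X U f g => [|n IH] X U f g [cf hf] [cg hg]; split => //;
  try by move=> x Ux; exact: (cvg_pair (cf x Ux) (cg x Ux)).
case: hf => df [hf Cf]; case: hg => dg [hg Cg].
exists (fun p => (df p, dg p)); split; last exact: IH.
exact: has_derivative_pair.
Qed.

Lemma cvg_filter_prod {T S W : Type} (F : set_system T) (G : set_system S)
    (H : set_system W) (f : T -> S) (g : T -> W) : Filter F ->
  f @ F `=>` G -> g @ F `=>` H -> (fun t => (f t, g t)) @ F `=>` filter_prod G H.
Proof.
move=> FF cf cg A [[P Q] /= [GP HQ] PQA].
have /= := @filterI _ F FF (f @^-1` P) (g @^-1` Q) (cf _ GP) (cg _ HQ).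
by apply: filterS => t [Pt Qt]; apply: PQA.
Qed.

(** The difference quotient of g \o f at x in the direction h is the one of g at
f x in the moving direction (f (x + t h) - f x) / t. Since has_derivative asks
for convergence jointly in the step and the direction, the limit passes through. *)
Lemma has_derivative_comp X Y Z (U : set X) (V : set Y) (f : X -> Y) (g : Y -> Z)
    df dg : (forall x, U x -> V (f x)) ->
  has_derivative U f df -> has_derivative V g dg ->
  has_derivative U (g \o f) (fun p => dg (f p.1, df p)).
Proof.
move=> UV hf hg x Ux.
have [lf cf] := hf x Ux; have [lg cg] := hg _ (UV _ Ux).
split=> [a u v|v] /=; first by rewrite lf lg.
have c : (fun p : R * X => (p.1, p.1^-1 *: (f (x + p.1 *: p.2) - f x)))
    @ filter_prod 0^' (nbhs v) `=>` filter_prod 0^' (nbhs (df (x, v))).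
  apply: cvg_filter_prod; first by move=> A; exact: cvg_fst.
  exact: cf.
apply: cvg_trans (cvg_comp _ _ c (cg (df (x, v)))).
apply: near_eq_cvg; apply: filterS (near_line_neq0 v) => -[t h] /= t0.
by rewrite scalerA mulfV // scale1r addrCA subrr addr0.
Qed.

(** The derivative of g \o f is dg composed with (f \o fst, df), which involves
maps of one class less only. *)
Lemma Cn_comp n X Y Z (U : set X) (V : set Y) (f : X -> Y) (g : Y -> Z) :
  (forall x, U x -> V (f x)) -> Cn n U f -> Cn n V g -> Cn n U (g \o f).
Proof.
elim: n X Y Z U V f g => [|n IH] X Y Z U V f g UV Cf Cg.
  by split=> // x Ux; apply: continuous_comp; [exact: Cn_cont Cf _ _|
    exact: Cn_cont Cg _ (UV _ _)].
split.
  by move=> x Ux; apply: continuous_comp; [exact: Cn_cont Cf _ _|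
    exact: Cn_cont Cg _ (UV _ _)].
have Cf' := Cn_pred Cf; case: Cf => _ [df [hf Cdf]]; case: Cg => _ [dg [hg Cdg]].
exists (fun p => dg (f p.1, df p)); split; first exact: has_derivative_comp hf hg.
apply: (@IH _ _ _ _ (V `*` setT) (fun p => (f p.1, df p)) dg) => //.
  by move=> -[x v] /= [Ux _]; split => //; exact: UV.
apply: Cn_pair => //.
apply: (@IH _ _ _ _ U fst f) => //; first by move=> p [].
exact: Cn_fst.
Qed.

Lemma cvg_fun2 {T : Type} X Y Z (F : set_system T) (f : T -> X) (g : T -> Y)
    (h : X * Y -> Z) x y : Filter F ->
  f @ F --> x -> g @ F --> y -> {for (x, y), continuous h} ->
  (fun t => h (f t, g t)) @ F --> h (x, y).
Proof. by move=> FF cf cg ch; exact: cvg_comp (cvg_pair cf cg) ch. Qed.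

Lemma cvgDtvs {T : Type} X (F : set_system T) (f g : T -> X) x y : Filter F ->
  f @ F --> x -> g @ F --> y -> (fun t => f t + g t) @ F --> x + y.
Proof.
move=> FF cf cg.
exact: (cvg_fun2 (h := fun p : X * X => p.1 + p.2) FF cf cg (@add_continuous X (x, y))).
Qed.

Lemma cvgZtvs {T : Type} X (F : set_system T) (f : T -> R) (g : T -> X) (a : R) x :
  Filter F -> f @ F --> a -> g @ F --> x -> (fun t => f t *: g t) @ F --> a *: x.
Proof.
move=> FF cf cg.
exact: (cvg_fun2 (X := R^o) (h := fun p : R^o * X => p.1 *: p.2) FF cf cg
  (@scale_continuous R X (a : R^o, x))).
Qed.

Lemma Cn_add n X (U : set (X * X)) : Cn n U (fun p => p.1 + p.2).
Proof.
apply: Cn_linear => [a [u1 u2] [v1 v2]|p]; last exact: add_continuous.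
by rewrite /= scalerDr addrACA.
Qed.

Lemma CnD n X Y (U : set X) (f g : X -> Y) :
  Cn n U f -> Cn n U g -> Cn n U (fun x => f x + g x).
Proof.
move=> Cf Cg; apply: (@Cn_comp _ _ _ _ U setT (fun x => (f x, g x))
  (fun p => p.1 + p.2)) => //; [exact: Cn_pair|exact: Cn_add].
Qed.

(** The difference quotient at (x, y) in the direction (h, k) is exactly
b (x, k) + b (h, y) + t b (h, k). *)
Lemma has_derivative_bilin X Y Z (U : set (X * Y)) (b : X * Y -> Z) :
  (forall x, linear (fun y => b (x, y))) -> (forall y, linear (fun x => b (x, y))) ->
  continuous b ->
  has_derivative U b (fun p => b (p.1.1, p.2.2) + b (p.2.1, p.1.2)).
Proof.
move=> lr ll cb [x y] _; split=> [a [u1 u2] [v1 v2]|[u v]] /=.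
  by rewrite lr ll scalerDr addrACA.
set F := filter_prod _ _.
have FF : Filter F by exact: filter_prod_filter.
pose q (p : R * (X * Y)) :=
  (b (x, p.2.2) + b (p.2.1, y)) + p.1 *: b (p.2.1, p.2.2).
have c2 : (fun p : R * (X * Y) => p.2) @ F --> (u, v) by exact: cvg_snd.
have c21 : (fun p : R * (X * Y) => p.2.1) @ F --> u.
  exact: cvg_comp c2 cvg_fst.
have c22 : (fun p : R * (X * Y) => p.2.2) @ F --> v.
  exact: cvg_comp c2 cvg_snd.
have c1 : (fun p : R * (X * Y) => p.1) @ F --> (0 : R).
  by move=> A A0; exact: (@cvg_fst _ _ (0 : R)^' _ _ A (nbhs_dnbhs A0)).
have : q @ F --> (b (x, v) + b (u, y)) + 0 *: b (u, v).
  apply: cvgDtvs.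
    apply: cvgDtvs.
      exact: (cvg_fun2 FF (cvg_cst x) c22 (@cb (x, v))).
    exact: (cvg_fun2 FF c21 (cvg_cst y) (@cb (u, y))).
  apply: cvgZtvs => //; exact: (cvg_fun2 FF c21 c22 (@cb (u, v))).
rewrite scale0r addr0; apply: cvg_trans.
apply: near_eq_cvg; apply: filterS (near_line_neq0 (u, v)) => -[t [h k]] /= t0.
rewrite /q /=.
have bDl s1 s2 w : b (s1 + t *: s2, w) = b (s1, w) + t *: b (s2, w).
  by rewrite [s1 + _]addrC [RHS]addrC; exact: (ll w t s2 s1).
have bDr s w1 w2 : b (s, w1 + t *: w2) = b (s, w1) + t *: b (s, w2).
  by rewrite [w1 + _]addrC [RHS]addrC; exact: (lr s t w2 w1).
rewrite bDl !bDr [X in _ = _ *: X]addrAC [b (x, y) + _]addrC addrK -scalerDr.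
by rewrite scalerA mulVf // scale1r addrA.
Qed.

(** The derivative is a sum of two copies of b composed with coordinate maps. *)
Lemma Cn_bilin n X Y Z (U : set (X * Y)) (b : X * Y -> Z) :
  (forall x, linear (fun y => b (x, y))) -> (forall y, linear (fun x => b (x, y))) ->
  continuous b -> Cn n U b.
Proof.
move=> lr ll cb; elim: n U => [|n IH] U; split => //; try by move=> x _; exact: cb.
exists (fun p => b (p.1.1, p.2.2) + b (p.2.1, p.1.2)).
split; first exact: has_derivative_bilin.
have C (V : set ((X * Y) * (X * Y))) (f : (X * Y) * (X * Y) -> X * Y) :
    (forall m, Cn m V f) -> Cn n V (b \o f).
  by move=> Cf; apply: (@Cn_comp _ _ _ _ V setT).
apply: CnD.
  apply: (C _ (fun p => (p.1.1, p.2.2))) => m; apply: Cn_pair.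
    by apply: (@Cn_comp _ _ _ _ _ setT fst fst) => //; exact: Cn_fst.
  by apply: (@Cn_comp _ _ _ _ _ setT snd snd) => //; exact: Cn_snd.
apply: (C _ (fun p => (p.2.1, p.1.2))) => m; apply: Cn_pair.
  by apply: (@Cn_comp _ _ _ _ _ setT snd fst) => //; [exact: Cn_snd|exact: Cn_fst].
by apply: (@Cn_comp _ _ _ _ _ setT fst snd) => //; [exact: Cn_fst|exact: Cn_snd].
Qed.

End Calculus.

(** * The mean value inequality *)

Section MeanValue.
Context (R : realType) (W : normedModType R).

Lemma local_lipschitz (k : R -> W) (s : R) (d : W) (C : R) :
  (fun t => t^-1 *: (k (s + t) - k s)) @ (0 : R)^' --> d -> `|d| < C ->
  exists2 e, 0 < e & forall u, `|u - s| < e -> `|k u - k s| <= C * `|u - s|.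
Proof.
move=> kd dC; have : nbhs (0 : R) [set t | t != 0 -> `|t^-1 *: (k (s + t) - k s)| < C].
  exact: (cvgr_norm_lt _ kd _ dC).
move=> /nbhs_ballP[e /= e0 he].
exists e => // u us; have [->|us0] := eqVneq u s; first by rewrite !subrr !normr0 mulr0.
have := he (u - s); rewrite /ball /= sub0r normrN subr_eq0 => /(_ us us0).
rewrite normrZ addrCA subrr addr0 normfV ltr_pdivrMl ?normr_gt0 ?subr_eq0 //.
by rewrite mulrC => /ltW.
Qed.

(** For each e, the supremum of the times up to which
|k s - k 0| <= (C + e) s holds is attained, and equals 1: at a
smaller time local_lipschitz would extend the bound to the right. *)
Lemma mean_value01 (k dk : R -> W) (C : R) :
  (forall s, 0 <= s <= 1 ->
     (fun t => t^-1 *: (k (s + t) - k s)) @ (0 : R)^' --> dk s) ->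
  (forall s, 0 <= s <= 1 -> `|dk s| <= C) -> `|k 1 - k 0| <= C.
Proof.
move=> kd dC; apply/ler_addgt0Pr => e e0; pose C' := C + e.
have C'0 : 0 <= C'.
  by apply: addr_ge0 (ltW e0); apply: le_trans (dC 0 _); rewrite ?lexx ?ler01.
have loc s : 0 <= s <= 1 -> exists2 e, 0 < e &
    forall u, `|u - s| < e -> `|k u - k s| <= C' * `|u - s|.
  move=> s01; apply: local_lipschitz (kd s s01) _.
  by rewrite /C'; have := dC s s01; lra.
pose S := [set t | 0 <= t <= 1 /\ forall s, 0 <= s <= t -> `|k s - k 0| <= C' * s].
have S0 : S 0.
  split; first by rewrite lexx ler01.
  move=> s /andP[s0 s1]; have -> : s = 0 by apply/eqP; rewrite eq_le s0 s1.
  by rewrite subrr normr0 mulr0.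
have hS : has_sup S by split; [exists 0|exists 1 => t [/andP[]]].
set t := sup S.
have t0 : 0 <= t by exact: sup_upper_bound.
have t1 : t <= 1 by apply: ge_sup => [|x [/andP[]]//]; exists 0.
have St : S t.
  split; first by rewrite t0 t1.
  have lt s : 0 <= s < t -> `|k s - k 0| <= C' * s.
    move=> /andP[s0 st]; have [u Su su] := @sup_adherent _ _ (t - s) ltac:(lra) hS.
    by have [_] := Su; apply; rewrite s0 /=; move: su; rewrite -/t; lra.
  move=> s /andP[s0]; rewrite le_eqVlt => /predU1P[->|st]; last by apply: lt; rewrite s0.
  have [t00|tn0] := eqVneq t 0; first by rewrite t00 subrr normr0 mulr0.
  have tp : 0 < t by rewrite lt_neqAle eq_sym tn0.
  have [d d0 hd] := loc t ltac:(by rewrite t0 t1).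
  pose u := Num.max (t / 2) (t - d / 2).
  have u0 : 0 <= u by rewrite le_max; apply/orP; left; lra.
  have ut : u < t by rewrite gt_max; apply/andP; split; lra.
  have ud : t - d / 2 <= u by rewrite le_max lexx orbT.
  have := hd u; rewrite distrC ger0_norm; last by lra.
  move=> /(_ ltac:(lra)) h1; have h2 := lt u ltac:(by rewrite u0 ut).
  have -> : k t - k 0 = (k u - k 0) - (k u - k t).
    by zmod.
  apply: le_trans (ler_normB _ _) _; apply: le_trans (lerD h2 h1) _.
  by rewrite -mulrDr addrCA subrr addr0.
(* t < 1 would contradict the choice of t as a supremum *)
have [t1'|tn1] := eqVneq t 1.
  by have [_] := St; move=> /(_ 1); rewrite mulr1 t1'; apply; rewrite ler01 lexx.
have tl1 : t < 1 by rewrite lt_neqAle tn1.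
have [d d0 hd] := loc t ltac:(by rewrite t0 t1).
pose u := Num.min 1 (t + d / 2).
have tu : t < u by rewrite lt_min; apply/andP; split; lra.
have u1 : u <= 1 by rewrite ge_min lexx.
have ud : u <= t + d / 2 by rewrite ge_min lexx orbT.
suff : S u by move=> /(sup_upper_bound hS); rewrite -/t; lra.
split; first by apply/andP; split; lra.
move=> s /andP[s0 su]; have [st|ts] := leP s t.
  by have [_] := St; apply; rewrite s0.
have := hd s; rewrite ger0_norm; last by lra.
move=> /(_ ltac:(lra)) h1; have [_ /(_ t)] := St; rewrite t0 lexx => /(_ isT) h2.
rewrite -[k s](subrK (k t)) -addrA; apply: le_trans (ler_normD _ _) _.
by apply: le_trans (lerD h1 h2) _; rewrite -mulrDr subrK.
Qed.

End MeanValue.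

Section Segment.
Context (R : realType).
Implicit Types (X Y : tvsType R).

Lemma near_neq0 : \forall t \near (0 : R)^', t != 0.
Proof. by apply: (@filterE _ (nbhs (0 : R))). Qed.

Lemma cvg_dir X Y (f : X -> Y) (x v : X) (y : Y) :
  (fun p : R * X => p.1^-1 *: (f (x + p.1 *: p.2) - f x))
      @ filter_prod 0^' (nbhs v) --> y ->
  (fun t : R => t^-1 *: (f (x + t *: v) - f x)) @ (0 : R)^' --> y.
Proof.
have c : (fun t : R => (t, v)) @ (0 : R)^' `=>` filter_prod 0^' (nbhs v).
  apply: cvg_filter_prod => [A //|A /nbhs_singleton Av].
  by apply: (@filterE _ (0 : R)^') => t.
by move=> h; exact: cvg_comp c h.
Qed.

Lemma has_derivative_dir X Y (U : set X) (f : X -> Y) df x v :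
  has_derivative U f df -> U x ->
  (fun t : R => t^-1 *: (f (x + t *: v) - f x)) @ (0 : R)^' --> df (x, v).
Proof. by move=> hf Ux; have [_ /(_ v)] := hf x Ux; exact: cvg_dir. Qed.

(** Subtracting w, the value of a linear map at h, gives the form in which the
inequality compares an increment of g with a candidate derivative. *)
Lemma mean_value_segment X (W : normedModType R) (U : set X) (g : X -> W)
    (dg : X * X -> W) (x h : X) (w : W) (C : R) :
  has_derivative U g dg ->
  (forall s : R, 0 <= s <= 1 -> U (x + s *: h)) ->
  (forall s : R, 0 <= s <= 1 -> `|dg (x + s *: h, h) - w| <= C) ->
  `|g (x + h) - g x - w| <= C.
Proof.
move=> hg Uh hC.
have := @mean_value01 R W (fun s => g (x + s *: h) - s *: w)
  (fun s => dg (x + s *: h, h) - w) C.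
rewrite !scale1r !scale0r !addr0 subr0 addrAC; apply => // s s01.
have := has_derivative_dir (v := h) hg (Uh s s01) => c.
have : (fun t : R => t^-1 *: (g (x + s *: h + t *: h) - g (x + s *: h)) - w) @ (0 : R)^' -->
    dg (x + s *: h, h) - w by apply: cvgB c (cvg_cst _).
apply: cvg_trans; apply: near_eq_cvg; apply: filterS near_neq0 => t t0.
rewrite [X in _ = t^-1 *: X](_ : _ =
  (g (x + s *: h + t *: h) - g (x + s *: h)) - t *: w); last first.
  have -> : x + (s + t) *: h = x + s *: h + t *: h by rewrite scalerDl addrA.
  by rewrite scalerDl; zmod.
by rewrite [RHS]scalerBr scalerA mulVf // scale1r.
Qed.

Lemma convex_nbhs X (x : X) (U : set X) : nbhs x U ->
  exists2 V, nbhs x V & V `<=` U /\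
    forall h (s : R), 0 <= s <= 1 -> V (x + h) -> V (x + s *: h).
Proof.
move=> Ux; have [B cB [oB /(_ x U Ux) [b [Bb bx] bU]]] := @locally_convex R X.
exists b; first by apply: open_nbhs_nbhs; split => //; exact: oB.
split => // h s /andP[s0 s1] bh.
have := cB _ (mem_set Bb) (x + h) x (Itv01 s0 s1) (mem_set bh) (mem_set bx).
rewrite inE; congr (b _).
by rewrite /conv /= /unstable.onem scalerDr scalerBl scale1r; zmod.
Qed.

End Segment.

(** * Maps into spaces with initial topology, and into normed spaces *)

Section Initial.
Context (R : realType).
Implicit Types (X Y : tvsType R).

(** The maps p j identify Y, with its topology, with a closed subspace of the
product of the Z j. The last condition is closedness: a family of limits of the
coordinates of points of Y consists of the coordinates of a point of Y. *)
Definition initial_family Y (J : Type) (Z : J -> tvsType R)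
    (p : forall j, {linear Y -> Z j}) :=
  [/\ forall x y, (forall j, p j x = p j y) -> x = y,
      forall j, continuous (p j),
      forall (F : set_system Y) y, Filter F ->
        (forall j, p j @ F --> p j y) -> F --> y &
      forall (F : set_system Y) (z : forall j, Z j), ProperFilter F ->
        (forall j, p j @ F --> z j) -> exists y, forall j, p j y = z j].

Section Family.
Context Y (J : Type) (Z : J -> tvsType R) (p : forall j, {linear Y -> Z j}).
Hypothesis pI : initial_family p.

Lemma initial_cvg {T : Type} (F : set_system T) (f : T -> Y) (y : Y) : Filter F ->
  (forall j, (fun t => p j (f t)) @ F --> p j y) -> f @ F --> y.
Proof. by move=> FF h; case: pI => _ _ c _; apply: c. Qed.

(** The derivatives of the coordinates are limits of coordinates of difference
quotients, hence by closedness the coordinates of a map into Y. *)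
Lemma initial_derivative X (U : set X) (f : X -> Y) (df : forall j, X * X -> Z j) :
  (forall j, has_derivative U (fun x => p j (f x)) (df j)) ->
  exists dF, has_derivative U f dF /\
    forall x v j, U x -> p j (dF (x, v)) = df j (x, v).
Proof.
move=> hd; have [inj cp ini cl] := pI.
have ex (q : X * X) : exists y : Y, U q.1 -> forall j, p j y = df j q.
  have [Uq|nUq] := pselect (U q.1); last by exists 0.
  case: q Uq => x v /= Ux.
  pose F := (fun t : R => t^-1 *: (f (x + t *: v) - f x)) @ (0 : R)^'.
  have FF : ProperFilter F by exact: fmap_proper_filter.
  suff [y hy] : exists y, forall j, p j y = df j (x, v) by exists y.
  apply: (cl F) => j; have := has_derivative_dir (v := v) (hd j) Ux.
  move=> h; have h2 : (fun t : R => p j (t^-1 *: (f (x + t *: v) - f x))) @ (0 : R)^' -->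
      df j (x, v).
    apply: cvg_trans h; apply: near_eq_cvg; apply: filterE => t.
    by rewrite (linearZ_LR (p j)) (linearB (p j)).
  exact: h2.
pose dF q := proj1_sig (cid (ex q)).
have dFE x v j : U x -> p j (dF (x, v)) = df j (x, v).
  by move=> Ux; rewrite /dF; case: cid => y /= /(_ Ux).
exists dF; split => // x Ux; split.
  move=> a u v /=; apply: inj => j; rewrite linearD linearZ /= !dFE //.
  by have [/(_ a u v)] := hd j x Ux.
move=> v; apply: initial_cvg => j; rewrite dFE //.
have [_ /(_ v)] := hd j x Ux; apply: cvg_trans.
by apply: near_eq_cvg; apply: filterE => q; rewrite (linearZ_LR (p j)) (linearB (p j)).
Qed.

End Family.

(** Smoothness into E^n, into F and into the limits of operator spaces is always
checked on coordinates through this lemma. *)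
Lemma Cn_initial n X Y (J : Type) (Z : J -> tvsType R)
    (p : forall j, {linear Y -> Z j}) (U : set X) (f : X -> Y) :
  initial_family p -> open U -> (forall j, Cn n U (fun x => p j (f x))) -> Cn n U f.
Proof.
move=> pI; elim: n X U f => [|n IH] X U f oU Cf.
  by split=> // x Ux; apply: (initial_cvg pI) => j; exact: (Cn_cont (Cf j)).
split.
  by move=> x Ux; apply: (initial_cvg pI) => j; exact: (Cn_cont (Cf j)).
have [df hdf] : exists df : forall j, X * X -> Z j, forall j,
    has_derivative U (fun x => p j (f x)) (df j) /\ Cn n (U `*` [set: X]) (df j).
  have h j : exists df : X * X -> Z j,
      has_derivative U (fun x => p j (f x)) df /\ Cn n (U `*` [set: X]) df.
    by case: (Cf j) => _ [df]; exists df.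
  by exists (fun j => proj1_sig (cid (h j))) => j; case: cid.
have [dF [hF dFE]] := initial_derivative pI (fun j => proj1 (hdf j)).
exists dF; split => //.
have oU2 : open (U `*` [set: X]) by apply: openX => //; exact: openT.
apply: IH => // j; apply: Cn_eq (proj2 (hdf j)) => // -[x v] [Ux _].
by rewrite dFE.
Qed.

Lemma smooth_initial X Y (J : Type) (Z : J -> tvsType R)
    (p : forall j, {linear Y -> Z j}) (U : set X) (f : X -> Y) :
  initial_family p -> open U -> (forall j, smooth_on U (fun x => p j (f x))) ->
  smooth_on U f.
Proof. by move=> pI oU h n; apply: Cn_initial pI oU _ => j; exact: h. Qed.

End Initial.

Section Normed.
Context (R : realType).
Implicit Types (X Y : tvsType R) (V W : normedModType R).

Lemma has_derivative_unique X W (U : set X) (f : X -> W) df dg x v :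
  has_derivative U f df -> has_derivative U f dg -> U x -> df (x, v) = dg (x, v).
Proof.
move=> hf hg Ux.
have := has_derivative_dir (v := v) hf Ux; have := has_derivative_dir (v := v) hg Ux.
by move=> h1 h2; exact: (cvg_unique (@norm_hausdorff _ W) h2 h1).
Qed.

(** A smooth map comes with one derivative for each order n. In a separated target
all of them agree on U, so that a single derivative is smooth. *)
Lemma smooth_derivative X W (U : set X) (f : X -> W) : open U -> smooth_on U f ->
  exists df, has_derivative U f df /\ smooth_on (U `*` [set: X]) df.
Proof.
move=> oU Sf; have [_ [df [hf _]]] := Sf 1%N; exists df; split => // n.
have [_ [dg [hg Cg]]] := Sf n.+1.
apply: Cn_eq Cg => [|[x v] [Ux _]]; first by apply: openX => //; exact: openT.
exact: has_derivative_unique hg hf Ux.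
Qed.

Lemma has_derivative_derive V W (U : set V) (f : V -> W) df x v :
  has_derivative U f df -> U x -> derivable f x v /\ 'D_v f x = df (x, v).
Proof.
move=> hf Ux; have h := has_derivative_dir (v := v) hf Ux.
have h' : (fun t => t^-1 *: ((f \o shift x) (t *: v) - f x)) @ (0 : R)^' --> df (x, v).
  by apply: cvg_trans h; apply: near_eq_cvg; apply: filterE => t; rewrite /= [x + _]addrC.
split; first by apply/cvg_ex; exists (df (x, v)).
exact: cvg_lim.
Qed.

Lemma clin_lin V W (f : clin V W) : linear (fun x => fam f x : W).
Proof. exact: (famP f).1. Qed.

Lemma clin0 V W (f : clin V W) : fam f 0 = 0 :> W.
Proof. exact: linear0 (clin_linear f). Qed.

Lemma clinD V W (f : clin V W) x y : fam f (x + y) = fam f x + fam f y :> W.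
Proof. exact: linearD (clin_linear f) x y. Qed.

Lemma clinB V W (f : clin V W) x y : fam f (x - y) = fam f x - fam f y :> W.
Proof. exact: linearB (clin_linear f) x y. Qed.

Lemma clinZ V W (f : clin V W) (a : R) x : fam f (a *: x) = a *: fam f x :> W.
Proof. exact: linearZ_LR (clin_linear f) a x. Qed.

Lemma famB V W (f g : clin V W) x : fam (f - g) x = fam f x - fam g x :> W.
Proof. by rewrite -[- g]scaleN1r famD famZ scaleN1r. Qed.

Lemma opnorm_bound V W (f : clin V W) (x : V) : `|fam f x : W| <= `|f| * `|x|.
Proof.
have [->|x0] := eqVneq x 0.
  by rewrite clin0 !normr0 mulr0.
have xp : 0 < `|x| by rewrite normr_gt0.
have := @opnorm_ub R V W f (`|x|^-1 *: x).
rewrite normrZ normfV normr_id mulVf ?normr_eq0 // lexx => /(_ isT).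
rewrite clinZ normrZ normfV normr_id ler_pdivrMl //.
by rewrite mulrC.
Qed.

Lemma clin_norm_le V W (f : clin V W) (C : R) : 
  (forall x : V, `|x| <= 1 -> `|fam f x : W| <= C) -> `|f| <= C.
Proof. exact: opnorm_le. Qed.

(** This is what lets the smoothness of a map into clin V W be used pointwise. *)
Lemma clin_eval_continuous V W : continuous (fun p : clin V W * V => fam p.1 p.2 : W).
Proof.
move=> [f x]; apply/cvgrPdist_le => e e0.
pose d := e / (`|f| + `|x| + 1 + e).
have f0 := normr_ge0 f; have x0 := normr_ge0 x.
have D0 : 0 < `|f| + `|x| + 1 + e by lra.
have d0 : 0 < d by rewrite divr_gt0.
have d1 : d <= 1 by rewrite ler_pdivrMr // mul1r; lra.
near=> p.
have p1 : `|f - p.1| <= d.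
  near: p; apply: (@cvgr_dist_le _ _ _ (nbhs (f, x)) _ fst f) => //; exact: cvg_fst.
have p2 : `|x - p.2| <= d.
  near: p; apply: (@cvgr_dist_le _ _ _ (nbhs (f, x)) _ snd x) => //; exact: cvg_snd.
have -> : (fam f x : W) - fam p.1 p.2 = fam f (x - p.2) + fam (f - p.1) p.2.
  rewrite clinB famB; zmod.
apply: le_trans (ler_normD _ _) _.
have b1 : `|fam f (x - p.2) : W| <= `|f| * d.
  by apply: le_trans (opnorm_bound _ _) _; apply: ler_wpM2l.
have b2 : `|fam (f - p.1) p.2 : W| <= d * (`|x| + 1).
  apply: le_trans (opnorm_bound _ _) _; apply: ler_pM => //.
  rewrite -[p.2](subrK x); apply: le_trans (ler_normD _ _) _.
  by rewrite addrC lerD2l distrC (le_trans p2).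
apply: le_trans (lerD b1 b2) _.
rewrite mulrC -mulrDr /d mulrAC ler_pdivrMr // ler_pM2l //; lra.
Unshelve. all: by end_near. Qed.

End Normed.

(** * Smooth maps into spaces of operators *)

Section Smooth.
Context (R : realType).
Implicit Types (X Y Z : tvsType R) (V W : normedModType R).

Lemma linear_fun0 X Y (f : X -> Y) : linear f -> f 0 = 0.
Proof. by move=> /(_ (-1) 0 0); rewrite scaler0 addr0 scaleN1r addNr. Qed.

Lemma linear_funZ X Y (f : X -> Y) (a : R) x : linear f -> f (a *: x) = a *: f x.
Proof. by move=> lf; have := lf a x 0; rewrite addr0 (linear_fun0 lf) addr0. Qed.

Lemma smooth_cont X Y (U : set X) (f : X -> Y) :
  smooth_on U f -> forall x, U x -> {for x, continuous f}.
Proof. by move=> /(_ 0%N) /Cn_cont. Qed.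

Lemma smooth_sub X Y (U U' : set X) (f : X -> Y) :
  U' `<=` U -> smooth_on U f -> smooth_on U' f.
Proof. by move=> UU' h n; exact: Cn_sub UU' (h n). Qed.

Lemma smooth_eq X Y (U : set X) (f g : X -> Y) : open U ->
  (forall x, U x -> f x = g x) -> smooth_on U f -> smooth_on U g.
Proof. by move=> oU fg h n; exact: Cn_eq oU fg (h n). Qed.

Lemma smooth_comp X Y Z (U : set X) (V : set Y) (f : X -> Y) (g : Y -> Z) :
  (forall x, U x -> V (f x)) -> smooth_on U f -> smooth_on V g ->
  smooth_on U (fun x => g (f x)).
Proof. by move=> UV hf hg n; exact: Cn_comp UV (hf n) (hg n). Qed.

Lemma smooth_pair X Y Z (U : set X) (f : X -> Y) (g : X -> Z) :
  smooth_on U f -> smooth_on U g -> smooth_on U (fun x => (f x, g x)).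
Proof. by move=> hf hg n; exact: Cn_pair. Qed.

Lemma smooth_lin X Y (U : set X) (f : {linear X -> Y}) :
  continuous f -> smooth_on U f.
Proof. by move=> cf n; exact: Cn_lin. Qed.

Lemma smooth_cst X Y (U : set X) (y : Y) : smooth_on U (fun=> y).
Proof. by move=> n; exact: Cn_cst. Qed.

Lemma smooth_id X (U : set X) : smooth_on U id.
Proof. by move=> n; exact: Cn_id. Qed.

Lemma smooth_fst X Y Z (U : set X) (f : X -> Y * Z) :
  smooth_on U f -> smooth_on U (fun x => (f x).1).
Proof. by move=> h; apply: (smooth_comp (V := setT)) h _ => // n; exact: Cn_fst. Qed.

Lemma smooth_snd X Y Z (U : set X) (f : X -> Y * Z) :
  smooth_on U f -> smooth_on U (fun x => (f x).2).
Proof. by move=> h; apply: (smooth_comp (V := setT)) h _ => // n; exact: Cn_snd. Qed.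

Lemma smoothD X Y (U : set X) (f g : X -> Y) :
  smooth_on U f -> smooth_on U g -> smooth_on U (fun x => f x + g x).
Proof. by move=> hf hg n; exact: CnD. Qed.

Lemma smoothZ X Y (U : set X) (a : X -> R^o) (f : X -> Y) :
  smooth_on U a -> smooth_on U f -> smooth_on U (fun x => (a x : R) *: f x).
Proof.
move=> ha hf; apply: (smooth_comp (V := setT)
  (g := fun p : R^o * Y => (p.1 : R) *: p.2) _ (smooth_pair ha hf)) => // n.
apply: Cn_bilin; last exact: scale_continuous.
  by move=> a' b x y; rewrite /= scalerDr !scalerA mulrC.
by move=> y b x x'; rewrite /= scalerDl scalerA.
Qed.

Lemma smooth_sum (I : Type) (r : seq I) (P : pred I) X Y (U : set X)
    (f : I -> X -> Y) : (forall i, P i -> smooth_on U (f i)) ->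
  smooth_on U (fun x => \sum_(i <- r | P i) f i x).
Proof.
move=> h; elim: r => [|i r IH].
  by under eq_fun do rewrite big_nil; exact: smooth_cst.
under eq_fun do rewrite big_cons; case Pi : (P i) => //.
by apply: smoothD => //; exact: h.
Qed.

Lemma smooth_eval X V W (U : set X) (l : X -> clin V W) (y : X -> V) :
  smooth_on U l -> smooth_on U y -> smooth_on U (fun x => fam (l x) (y x) : W).
Proof.
move=> hl hy; apply: (smooth_comp (V := setT)
  (g := fun p : clin V W * V => fam p.1 p.2 : W) _ (smooth_pair hl hy)) => // n.
apply: Cn_bilin; last exact: clin_eval_continuous.
  by move=> f; exact: clin_lin.
by move=> x a f g.
Qed.

Section Curry.

(** Since dg vanishes at ((x, 0), 0), it is bounded by 1 on a neighbourhood of that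
point. By linearity in the direction, the mean value inequality bounds
g (y, v) - g (x, v) by k as soon as |v| <= r and (y - x) / k is small, and
homogeneity in v turns this into a bound on the operator norm. *)
Lemma curry_continuous X V W (U : set X) (g : X * V -> W) (gh : X -> clin V W) :
  open U -> (forall x v, U x -> fam (gh x) v = g (x, v)) ->
  Cn 1 (U `*` [set: V]) g -> forall x, U x -> {for x, continuous gh}.
Proof.
move=> oU ghE [cg [dg [hg Cg]]] x Ux; apply/cvgrPdist_le => e e0.
have dg0 y w : U y -> dg ((y, w), 0) = 0.
  move=> Uy; have [l _] := hg (y, w) (conj Uy I).
  exact: (linear_fun0 l).
have := Cg.1 ((x, 0), 0) (conj (conj Ux I) I).
move=> /cvgrPdist_le /(_ 1 ltr01) /=; rewrite dg0 //.
move=> [[A B]] /= [[[A1 A2] /= [A1x A20] AA] [[B1 B2] /= [B10 B20] BB]] hAB.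
(* the segment from x to a nearby point y must stay in the region of control *)
have [C Cx [CU Cconv]] := convex_nbhs (filterI A1x (open_nbhs_nbhs (conj oU Ux))).
have /nbhs_ballP[d /= d0 hd] := A20.
pose r := d / 2; have r0 : 0 < r by rewrite divr_gt0.
have {}hd v : `|v| <= r -> A2 v.
  move=> vr; apply: hd; rewrite -ball_normE /= sub0r normrN.
  by apply: le_lt_trans vr _; rewrite /r; lra.
pose k := e * r; have k0 : 0 < k by rewrite mulr_gt0.
have kB : \forall y \near x, B1 (k^-1 *: (y - x)).
  have c : (fun y => k^-1 *: (y - x)) @ x --> k^-1 *: (x - x).
    by apply: cvgZtvs; [exact: cvg_cst|apply: cvgDtvs; [exact: cvg_id|exact: cvg_cst]].
  by apply: c; rewrite subrr scaler0.
near=> y.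
have Cy : C y by near: y.
have By : B1 (k^-1 *: (y - x)) by near: y.
have yE : x + (y - x) = y by rewrite addrC subrK.
have Uy : U y by case: (CU y Cy).
have bnd v : `|v| <= r -> `|g (y, v) - g (x, v)| <= k.
  move=> vr.
  have := mean_value_segment (x := (x, v)) (h := (y - x, 0)) (w := 0) (C := k) hg.
  rewrite subr0 -[X in g X](_ : (y, v) = _); last first.
    by rewrite -[in LHS]yE -[v in LHS]addr0.
  apply=> s s01; have Cs : C (x + s *: (y - x)) by apply: Cconv => //; rewrite yE.
    by split => //; case: (CU _ Cs).
  rewrite subr0; have [A1s Us] := CU _ Cs.
  have [l _] := hg (x + s *: (y - x), v) (conj Us I).
  have -> : dg ((x, v) + s *: (y - x, 0), (y - x, 0)) =
     k *: dg ((x + s *: (y - x), v), (k^-1 *: (y - x), 0)).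
    rewrite -(linear_funZ _ _ l) /=.
    have -> : k *: (k^-1 *: (y - x), 0 : V) = (y - x, 0).
      by congr (_, _); rewrite /= ?scaler0 // scalerA mulfV ?gt_eqF // scale1r.
    by congr dg; congr (_, _); congr (_, _); rewrite /= scaler0 addr0.
  rewrite normrZ gtr0_norm // -[leRHS]mulr1 ler_pM2l //.
  have := hAB ((x + s *: (y - x), v), (k^-1 *: (y - x), 0)); rewrite /= sub0r normrN.
  apply; split; first by apply: AA; split => //=; exact: hd.
  by apply: BB; split => //=; exact: nbhs_singleton.
apply: clin_norm_le => v v1.
rewrite famB !ghE // distrC -(ler_pM2l r0) -{1}(gtr0_norm r0) -normrZ.
rewrite scalerBr.
have gZ z : U z -> r *: g (z, v) = g (z, r *: v).
  by move=> Uz; rewrite -!ghE // clinZ.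
rewrite !gZ // [r * e]mulrC; apply: bnd.
by rewrite normrZ gtr0_norm // -[leRHS]mulr1 ler_pM2l.
Unshelve. all: by end_near. Qed.

(** The partial derivative is a pointwise limit of maps that are linear in v. *)
Lemma partial_linear X V W (U : set X) (g : X * V -> W) (dg : (X * V) * (X * V) -> W) :
  open U -> (forall x, U x -> linear (fun v => g (x, v))) ->
  has_derivative (U `*` [set: V]) g dg ->
  forall x h, U x -> linear (fun v => dg ((x, v), (h, 0))).
Proof.
move=> oU lg hg x h Ux a v w.
have c u : (fun t : R => t^-1 *: (g (x + t *: h, u) - g (x, u))) @ (0 : R)^' -->
    dg ((x, u), (h, 0)).
  have := has_derivative_dir (v := (h, 0)) hg (conj Ux I : (U `*` setT) (x, u)).
  apply: cvg_trans; apply: near_eq_cvg; apply: filterE => t.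
  by congr (_ *: (g _ - _)); congr (_, _); rewrite /= scaler0 addr0.
have c1 := c (a *: v + w).
have c2 : (fun t : R => a *: (t^-1 *: (g (x + t *: h, v) - g (x, v))) +
   t^-1 *: (g (x + t *: h, w) - g (x, w))) @ (0 : R)^' -->
   a *: dg ((x, v), (h, 0)) + dg ((x, w), (h, 0)).
  by apply: cvgD; [apply: cvgZr|]; exact: c.
apply: (cvg_unique (@norm_hausdorff _ W) c1); apply: cvg_trans c2.
apply: near_eq_cvg.
have : \forall t \near (0 : R)^', U (x + t *: h).
  have cl : (fun t : R => x + t *: h) @ (0 : R)^' --> x.
    rewrite -[X in _ --> X]addr0 -(scale0r h); apply: cvgDtvs; first exact: cvg_cst.
    by apply: cvgZtvs; [exact: cvg_within|exact: cvg_cst].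
  by apply: cl; exact: open_nbhs_nbhs.
apply: filterS => t Ut; rewrite !lg //.
rewrite !scalerBr !scalerDr !scalerA [a * _]mulrC; zmod.
Qed.

(** Directional smoothness of g in both variables gives smoothness for the operator
norm: the partial derivative of g in the first variable is again smooth and
linear in v, so that by induction it defines a map gh1 into clin V W which is one
class less smooth than required of gh. The difference quotients of gh converge to
gh1 in norm by the mean value inequality and the continuity of gh1. *)
Lemma Cn_curry n X V W (U : set X) (g : X * V -> W) (gh : X -> clin V W) :
  open U -> (forall x v, U x -> fam (gh x) v = g (x, v)) ->
  smooth_on (U `*` [set: V]) g -> Cn n U gh.
Proof.
elim: n X U g gh => [|n IH] X U g gh oU ghE Sg.
  by split => // x Ux; exact: curry_continuous ghE (Sg 1%N) x Ux.
split; first by move=> x Ux; exact: curry_continuous ghE (Sg 1%N) x Ux.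
have oUV : open (U `*` [set: V]) by apply: openX => //; exact: openT.
have [dg [hg Sdg]] := smooth_derivative oUV Sg.
have oU2 : open (U `*` [set: X]) by apply: openX => //; exact: openT.
have lg x : U x -> linear (fun v => g (x, v)).
  by move=> Ux a v w; rewrite -!ghE // clin_lin.
pose g1 (p : (X * X) * V) := dg ((p.1.1, p.2), (p.1.2, 0)).
have Sg1 : smooth_on ((U `*` [set: X]) `*` [set: V]) g1.
  apply: (smooth_comp (V := (U `*` [set: V]) `*` setT)
    (f := fun p : (X * X) * V => ((p.1.1, p.2), (p.1.2, 0 : V))) _ _ Sdg).
    by move=> [[x h] v] /= [[Ux _] _].
  apply: smooth_pair; apply: smooth_pair.
  - by do 2!apply: smooth_fst; exact: smooth_id.
  - by apply: smooth_snd; exact: smooth_id.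
  - by apply: smooth_snd; apply: smooth_fst; exact: smooth_id.
  - exact: smooth_cst.
have ex (p : X * X) : exists l : clin V W, U p.1 -> forall v, fam l v = g1 (p, v).
  have [Up|nU] := pselect (U p.1); last by exists 0.
  have cl : clin_set (fun v => g1 (p, v)).
    split; first by case: p Up => x h /= Ux; exact: partial_linear hg x h Ux.
    move=> v; have c := smooth_cont Sg1 (x := (p, v)) (conj (conj Up I) I).
    have c' : (fun w : V => (p, w)) @ v --> (p, v).
      exact: (cvg_pair (cvg_cst p) (@cvg_id _ (nbhs v))).
    exact: (cvg_comp _ _ c' c).
  by exists (Subfam (S := clin_subspace V W) cl).
pose gh1 p := proj1_sig (cid (ex p)).
have gh1E p v : U p.1 -> fam (gh1 p) v = g1 (p, v).
  by move=> Up; rewrite /gh1; case: cid => l /= /(_ Up).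
exists gh1; split; last first.
  by apply: (IH _ _ g1) => // -[x h] v [Ux _]; rewrite gh1E.
move=> x Ux; split=> [a u w|h0].
  apply: fam_inj => v; rewrite famD famZ !gh1E // /g1 /=.
  have [l _] := hg (x, v) (conj Ux I).
  by rewrite -l; congr dg; congr (_, _); congr (_, _); rewrite /= scaler0 addr0.
apply/cvgrPdist_le => e e0.
have := curry_continuous (gh := gh1) oU2 _ (Sg1 1%N) (x := (x, h0)) (conj Ux I).
move=> /(_ (fun p v Up => gh1E p v Up.1)) /cvgrPdist_le /(_ e e0).
move=> [[A B]] /= [Ax Bh] hAB.
have [C Cx [CU Cconv]] := convex_nbhs (filterI Ax (open_nbhs_nbhs (conj oU Ux))).
near=> p.
have p0 : p.1 != 0 by near: p; exact: near_line_neq0.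
have Cp : C (x + p.1 *: p.2) by near: p; exact: near_line.
have Bp : B p.2.
  near: p; have := @cvg_snd _ _ (0 : R)^' (nbhs h0) _ B Bh; exact.
apply: clin_norm_le => v v1.
have [_ Uxp] := CU _ Cp.
have -> : fam (gh1 (x, h0) - p.1^-1 *: (gh (x + p.1 *: p.2) - gh x)) v =
   - (p.1^-1 *: (g (x + p.1 *: p.2, v) - g (x, v) - p.1 *: g1 ((x, h0), v))) :> W.
  rewrite famB famZ famB !ghE // gh1E // [in RHS]scalerBr scalerA mulVf //.
  by rewrite scale1r opprB.
rewrite normrN normrZ normfV ler_pdivrMl ?normr_gt0 //.
have := mean_value_segment (x := (x, v)) (h := (p.1 *: p.2, 0))
  (w := p.1 *: g1 ((x, h0), v)) (C := `|p.1| * e) hg.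
rewrite -[X in g X](_ : (x + p.1 *: p.2, v) = _); last first.
  by rewrite -[v in LHS]addr0.
apply=> s s01; have Cs : C (x + s *: (p.1 *: p.2)) by exact: Cconv.
  by split => //; case: (CU _ Cs).
have [As Us] := CU _ Cs.
have -> : dg ((x, v) + s *: (p.1 *: p.2, 0), (p.1 *: p.2, 0)) =
    p.1 *: g1 ((x + s *: (p.1 *: p.2), p.2), v).
  rewrite /g1 /=.
  have [l _] := hg (x + s *: (p.1 *: p.2), v) (conj Us I).
  rewrite -(linear_funZ _ _ l) /=; congr dg; congr (_, _); congr (_, _).
    by rewrite /= scaler0 addr0.
  by rewrite /= scaler0.
rewrite -scalerBr normrZ ler_pM2l ?normr_gt0 //.
rewrite -!gh1E // -famB -[leRHS]mulr1.
apply: le_trans (opnorm_bound _ _) _; apply: ler_pM => //.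
by rewrite distrC; exact: (hAB (_, _)).
Unshelve. all: by end_near. Qed.

End Curry.

End Smooth.

(** * Coordinates on powers of E, on F and on the limit of operator tuples *)

Section Families.
Context (R : realType).

Section Npow.
Context (E : normedModType R) (n : nat).

Lemma npow_coord_linear (i : 'I_n) : linear (fun x : npow E n => x i).
Proof. by move=> a x y; rewrite !ffunE. Qed.

Definition npow_coord (i : 'I_n) : {linear npow E n -> E} :=
  HB.pack (fun x : npow E n => x i)
    (GRing.isLinear.Build R (npow E n) E *:%R _ (npow_coord_linear i)).

Lemma npow_coord_le (x : npow E n) (i : 'I_n) : `|x i| <= `|x|.
Proof. exact: (le_bigmax _ (fun k => `|x k|)). Qed.

Lemma npow_norm_le (x : npow E n) (C : R) : 0 <= C ->
  (forall i, `|x i| <= C) -> `|x| <= C.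
Proof. by move=> C0 h; apply: bigmax_le => // i _. Qed.

Lemma npow_coord_continuous (i : 'I_n) : continuous (npow_coord i).
Proof.
move=> x; have FF : Filter (nbhs (x : npow E n)) by exact: nbhs_filter.
apply/(@cvgrPdist_le R E _ (nbhs (x : npow E n)) FF) => e e0; near=> y.
have h : `|x - y| <= e.
  by near: y; apply: (@cvgr_dist_le R (npow E n) _ (nbhs x) _ id x _ e e0); exact: cvg_id.
rewrite -(linearB (npow_coord i)).
by apply: le_trans (npow_coord_le _ _) h.
Unshelve. all: by end_near. Qed.

Lemma npow_initial : initial_family npow_coord.
Proof.
split=> [x y xy||F y FF h|F z FF h].
- by apply/ffunP => i; exact: xy.
- exact: npow_coord_continuous.
- apply/cvgrPdist_le => e e0.
  have hi (i : 'I_n) : \forall x \near F, `|y i - (x : npow E n) i| <= e.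
    exact: (@cvgr_dist_le R E _ F FF (npow_coord i) _ (h i) e e0).
  have : F (fun x : npow E n => forall i : 'I_n, `|y i - x i| <= e) by exact: filter_forall.
  apply: filterS => x hx; apply: npow_norm_le (ltW e0) _ => i.
  by have := hx i; rewrite !ffunE.
- by exists [ffun i => z i] => i; rewrite /= ffunE.
Qed.

End Npow.

Section FFamily.
Context (E : normedModType R).

Lemma Fcoord_linear (k : nat) : linear (fun v : Fspace E => coordF v k ord_max).
Proof. by move=> a x y; rewrite !ffunE. Qed.

Definition Fcoord (k : nat) : {linear Fspace E -> E} :=
  HB.pack (fun v : Fspace E => coordF v k ord_max)
    (GRing.isLinear.Build R (Fspace E) E *:%R _ (Fcoord_linear k)).

Lemma mkF_subproof (z : nat -> E) :
  @plim_npow_set R E 1 (fun n => [ffun i : 'I_(1 + n) => z i]).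
Proof. by move=> n m h; apply/ffunP => i; rewrite !ffunE. Qed.

Definition mkF (z : nat -> E) : Fspace E :=
  Subfam (S := plim_npow_subspace E 1) (mkF_subproof z).

(** A compatible family is determined by the last coordinates of its members. *)
Lemma FcoordE (v : Fspace E) n (i : 'I_(1 + n)) : coordF v n i = Fcoord i v.
Proof.
have h : (1 + i <= 1 + n)%N by rewrite leq_add2l -ltnS.
have e : rho h (coordF v n) = coordF v i := famP v n i h.
rewrite -[RHS]/(coordF v i ord_max) -e ffunE.
by congr (coordF v n _); exact: val_inj.
Qed.

Lemma Fcoord_mkF z k : Fcoord k (mkF z) = z k.
Proof. by rewrite /= ffunE. Qed.

Lemma Fcoord_inj (v w : Fspace E) : (forall k, Fcoord k v = Fcoord k w) -> v = w.
Proof.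
move=> h; apply: fam_inj => n; apply/ffunP => i.
by have := FcoordE v i; have := FcoordE w i; rewrite /coordF h => -> ->.
Qed.

Lemma Fcoord_continuous k : continuous (Fcoord k).
Proof.
move=> v.
have c1 := @Defs.coord_continuous R nat (fun n => npow E (1 + n)) (plim_npow_subspace E 1) k v.
have c2 := @npow_coord_continuous E (1 + k) ord_max (coordF v k).
exact: (cvg_comp _ _ c1 c2).
Qed.

Lemma F_initial : initial_family Fcoord.
Proof.
split=> [||F v FF h|F z FF h].
- exact: Fcoord_inj.
- exact: Fcoord_continuous.
- apply: cvg_subprod => n; apply: (initial_cvg (@npow_initial E (1 + n))) => i.
  have -> : npow_coord E i (fam v n) = Fcoord i v by exact: FcoordE.
  have := h i; apply: cvg_trans; apply: near_eq_cvg; apply: filterE => w.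
  by rewrite -FcoordE.
- by exists (mkF z) => k; rewrite Fcoord_mkF.
Qed.

End FFamily.

Section EndFamily.
Context (E : normedModType R).

(** As for F, a point of the limit is determined by the last operator of each
tuple. *)
Definition plim_coord_fun (k : nat) (t : plim_end E) : clin (npow E k.+1) (npow E k.+1) :=
  tuple_end (trunc t k) ord_max.

Lemma plim_coord_linear k : linear (plim_coord_fun k).
Proof. by []. Qed.

Definition plim_coord (k : nat) : {linear plim_end E -> clin (npow E k.+1) (npow E k.+1)} :=
  HB.pack (plim_coord_fun k)
    (GRing.isLinear.Build R (plim_end E) _ *:%R _ (plim_coord_linear k)).

Lemma plim_coordE (t : plim_end E) n (j : 'I_n.+1) :
  tuple_end (trunc t n) j = plim_coord j t.
Proof.
have h : (j.+1 <= n.+1)%N by [].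
have e : tuple_end (trunc t n) (widen_ord h ord_max) = plim_coord j t.
  exact: (famP t n j h ord_max).
have <- : widen_ord h ord_max = j by exact: val_inj.
exact: e.
Qed.

Lemma plim_end_coord_inj (s t : plim_end E) :
  (forall k, plim_coord k s = plim_coord k t) -> s = t.
Proof.
move=> h; apply: fam_inj => n; apply: fam_inj => j.
by have := plim_coordE s j; have := plim_coordE t j; rewrite h => <-.
Qed.

Lemma plim_coord_continuous k : continuous (plim_coord k).
Proof.
move=> t.
have c1 := @Defs.coord_continuous R nat (end_tuple E)
  (Subspace (@plim_end_set0 R E) (@plim_end_setL R E)) k t.
have c2 := @Defs.coord_continuous R 'I_k.+1
  (fun j : 'I_k.+1 => clin (npow E j.+1) (npow E j.+1))
  (Subspace (@end_tuple_set0 R E k) (@end_tuple_setL R E k)) ord_max (fam t k).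
exact: (cvg_comp _ _ c1 c2).
Qed.

Lemma plim_compat (t : plim_end E) (j k : nat) (h : (k.+1 <= j.+1)%N) x :
  rho h (fam (plim_coord j t) x) = fam (plim_coord k t) (rho h x).
Proof.
have e := @plim_coordE t j (Ordinal h).
have := famP (trunc t j) ord_max (Ordinal h) h x.
by rewrite -[fam (trunc t j) (Ordinal h)]/(tuple_end (trunc t j) (Ordinal h)) e.
Qed.

Lemma mk_end_subproof1 (l : forall k, clin (npow E k.+1) (npow E k.+1))
  (hl : forall (j k : nat) (h : (k.+1 <= j.+1)%N) x,
     rho h (fam (l j) x) = fam (l k) (rho h x)) n :
  @end_tuple_set R E n (fun j => l j).
Proof. by move=> j k h x; exact: hl. Qed.

Lemma mk_end_subproof2 l hl :
  @plim_end_set R E (fun n => Subfam (S := Subspace (@end_tuple_set0 R E n)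
    (@end_tuple_setL R E n)) (@mk_end_subproof1 l hl n)).
Proof. by move=> n m h j. Qed.

Definition mk_end l hl : plim_end E :=
  Subfam (S := Subspace (@plim_end_set0 R E) (@plim_end_setL R E))
    (@mk_end_subproof2 l hl).

Lemma plim_coord_mk l hl k : plim_coord k (@mk_end l hl) = l k.
Proof. by []. Qed.

Lemma rho_continuous n m (h : (m <= n)%N) : continuous (@rho R E n m h).
Proof.
move=> x; have FF : Filter (nbhs (x : npow E n)) by exact: nbhs_filter.
apply: (@initial_cvg R _ _ _ _ (npow_initial E m) _ (nbhs (x : npow E n)) (rho h)
  (rho h x) FF) => i.
have -> : npow_coord E i (rho h x) = npow_coord E (widen_ord h i) x by rewrite /= ffunE.
have := @npow_coord_continuous E n (widen_ord h i) x.
by apply: cvg_trans; apply: near_eq_cvg; apply: filterE => y; rewrite /= ffunE.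
Qed.

(** Closedness: the relations rho (l_j x) = l_k (rho x) pass to limits because
evaluation at x is continuous. *)
Lemma plim_end_initial : initial_family (@plim_coord).
Proof.
split=> [||F t FF h|F l FF h].
- exact: plim_end_coord_inj.
- exact: plim_coord_continuous.
- apply: cvg_subprod => n.
  have FFn : Filter ((fun s : plim_end E => trunc s n) @ F) by exact: fmap_filter.
  apply: (@cvg_subprod R _ (fun j : 'I_n.+1 => clin (npow E j.+1) (npow E j.+1))
    _ _ (trunc t n) FFn) => j.
  have -> : fam (fam t n) j = plim_coord j t by exact: plim_coordE.
  have := h j; apply: cvg_trans.
  apply: (@near_eq_cvg _ _ F FF (fun s : plim_end E => plim_coord j s)
    (fun s => tuple_end (trunc s n) j)).
  by apply: filterE => s; rewrite plim_coordE.
- have hl (j k : nat) (hjk : (k.+1 <= j.+1)%N) x :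
     rho hjk (fam (l j) x) = fam (l k) (rho hjk x).
    have ev m (y : npow E m.+1) : (fun t => fam (plim_coord m t) y : npow E m.+1) @ F -->
        (fam (l m) y : npow E m.+1).
      exact: (cvg_fun2 FF (h m) (cvg_cst y)
        (@clin_eval_continuous R (npow E m.+1) (npow E m.+1) (l m, y))).
    have c1 := cvg_comp _ _ (ev j x) (@rho_continuous j.+1 k.+1 hjk (fam (l j) x)).
    have c2 := ev k (rho hjk x).
    apply: (cvg_unique (@norm_hausdorff _ (npow E k.+1)) c1).
    apply: cvg_trans c2; apply: near_eq_cvg; apply: filterE => t.
    exact: esym (plim_compat _ _ _).
  by exists (mk_end hl) => k; rewrite plim_coord_mk.
Qed.

End EndFamily.

End Families.

(** * Curves and their derivatives *)

Section Curves.
Context (R : realType).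
Implicit Types (X Y Z : tvsType R) (V W : normedModType R).

(** The derivative of a curve as a relation, for curves in any topological vector
space. *)
Definition cder X (g : R -> X) (t : R) (d : X) :=
  (fun h : R => h^-1 *: (g (t + h) - g t)) @ (0 : R)^' --> d.

Lemma near_translate (P : set R) (t : R) : (\forall s \near t, P s) ->
  \forall h \near (0 : R)^', P (t + h).
Proof.
move=> Pt; apply: nbhs_dnbhs.
have c : (fun h : R => t + h) @ (0 : R) --> t.
  rewrite -[X in _ --> X]addr0; apply: (@cvgD R R^o); [exact: cvg_cst|exact: cvg_id].
exact: c.
Qed.

Lemma cder_eq X (f g : R -> X) t d : (\forall s \near t, f s = g s) ->
  cder f t d -> cder g t d.
Proof.
move=> fg; apply: cvg_trans; apply: near_eq_cvg.
have := near_translate fg; apply: filterS => h <-.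
by rewrite (nbhs_singleton fg).
Qed.

Lemma cder_comp X Y (U : set X) (f : X -> Y) df (g : R -> X) t d :
  has_derivative U f df -> U (g t) -> cder g t d -> cder (fun s => f (g s)) t (df (g t, d)).
Proof.
move=> hf Ug hg; have [_ /(_ d) c] := hf _ Ug.
have c' : (fun h : R => (h, h^-1 *: (g (t + h) - g t))) @ (0 : R)^' `=>`
    filter_prod (0 : R)^' (nbhs d).
  exact: (@cvg_filter_prod _ _ _ (0 : R)^' _ _ id _ _ (fun A => id) hg).
apply: cvg_trans (cvg_comp _ _ c' c).
apply: (@near_eq_cvg _ _ (0 : R)^' _).
apply: filterS (near_neq0 R) => h h0 /=.
by rewrite scalerA mulfV // scale1r addrCA subrr addr0.
Qed.

Lemma cder_pair X Y (f : R -> X) (g : R -> Y) t d e :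
  cder f t d -> cder g t e -> cder (fun s => (f s, g s)) t (d, e).
Proof. by move=> hf hg; exact: (cvg_pair hf hg). Qed.

Lemma cder_cst X (x : X) t : cder (fun=> x) t 0.
Proof. by rewrite /cder; under eq_fun do rewrite subrr scaler0; exact: cvg_cst. Qed.

Lemma cder_lin X Y (f : {linear X -> Y}) (g : R -> X) t d : continuous f ->
  cder g t d -> cder (fun s => f (g s)) t (f d).
Proof.
move=> cf; apply: (@cder_comp X Y setT f (fun p => f p.2)) => //.
exact: has_derivative_lin.
Qed.

Lemma cderD X (f g : R -> X) t d e :
  cder f t d -> cder g t e -> cder (fun s => f s + g s) t (d + e).
Proof.
move=> hf hg; have := cvgDtvs (dnbhs_filter (0 : R)) hf hg; apply: cvg_trans; apply: near_eq_cvg.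
by apply: filterE => h; rewrite -scalerDr; congr (_ *: _); zmod.
Qed.

Lemma cderZ X (a : R) (f : R -> X) t d : cder f t d -> cder (fun s => a *: f s) t (a *: d).
Proof.
move=> hf; have : (fun h : R => a *: (h^-1 *: (f (t + h) - f t))) @ (0 : R)^' --> a *: d.
  by apply: cvgZtvs => //; exact: cvg_cst.
apply: cvg_trans; apply: near_eq_cvg.
by apply: filterE => h; rewrite -scalerBr !scalerA mulrC.
Qed.

Lemma cder_sum (I : Type) (r : seq I) X (f : I -> R -> X) (d : I -> X) t :
  (forall i, cder (f i) t (d i)) ->
  cder (fun s => \sum_(i <- r) f i s) t (\sum_(i <- r) d i).
Proof.
move=> h; elim: r => [|i r IH].
  rewrite big_nil (_ : (fun s => _) = fun=> 0); first exact: cder_cst.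
  by apply/funext => s; rewrite big_nil.
rewrite big_cons (_ : (fun s => _) = fun s => f i s + \sum_(j <- r) f j s).
  exact: cderD (h i) IH.
by apply/funext => s; rewrite big_cons.
Qed.

Lemma cder_initial X (J : Type) (Z : J -> tvsType R) (p : forall j, {linear X -> Z j})
    (g : R -> X) t d : initial_family p ->
  (forall j, cder (fun s => p j (g s)) t (p j d)) -> cder g t d.
Proof.
move=> pI h; apply: (initial_cvg pI) => j; have := h j; apply: cvg_trans.
by apply: near_eq_cvg; apply: filterE => s; rewrite (linearZ_LR (p j)) (linearB (p j)).
Qed.

Lemma cder_derive1 W (g : R -> W) t d : cder g t d -> derive1 g t = d.
Proof.
move=> h; apply: cvg_lim; first exact: norm_hausdorff.
apply: cvg_trans h; apply: near_eq_cvg.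
by apply: filterE => s; rewrite [s + t]addrC.
Qed.

Lemma cder_unique W (g : R -> W) t d e : cder g t d -> cder g t e -> d = e.
Proof. by move=> /cder_derive1 <- /cder_derive1 <-. Qed.

Lemma smooth_cder X (I : set R^o) (g : R -> X) df t :
  has_derivative (I : set R^o) (g : R^o -> X) df -> I t -> cder g t (df (t, 1 : R^o)).
Proof.
move=> hg It; have := has_derivative_dir (v := 1 : R^o) hg It.
by apply: cvg_trans; apply: near_eq_cvg; apply: filterE => h; rewrite [h *: _]mulr1.
Qed.

Lemma smooth_derive1 W (I : set R^o) (g : R -> W) : open I ->
  smooth_on I (g : R^o -> W) ->
  smooth_on I (derive1 g : R^o -> W) /\ forall t, I t -> cder g t (derive1 g t).
Proof.
move=> oI Sg; have [df [hg Sdf]] := smooth_derivative oI Sg.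
have h t : I t -> cder g t (derive1 g t).
  by move=> It; rewrite (cder_derive1 (smooth_cder hg It)); exact: smooth_cder hg It.
split => //; apply: (smooth_eq (f := fun t : R^o => df (t, 1 : R^o)) oI) => [t It|].
  by rewrite (cder_derive1 (smooth_cder hg It)).
apply: (smooth_comp (V := I `*` setT)) Sdf => //.
by apply: smooth_pair; [exact: smooth_id|exact: smooth_cst].
Qed.

Lemma smooth_derive1n W (I : set R^o) (g : R -> W) n : open I ->
  smooth_on I (g : R^o -> W) -> smooth_on I (derive1n n g : R^o -> W).
Proof.
by move=> oI Sg; elim: n => // n IH; exact: (smooth_derive1 oI IH).1.
Qed.

Lemma smooth_cdern W (I : set R^o) (g : R -> W) n t : open I ->
  smooth_on I (g : R^o -> W) -> I t -> cder (derive1n n g) t (derive1n n.+1 g t).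
Proof.
by move=> oI Sg; exact: (smooth_derive1 oI (smooth_derive1n n oI Sg)).2.
Qed.

(** The slope extended by the derivative at 0 avoids the case distinction on
vanishing increments, which occur below for the direction 0. *)
Lemma cder_slope X (g : R -> X) t d : cder g t d ->
  exists q : R -> X, q @ (0 : R) --> d /\ forall h, g (t + h) = g t + h *: q h.
Proof.
move=> hg; pose q h := if h == 0 then d else h^-1 *: (g (t + h) - g t).
exists q; split=> [A Ad|h].
  have : \forall h \near (0 : R)^', A (h^-1 *: (g (t + h) - g t)) by exact: hg.
  rewrite /dnbhs near_withinE => B; rewrite /nbhs /=.
  apply: filterS B => h hA; rewrite /= /q; case: eqVneq => [_|/hA//].
  exact: nbhs_singleton.
rewrite /q; case: eqVneq => [->|h0]; first by rewrite scale0r !addr0.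
by rewrite scalerA mulfV // scale1r addrCA subrr addr0.
Qed.

Lemma cder_cont X (g : R -> X) t d : cder g t d -> g @ t --> g t.
Proof.
move=> /cder_slope[q [cq gq]].
have c0 : (fun s : R => s - t) @ t --> (0 : R).
  by rewrite -(subrr t); apply: (@cvgB R R^o); [exact: cvg_id|exact: cvg_cst].
rewrite -[X in _ --> X]addr0 -(scale0r d).
have : (fun s : R => g t + (s - t) *: q (s - t)) @ t --> g t + 0 *: d.
  apply: cvgDtvs; first exact: cvg_cst.
  by apply: cvgZtvs => //; exact: cvg_comp c0 cq.
apply: cvg_trans; apply: near_eq_cvg; apply: filterE => s.
by rewrite -gq addrCA subrr addr0.
Qed.

(** With the extended slope q, the difference quotient of g at t with step s and
direction h is h * q (s h), also when h = 0. *)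
Lemma cder_has_derivative X (I : set R^o) (g g' : R -> X) :
  (forall t, I t -> cder g t (g' t)) ->
  has_derivative I (g : R^o -> X) (fun p => (p.2 : R) *: g' p.1).
Proof.
move=> hg t It; split=> [a u v|v] /=; first by rewrite scalerDl scalerA.
have [q [cq gq]] := cder_slope (hg t It).
pose F : set_system (R * R^o) := filter_prod (0 : R)^' (nbhs (v : R^o)).
have FF : Filter F by exact: filter_prod_filter.
have c2 : (fun p : R * R^o => p.2 : R^o) @ F --> (v : R^o) by exact: cvg_snd.
have c1 : (fun p : R * R^o => p.1 : R^o) @ F --> (0 : R^o).
  by move=> A A0; exact: (@cvg_fst _ _ (0 : R)^' _ _ A (nbhs_dnbhs A0)).
have c0 : (fun p : R * R^o => (p.1 * p.2 : R)) @ F --> (0 : R).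
  by rewrite -(mul0r v); exact: (@cvgM R _ F FF (fun p : R * R^o => p.1) (fun p => p.2) 0 v c1 c2).
have : (fun p : R * R^o => (p.2 : R) *: q (p.1 * p.2)) @ F --> v *: g' t.
  by apply: cvgZtvs => //; exact: cvg_comp c0 cq.
apply: cvg_trans; apply: near_eq_cvg.
apply: filterS (near_line_neq0 (v : R^o)) => -[s h] /= s0.
rewrite [s *: h]/(s * h) gq addrAC subrr add0r !scalerA mulrA mulVf // mul1r.
by [].
Qed.

(** A sequence of curves in which each is the derivative of the preceding one
consists of smooth curves, by induction on the class of all its members at once. *)
Lemma cder_smooth X (I : set R^o) (g : nat -> R -> X) : open I ->
  (forall m t, I t -> cder (g m) t (g m.+1 t)) ->
  forall m, smooth_on I (g m : R^o -> X).
Proof.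
move=> oI hg m n; elim: n m => [|n IH] m.
  by split => // t It; exact: cder_cont (hg m t It).
split; first by move=> t It; exact: cder_cont (hg m t It).
exists (fun p => (p.2 : R) *: g m.+1 p.1); split.
  by apply: cder_has_derivative => t; exact: hg.
apply: (@Cn_comp R n _ (R^o * X)%type X _ setT
  (fun p : R^o * R^o => (p.2 : R^o, g m.+1 p.1))
  (fun q : R^o * X => (q.1 : R) *: q.2)) => //.
  apply: Cn_pair; first exact: Cn_snd.
  by apply: (@Cn_comp R n _ R^o X _ I fst (g m.+1)) => //; [move=> p []|exact: Cn_fst].
apply: Cn_bilin; last exact: scale_continuous.
  by move=> a' b x y; rewrite /= scalerDr !scalerA mulrC.
by move=> y b x x'; rewrite /= scalerDl scalerA.
Qed.

End Curves.

(** * The operators of a linear connection *)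

Section ConnM.
Context (R : realType) (E : completeNormedModType R).
Variables (G : E -> clin E (clin E E)) (U : set E).
Hypotheses (oU : open U) (SG : smooth_on U G).
Implicit Types (u v : nat -> E) (y : E).

Lemma update_id u k : update u k (u k) = u.
Proof. by apply/funext => j; rewrite /update; case: eqVneq => [->|]. Qed.

Lemma connM_ext n u v y : (forall k, (k <= n.+1)%N -> u k = v k) ->
  connM G n u y = connM G n v y.
Proof.
elim: n u v y => [|n IH] u v y uv /=; first by rewrite !uv.
have -> : connM G n u y = connM G n v y by apply: IH => k kn; apply: uv; exact: leqW.
rewrite !(uv 0%N) // !(uv 1%N) //; congr (_ *: (_ + _)).
rewrite big_nat_cond [RHS]big_nat_cond; apply: eq_bigr => l /andP[/andP[l0 ln] _].
rewrite (uv l) // (uv l.-1); last by lia.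
congr (derive _ _ _); apply/funext => w; apply: IH => k kn.
by rewrite /update; case: eqP => // _; apply: uv; exact: leqW.
Qed.

(** Only the variable of index 0, the base point, is confined to U. *)
Definition vdom (k : nat) : set E := [set w | k = 0%N -> U w].

Lemma open_vdom k : open (vdom k).
Proof.
case: k => [|k].
  suff -> : vdom 0 = U by [].
  by apply/seteqP; split=> [w h|w h _]; exact: h.
suff -> : vdom k.+1 = setT by exact: openT.
by apply/seteqP; split.
Qed.

Lemma partial2_derive (P : tvsType R) (V : normedModType R) (D : set (P * E))
    (F : P * E -> V) dF p w (v : E) :
  has_derivative D F dF -> D (p, w) ->
  'D_v (fun z => F (p, z)) w = dF ((p, w), (0, v)).
Proof.
move=> hF Dpw; have := has_derivative_dir (v := (0, v)) hF Dpw => c.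
apply: cvg_lim; first exact: norm_hausdorff.
apply: cvg_trans c; apply: near_eq_cvg; apply: filterE => t /=.
congr (_ *: (F _ - _)); congr (_, _); first by rewrite /= scaler0 addr0.
by rewrite /= addrC.
Qed.

(** Stated for arguments that depend smoothly on a parameter p: the derivative in
the variable l.-1 of the recursion is then a derivative in an additional parameter
w that replaces this variable, and the induction hypothesis applies to (p, w). *)
Lemma connM_smooth n (P : tvsType R) (W : set P) (u : nat -> P -> E) (y : P -> E) :
  open W -> (forall p, W p -> U (u 0%N p)) -> (forall k, smooth_on W (u k)) ->
  smooth_on W y -> smooth_on W (fun p => connM G n (fun k => u k p) (y p)).
Proof.
elim: n P W u y => [|n IH] P W u y oW Uu Su Sy /=.
  apply: smooth_eval => //; apply: smooth_eval => //.
  exact: (smooth_comp (V := U)).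
apply: smoothZ; first exact: smooth_cst.
apply: smoothD; last first.
  apply: smooth_eval; last exact: IH.
  by apply: smooth_eval => //; exact: (smooth_comp (V := U)).
apply: smooth_sum => l _.
pose D : set (P * E) := W `*` vdom l.-1.
have oD : open D by apply: openX => //; exact: open_vdom.
pose u' k (q : P * E) := update (u^~ q.1) l.-1 q.2 k.
have SF : smooth_on D (fun q : P * E => connM G n (u'^~ q) (y q.1)).
  have S1 (f : P -> E) : smooth_on W f -> smooth_on D (fun q => f q.1).
    move=> Sf; apply: (smooth_comp (V := W)) Sf; first by move=> q [].
    by apply: smooth_fst; exact: smooth_id.
  apply: IH => //; last exact: S1.
    move=> [p w] [/= Wp]; rewrite /u' /update /vdom /=.
    by case: eqVneq => [->|_ _]; [exact|exact: Uu].
  move=> k; rewrite /u' /update; case: eqVneq => _; last exact: S1.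
  by apply: smooth_snd; exact: smooth_id.
have [dF [hF SdF]] := smooth_derivative oD SF.
have Du p : W p -> D (p, u l.-1 p).
  by move=> Wp; split => //=; rewrite /vdom /= => ->; exact: Uu.
apply: (smooth_eq (f := fun p => dF ((p, u l.-1 p), (0, l%:R *: u l p))) oW).
  by move=> p Wp; rewrite -(partial2_derive _ hF (Du p Wp)).
apply: (smooth_comp (V := D `*` setT)
  (f := fun p => ((p, u l.-1 p), (0 : P, l%:R *: u l p)))) SdF.
  by move=> p Wp; split => //; exact: Du.
apply: smooth_pair; apply: smooth_pair => //; first exact: smooth_id.
  exact: smooth_cst.
by apply: smoothZ => //; exact: smooth_cst.
Qed.

(** In the recursion, linearity in y of a partial derivative follows from the
linearity of the differentiated map by partial_linear. *)
Lemma connM_linear n u : U (u 0%N) -> linear (connM G n u).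
Proof.
elim: n u => [|n IH] u Uu a y z /=; first by rewrite clin_lin.
rewrite IH // clin_lin; set c := n.+2%:R^-1.
pose Su x := \sum_(1 <= l < n.+3)
  'D_(l%:R *: u l) (fun w => connM G n (update u l.-1 w) x) (u l.-1).
suff e : Su (a *: y + z) = a *: Su y + Su z.
  rewrite -/(Su _) -/(Su y) -/(Su z) e !scalerDr !scalerA [a * c]mulrC; zmod.
rewrite /Su scaler_sumr -big_split /=; apply: eq_bigr => l _.
pose D : set (E * E) := vdom l.-1 `*` setT.
have oD : open D by apply: openX; [exact: open_vdom|exact: openT].
pose g (q : E * E) := connM G n (update u l.-1 q.1) q.2.
have Dw w : vdom l.-1 w -> U (update u l.-1 w 0%N).
  by rewrite /update /vdom /=; case: eqVneq => [<-|]; first exact.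
have Sg : smooth_on D g.
  apply: (@connM_smooth n (E * E)%type D
    (fun k (q : E * E) => update u l.-1 q.1 k) (fun q : E * E => q.2)) => //.
  - by move=> [w x] [/= /Dw].
  - move=> k; rewrite /update; case: eqVneq => _; last exact: smooth_cst.
    by apply: smooth_fst; exact: smooth_id.
  - by apply: smooth_snd; exact: smooth_id.
have [dg [hg _]] := smooth_derivative oD Sg.
have Du : vdom l.-1 (u l.-1) by rewrite /vdom /= => ->.
have e x : 'D_(l%:R *: u l) (fun w => connM G n (update u l.-1 w) x) (u l.-1) =
    dg ((u l.-1, x), (l%:R *: u l, 0)).
  have cv := has_derivative_dir (v := (l%:R *: u l, 0)) hg (conj Du I : D (u l.-1, x)).
  apply: cvg_lim; first exact: norm_hausdorff.
  apply: cvg_trans cv; apply: near_eq_cvg; apply: filterE => t /=.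
  rewrite /g /= scaler0 addr0 [u l.-1 + _]addrC //.
rewrite !e; apply: (partial_linear (@open_vdom l.-1) _ hg) => // w Vw b s t.
by rewrite /g /= IH //; exact: Dw.
Qed.

Section Total.
Variable n : nat.
Local Notation N := (n.+2).

(** connM n reads the first n.+2 variables only; gathering them in one vector makes
it a function of finitely many variables, extended by 0. *)
Definition ext (x : npow E N) (k : nat) : E :=
  if insub k is Some i then x i else 0.

Lemma extE x (i : 'I_N) : ext x i = x i.
Proof. by rewrite /ext valK. Qed.

Lemma ext_smooth k (P : tvsType R) (W : set P) (f : P -> npow E N) :
  smooth_on W f -> smooth_on W (fun p => ext (f p) k).
Proof.
move=> Sf; rewrite /ext; case: insub => [i|]; last exact: smooth_cst.
apply: (smooth_comp (V := setT) (g := npow_coord E i) _ Sf) => //.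
by apply: smooth_lin; exact: npow_coord_continuous.
Qed.

Definition npow_delta (i : 'I_N) (w : E) : npow E N :=
  [ffun j => if j == i then w else 0].

(** The total derivative is the sum of the partial ones, and the variable y
contributes its own derivative by linearity. *)
Lemma connM_cder (u du : nat -> R -> E) (y dy : R -> E) t :
  U (u 0%N t) -> (forall k, cder (u k) t (du k t)) -> cder y t (dy t) ->
  cder (fun s => connM G n (u^~ s) (y s)) t
   (\sum_(0 <= k < N) 'D_(du k t) (fun w => connM G n (update (u^~ t) k w) (y t)) (u k t)
    + connM G n (u^~ t) (dy t)).
Proof.
move=> Uu hu hy.
pose D := [set q : npow E N * E | U (q.1 ord0)].
have oD : open D.
  rewrite (_ : D = (fun q : npow E N * E => npow_coord E ord0 q.1) @^-1` U) //.
  apply: open_comp => // q _.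
  by apply: (@cvg_comp _ _ _ fst (npow_coord E ord0) _ (nbhs q.1));
    [exact: cvg_fst|exact: npow_coord_continuous].
pose F (q : npow E N * E) := connM G n (ext q.1) q.2.
have SF : smooth_on D F.
  apply: (@connM_smooth n (npow E N * E)%type D
    (fun k (q : npow E N * E) => ext q.1 k) (fun q : npow E N * E => q.2)) => //.
  - by move=> [x z] /=; rewrite /D /= (extE x ord0).
  - by move=> k; apply: ext_smooth; apply: smooth_fst; exact: smooth_id.
  - by apply: smooth_snd; exact: smooth_id.
have [dF [hF _]] := smooth_derivative oD SF.
pose x s : npow E N := [ffun i : 'I_N => u i s].
pose dx : npow E N := [ffun i : 'I_N => du i t].
have hx : cder x t dx.
  apply: (cder_initial (@npow_initial R E N)) => i; rewrite /= ffunE.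
  by under [X in cder X]funext do rewrite ffunE; exact: hu.
have Dt : D (x t, y t) by rewrite /D /= ffunE.
have xE s z : F (x s, z) = connM G n (u^~ s) z.
  apply: connM_ext => k kn; rewrite -[k]/(nat_of_ord (Ordinal (kn : (k < N)%N))).
  by rewrite extE ffunE.
have := cder_comp hF Dt (cder_pair hx hy).
rewrite (_ : (fun s => F _) = fun s => connM G n (u^~ s) (y s)); last first.
  by apply/funext => s; rewrite xE.
suff -> : dF ((x t, y t), (dx, dy t)) =
  \sum_(0 <= k < N) 'D_(du k t) (fun w => connM G n (update (u^~ t) k w) (y t)) (u k t)
    + connM G n (u^~ t) (dy t) by [].
have [l _] := hF _ Dt.
have lD a b : dF ((x t, y t), a + b) = dF ((x t, y t), a) + dF ((x t, y t), b).
  by have := l 1 a b; rewrite !scale1r.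
have lS (I : Type) (r : seq I) (f : I -> npow E N * E) :
    dF ((x t, y t), \sum_(i <- r) f i) = \sum_(i <- r) dF ((x t, y t), f i).
  elim: r => [|i r IH]; first by rewrite !big_nil (linear_fun0 l).
  by rewrite !big_cons lD IH.
(* the direction is split into one part for each variable *)
have -> : (dx, dy t) = \sum_(i < N) (npow_delta i (du i t), 0) + (0, dy t).
  rewrite [LHS]surjective_pairing [RHS]surjective_pairing /=.
  rewrite !raddf_sum /=; congr (_, _); last by rewrite big1 // add0r.
  rewrite addr0.
  apply/ffunP => j; rewrite sum_ffunE !ffunE (bigD1 j) //= ffunE eqxx big1 ?addr0 //.
  by move=> i ij; rewrite ffunE eq_sym (negbTE ij).
rewrite lD lS big_mkord; congr (_ + _); last first.
  rewrite -(partial2_derive _ hF Dt).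
  apply: cvg_lim; first exact: norm_hausdorff.
  have c0 : (fun=> connM G n (u^~ t) (dy t)) @ (0 : R)^' --> connM G n (u^~ t) (dy t).
    exact: cvg_cst.
  apply: cvg_trans c0; apply: near_eq_cvg; apply: filterS (near_neq0 R) => h h0.
  by rewrite /= !xE connM_linear // addrK scalerA mulVf // scale1r.
apply: eq_bigr => i _.
have c := has_derivative_dir (v := (npow_delta i (du i t), 0)) hF Dt.
apply/esym/cvg_lim; first exact: norm_hausdorff.
apply: cvg_trans c; apply: near_eq_cvg; apply: filterE => h /=.
rewrite update_id -xE; congr (_ *: (_ - _)).
rewrite /F /= scaler0 addr0; apply: connM_ext => k kn.
rewrite -[k]/(nat_of_ord (Ordinal (kn : (k < N)%N))) extE !ffunE /update.
rewrite -val_eqE /=; case: eqVneq => [<-|_]; first by rewrite addrC.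
by rewrite scaler0 addr0.
Qed.

End Total.

End ConnM.

(** * Covariance of the z-coordinates *)

Section ZCoord.
Context (R : realType) (E : completeNormedModType R).
Implicit Types (G : E -> clin E (clin E E)) (g : R -> E).

Definition taylor_at g (t : R) (k : nat) : E := k`!%:R^-1 *: derive1n k g t.

(** The operators M^j along the curve g, with M^0 = id. *)
Definition connA G g (j : nat) (t : R) (y : E) : E :=
  if j is j'.+1 then connM G j' (taylor_at g t) y else y.

(** With the covariant derivative nabla y = y' + Gamma (g, g') y along g, this is
nabla^i g' / i!, expanded by the Leibniz rule of connA_cder. *)
Definition zsum G g (i : nat) (t : R) : E :=
  \sum_(0 <= j < i.+1) (i - j)`!%:R^-1 *: connA G g j t (derive1n (i.+1 - j) g t).

Lemma zcoord_zsum G g i : zcoord G g i.+1 = i.+1%:R^-1 *: zsum G g i 0.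
Proof.
rewrite /zcoord /zsum [in RHS]big_ltn // subn0; congr (_ *: (_ + _)).
apply: eq_big_nat => j /andP[j0 ji].
have -> : (i.+1 - j - 1 = i - j)%N by lia.
by congr (_ *: _); case: j j0 ji.
Qed.

Section Deriv.
Variables (G : E -> clin E (clin E E)) (U : set E) (I : set R^o) (g : R -> E).
Hypotheses (oU : open U) (SG : smooth_on U G) (oI : open I)
  (Sg : smooth_on I (g : R^o -> E)) (gU : forall t, I t -> U (g t)).

Lemma taylor_at_cder k t : I t ->
  cder (fun s => taylor_at g s k) t (k.+1%:R *: taylor_at g t k.+1).
Proof.
move=> It.
have -> : k.+1%:R *: taylor_at g t k.+1 = k`!%:R^-1 *: derive1n k.+1 g t.
  by rewrite /taylor_at scalerA factS natrM invfM mulrA mulfV ?mul1r // pnatr_eq0.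
by apply: cderZ; exact: smooth_cdern Sg It.
Qed.

Lemma taylor_at0 t : taylor_at g t 0 = g t.
Proof. by rewrite /taylor_at invr1 scale1r. Qed.

Lemma taylor_at1 t : taylor_at g t 1 = derive1 g t.
Proof. by rewrite /taylor_at invr1 scale1r. Qed.

(** The recursion that defines M^(j+1) says that
nabla (M^j y) = (j + 1) M^(j+1) y + M^j y': along a curve the l-th variable of M^j
is a Taylor coefficient, whose derivative is l.+1 times the next one. *)
Lemma connA_cder j (y dy : R -> E) t : I t -> cder y t (dy t) ->
  cder (fun s => connA G g j s (y s)) t
    (j.+1%:R *: connA G g j.+1 t (y t) + connA G g j t (dy t)
     - G (g t) (derive1 g t) (connA G g j t (y t))).
Proof.
move=> It hy; case: j => [|n].
  by rewrite /= taylor_at0 taylor_at1 scale1r addrC addKr.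
rewrite [connA]lock -lock /=.
have U0 : U (taylor_at g t 0) by rewrite taylor_at0; exact: gU.
have := connM_cder oU SG (n := n) (u := fun k s => taylor_at g s k)
  (du := fun k s => k.+1%:R *: taylor_at g s k.+1) U0 (fun k => @taylor_at_cder k t It) hy.
rewrite scalerA mulfV ?pnatr_eq0 // scale1r taylor_at0 taylor_at1.
rewrite [in X in _ -> X]big_add1 /= [_ + _ + connM _ _ _ (dy t)]addrAC addrK.
exact.
Qed.

(** The coefficient of a j on the left is j / (i+1-j)! + (i+1-j) / (i+1-j)!. *)
Lemma zsum_coef i (a : nat -> E) :
  \sum_(0 <= j < i.+1) (i - j)`!%:R^-1 *: (j.+1%:R *: a j.+1 + a j) =
  i.+1%:R *: \sum_(0 <= j < i.+2) (i.+1 - j)`!%:R^-1 *: a j :> E.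
Proof.
under eq_bigr do rewrite scalerDr scalerA.
rewrite big_split /= scaler_sumr.
have -> : \sum_(0 <= j < i.+1) ((i - j)`!%:R^-1 * j.+1%:R) *: a j.+1 =
    \sum_(0 <= j < i.+2) ((i.+1 - j)`!%:R^-1 * j%:R) *: a j.
  by rewrite [RHS]big_nat_recl // mulr0 scale0r add0r.
have -> : \sum_(0 <= j < i.+1) (i - j)`!%:R^-1 *: a j =
    \sum_(0 <= j < i.+2) ((i.+1 - j)`!%:R^-1 * (i.+1 - j)%:R) *: a j.
  rewrite [RHS]big_nat_recr //= subnn mulr0 scale0r addr0.
  apply: eq_big_nat => j /andP[_ ji]; rewrite subSn //.
  rewrite factS natrM invfM mulrAC mulVf ?mul1r ?pnatr_eq0 //.
rewrite -big_split /=; apply: eq_big_nat => j /andP[_ ji].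
rewrite -scalerDl -mulrDr scalerA mulrC -natrD; congr (_ %:R * _ *: _); lia.
Qed.

(** That is, nabla (zsum i) = (i + 1) zsum (i + 1). *)
Lemma zsum_cder i t : I t -> exists d, cder (zsum G g i) t d /\
  d + G (g t) (derive1 g t) (zsum G g i t) = i.+1%:R *: zsum G g i.+1 t.
Proof.
move=> It.
pose y j := derive1n (i.+1 - j) g; pose dy j := derive1n (i.+1 - j).+1 g.
have hy j : cder (y j) t (dy j t) by exact: smooth_cdern Sg It.
have h j := cderZ (a := (i - j)`!%:R^-1) (@connA_cder j (y j) (dy j) t It (hy j)).
have hs := cder_sum (r := index_iota 0 i.+1) h.
exists (\sum_(0 <= j < i.+1) (i - j)`!%:R^-1 *: (j.+1%:R *: connA G g j.+1 t (y j t) +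
  connA G g j t (dy j t) - G (g t) (derive1 g t) (connA G g j t (y j t)))).
split; first exact: hs.
have -> : fam (G (g t) (derive1 g t)) (zsum G g i t) =
   \sum_(0 <= j < i.+1) (i - j)`!%:R^-1 *: G (g t) (derive1 g t) (connA G g j t (y j t)).
  rewrite /zsum; elim: (index_iota _ _) => [|j r IH].
    by rewrite !big_nil clin0.
  by rewrite !big_cons clinD clinZ IH.
rewrite -big_split /=.
rewrite -(zsum_coef i (fun j => connA G g j t (derive1n (i.+2 - j) g t))).
apply: eq_big_nat => j /andP[_ ji]; rewrite -scalerDr; congr (_ *: _).
rewrite subrK /y /dy.
by have -> : (i.+2 - j = (i.+1 - j).+1)%N by lia.
Qed.

Lemma zsum0 t : zsum G g 0 t = derive1 g t.
Proof. by rewrite /zsum big_nat1 /= invr1 scale1r. Qed.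

End Deriv.

Section Covariance.
Variables (G1 G2 : E -> clin E (clin E E)) (U U1 U2 : set E) (psi : E -> E).
Variables (I : set R^o) (g : R -> E).
Hypotheses (oU : open U) (oU1 : open U1) (oU2 : open U2).
Hypotheses (UU1 : U `<=` U1) (UU2 : forall x, U x -> U2 (psi x)).
Hypotheses (SG1 : smooth_on U1 G1) (SG2 : smooth_on U2 G2) (Spsi : smooth_on U psi).
Hypothesis compat : forall x, U x -> forall xi y : E,
  'D_(G1 x xi y) psi x =
  'D_xi (fun z => 'D_y psi z) x + G2 (psi x) ('D_xi psi x) ('D_y psi x).
Hypotheses (oI : open I) (Sg : smooth_on I (g : R^o -> E)).
Hypothesis gU : forall t, I t -> U (g t).

(** The transformation rule of the components of the connection says that the
derivative of psi intertwines the covariant derivatives along g and psi \o g;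
the claim follows by induction on i from zsum_cder, starting with the chain rule. *)
Lemma zsum_covariant i t : I t -> zsum G2 (psi \o g) i t = 'D_(zsum G1 g i t) psi (g t).
Proof.
have [dpsi [hpsi Sdpsi]] := smooth_derivative oU Spsi.
have oUT : open (U `*` [set: E]) by apply: openX => //; exact: openT.
have [ddpsi [hddpsi _]] := smooth_derivative oUT Sdpsi.
have DE x v : U x -> 'D_v psi x = dpsi (x, v).
  by move=> Ux; exact: (has_derivative_derive v hpsi Ux).2.
have DDE x xi y : U x -> 'D_xi (fun z => 'D_y psi z) x = ddpsi ((x, y), (xi, 0)).
  move=> Ux; have c := has_derivative_dir (v := (xi, 0)) hddpsi (conj Ux (Logic.I : True) : (U `*` setT) (x, y)).
  apply: cvg_lim; first exact: norm_hausdorff.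
  apply: cvg_trans c; apply: near_eq_cvg.
  have : \forall h \near (0 : R)^', U (x + h *: xi).
    have cl : (fun h : R => x + h *: xi) @ (0 : R)^' --> x.
      rewrite -[X in _ --> X]addr0 -(scale0r xi); apply: cvgDtvs; first exact: cvg_cst.
      by apply: cvgZtvs; [exact: cvg_within|exact: cvg_cst].
    by apply: cl; exact: open_nbhs_nbhs.
  apply: filterS => h Uh.
  have -> : (x, y) + h *: (xi, 0) = (x + h *: xi, y) :> E * E.
    by congr (_, _); rewrite /= scaler0 addr0.
  by rewrite /= [h *: _ + _]addrC !DE.
have ddE x y w : U x -> ddpsi ((x, y), (0, w)) = dpsi (x, w).
  move=> Ux; have c := has_derivative_dir (v := (0, w)) hddpsi (conj Ux (Logic.I : True) : (U `*` setT) (x, y)).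
  apply: (cvg_unique (@norm_hausdorff _ E) c).
  have c0 : (fun=> dpsi (x, w)) @ (0 : R)^' --> dpsi (x, w) by exact: cvg_cst.
  apply: cvg_trans c0; apply: near_eq_cvg; apply: filterS (near_neq0 R) => h h0.
  have [l _] := hpsi x Ux.
  have -> : (x, y) + h *: (0, w) = (x, h *: w + y) :> E * E.
    by congr (_, _); rewrite /= ?scaler0 ?addr0 // addrC.
  by rewrite l addrK scalerA mulVf // scale1r.
have Spg : smooth_on I ((psi \o g) : R^o -> E) by exact: (smooth_comp (V := U)).
have dpg s : I s -> derive1 (psi \o g) s = dpsi (g s, derive1 g s).
  move=> Is; apply: cder_derive1; apply: (cder_comp hpsi); first exact: gU.
  exact: (smooth_derive1 oI Sg).2.
have gU1 s : I s -> U1 (g s) by move=> /gU /UU1.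
have gU2 s : I s -> U2 ((psi \o g) s) by move=> /gU /UU2.
elim: i t => [|i IH] t It.
  by rewrite !zsum0 dpg // DE //; exact: gU.
have [d1 [h1 e1]] := zsum_cder oU1 SG1 oI Sg gU1 i It.
have [d2 [h2 e2]] := zsum_cder oU2 SG2 oI Spg gU2 i It.
have Ut := gU It.
have i0 : i.+1%:R != 0 :> R by rewrite pnatr_eq0.
apply: (scalerI i0); rewrite -e2.
have [l _] := hpsi _ Ut.
rewrite DE // -(linear_funZ _ _ l) -e1.
(* by the induction hypothesis, zsum G2 is dpsi along (g, zsum G1) *)
have -> : d2 = ddpsi ((g t, zsum G1 g i t), (derive1 g t, d1)).
  apply: (cder_unique h2).
  apply: (cder_eq (f := fun s => dpsi (g s, zsum G1 g i s))).
    have := open_nbhs_nbhs (conj oI It); apply: filterS => s Is.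
    by rewrite IH // DE //; exact: gU.
  apply: (cder_comp hddpsi) => //; apply: cder_pair => //.
  exact: (smooth_derive1 oI Sg).2.
have [ll _] := hddpsi (g t, zsum G1 g i t) (conj Ut Logic.I).
have -> : ddpsi ((g t, zsum G1 g i t), (derive1 g t, d1)) =
  ddpsi ((g t, zsum G1 g i t), (derive1 g t, 0)) +
  ddpsi ((g t, zsum G1 g i t), (0, d1)).
  have := ll 1 (derive1 g t, 0) (0, d1); rewrite !scale1r => <-.
  by congr ddpsi; congr (_, _); congr (_, _); rewrite /= ?addr0 ?add0r.
rewrite ddE // IH // dpg //= -DDE // -[dpsi (g t, derive1 g t)]DE //.
rewrite addrAC -compat // DE //.
have := l 1 (G1 (g t) (derive1 g t) (zsum G1 g i t)) d1; rewrite !scale1r => <-.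
by rewrite addrC.
Qed.

Lemma zcoord_covariant i : I 0 ->
  zcoord G2 (psi \o g) i.+1 = 'D_(zcoord G1 g i.+1) psi (g 0).
Proof.
move=> I0; rewrite !zcoord_zsum zsum_covariant //.
have [dpsi [hpsi _]] := smooth_derivative oU Spsi.
have Ug := gU I0; have [l _] := hpsi _ Ug.
by rewrite !(has_derivative_derive _ hpsi Ug).2 -(linear_funZ _ _ l).
Qed.

End Covariance.

(** The part of z^(i+1) that involves the Taylor coefficients of order at most i. *)
Definition zlow G (i : nat) (u : nat -> E) : E :=
  i.+1%:R^-1 *: \sum_(1 <= j < i.+1) (i.+1 - j)%:R *: connM G j.-1 u (u (i.+1 - j)%N).

Lemma zlow_ext G i u v : (forall k, (k <= i)%N -> u k = v k) -> zlow G i u = zlow G i v.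
Proof.
move=> uv; congr (_ *: _); apply: eq_big_nat => j /andP[j0 ji].
congr (_ *: _); rewrite uv; last by lia.
by apply: connM_ext => k kj; apply: uv; lia.
Qed.

(** z^(i+1) is the Taylor coefficient of order i + 1 plus a function of those of
lower order, so that the z^i and the derivatives determine each other. *)
Lemma zcoord_taylor G g U i : open U -> smooth_on U G -> U (g 0) ->
  zcoord G g i.+1 = taylor g i.+1 + zlow G i (taylor g).
Proof.
move=> oU SG Ug; rewrite /zcoord /zlow scalerDr; congr (_ + _).
  by rewrite /taylor scalerA factS natrM invfM.
congr (_ *: _); apply: eq_big_nat => j /andP[j0 ji].
have l : linear (connM G j.-1 (taylor g)).
  by apply: (connM_linear oU SG); rewrite /taylor invr1 scale1r.
rewrite /taylor -/(taylor g) (linear_funZ _ _ l) scalerA; congr (_ *: _).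
have -> : (i.+1 - j = (i.+1 - j - 1).+1)%N by lia.
rewrite subSS subn0 factS natrM invfM mulrA mulfV ?mul1r // pnatr_eq0.
Qed.

End ZCoord.

(** * Functions with bounded derivatives *)

Section Scalar.
Context (R : realType).
Implicit Types f g : R -> R.

Definition fun_der f g := forall t, cder (f : R -> R^o) t (g t : R^o).

Lemma fun_der_derive1 f g : fun_der f g -> derive1 f = g.
Proof. by move=> h; apply/funext => t; exact: cder_derive1 (h t). Qed.

Lemma is_derive_cder f (t d : R) : is_derive t 1 f d -> cder (f : R -> R^o) t d.
Proof.
move=> [ex <-]; move: ex; rewrite /derivable /derive => c.
have : (fun h : R => h^-1 *: ((f \o shift t) (h *: 1) - f t)) @ (0 : R)^' -->
  lim ((fun h : R => h^-1 *: ((f \o shift t) (h *: 1) - f t)) @ (0 : R)^') by [].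
apply: cvg_trans; apply: near_eq_cvg; apply: filterE => h /=.
by rewrite [h *: 1]mulr1 [t + h]addrC.
Qed.

Lemma fun_der_add f1 g1 f2 g2 : fun_der f1 g1 -> fun_der f2 g2 ->
  fun_der (fun t => f1 t + f2 t) (fun t => g1 t + g2 t).
Proof. by move=> h1 h2 t; exact: cderD (h1 t) (h2 t). Qed.

Lemma fun_der_opp f g : fun_der f g -> fun_der (fun t => - f t) (fun t => - g t).
Proof.
move=> h t; have := cderZ (a := -1) (h t).
rewrite scaleN1r; congr (cder _ t _).
by apply/funext => s; rewrite scaleN1r.
Qed.

Lemma fun_der_mul f1 g1 f2 g2 : fun_der f1 g1 -> fun_der f2 g2 ->
  fun_der (fun t => f1 t * f2 t) (fun t => g1 t * f2 t + f1 t * g2 t).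
Proof.
move=> h1 h2 t.
have lr (x : R^o) : linear (fun y : R^o => x * y : R^o).
  by move=> a u v; rewrite mulrDr [a *: u]/(a * u) mulrCA.
have ll (y : R^o) : linear (fun x : R^o => x * y : R^o).
  by move=> a u v; rewrite mulrDl [a *: u]/(a * u) -mulrA.
have hb := @has_derivative_bilin R R^o R^o R^o setT (fun p => p.1 * p.2) lr ll
  (@scale_continuous R R^o).
have := cder_comp hb I (cder_pair (h1 t) (h2 t)).
by rewrite /= addrC.
Qed.

(** The functions t |-> sin t ^+ k play the role of cut-off monomials in the proof
of Borel's lemma: they agree with t ^+ k to order k at 0 and all their derivatives
are bounded. *)
Definition bounded_fun f := exists C, forall t, `|f t| <= C.

Fixpoint bounded_upto n f : Prop := bounded_fun f /\
  if n is n'.+1 then exists g, fun_der f g /\ bounded_upto n' g else True.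

Lemma bounded_fun_add f g : bounded_fun f -> bounded_fun g -> bounded_fun (fun t => f t + g t).
Proof.
move=> [C hC] [D hD]; exists (C + D) => t.
by apply: le_trans (ler_normD _ _) _; exact: lerD.
Qed.

Lemma bounded_fun_mul f g : bounded_fun f -> bounded_fun g -> bounded_fun (fun t => f t * g t).
Proof. by move=> [C hC] [D hD]; exists (C * D) => t; rewrite normrM ler_pM. Qed.

Lemma bounded_upto_fun n f : bounded_upto n f -> bounded_fun f.
Proof. by case: n => [|n] []. Qed.

Lemma bounded_upto_pred n f : bounded_upto n.+1 f -> bounded_upto n f.
Proof.
elim: n f => [|n IH] f [bf [g [fg Bg]]]; split => //.
by exists g; split=> //; exact: IH.
Qed.

Lemma bounded_upto_add n f g : bounded_upto n f -> bounded_upto n g -> bounded_upto n (fun t => f t + g t).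
Proof.
elim: n f g => [|n IH] f g [bf hf] [bg hg]; split => //; try exact: bounded_fun_add.
case: hf => f' [ff' Bf]; case: hg => g' [gg' Bg].
by exists (fun t => f' t + g' t); split; [exact: fun_der_add|exact: IH].
Qed.

Lemma bounded_upto_opp n f : bounded_upto n f -> bounded_upto n (fun t => - f t).
Proof.
have b h : bounded_fun h -> bounded_fun (fun t => - h t) by move=> [C hC]; exists C => t; rewrite normrN.
elim: n f => [|n IH] f [bf hf]; split => //; try exact: b.
case: hf => f' [ff' Bf].
by exists (fun t => - f' t); split; [exact: fun_der_opp|exact: IH].
Qed.

Lemma bounded_upto_mul n f g : bounded_upto n f -> bounded_upto n g -> bounded_upto n (fun t => f t * g t).
Proof.
elim: n f g => [|n IH] f g Bf Bg.
  by split => //; apply: bounded_fun_mul; [exact: bounded_upto_fun Bf|exact: bounded_upto_fun Bg].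
split; first by apply: bounded_fun_mul; [exact: bounded_upto_fun Bf|exact: bounded_upto_fun Bg].
have Bf0 := bounded_upto_pred Bf; have Bg0 := bounded_upto_pred Bg.
case: Bf => _ [f' [ff' Bf]]; case: Bg => _ [g' [gg' Bg]].
exists (fun t => f' t * g t + f t * g' t); split; first exact: fun_der_mul.
by apply: bounded_upto_add; exact: IH.
Qed.

Lemma fun_der_sin : fun_der sin cos.
Proof. by move=> t; apply: is_derive_cder; exact: is_derive_sin. Qed.

Lemma fun_der_cos : fun_der cos (fun t => - sin t).
Proof. by move=> t; apply: is_derive_cder; exact: is_derive_cos. Qed.

Lemma bounded_upto_sincos n : bounded_upto n (@sin R) /\ bounded_upto n (@cos R).
Proof.
have bs : bounded_fun (@sin R) by exists 1 => t; rewrite ler_norml sin_geN1 sin_le1.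
have bc : bounded_fun (@cos R) by exists 1 => t; rewrite ler_norml cos_geN1 cos_le1.
elim: n => [|n [IHs IHc]]; first by split; split.
split; split => //; first by exists cos; split => //; exact: fun_der_sin.
by exists (fun t => - sin t); split; [exact: fun_der_cos|exact: bounded_upto_opp].
Qed.

(** Recursive in the derivative, so that products are treated by the Leibniz rule. *)
Fixpoint vanishes k (c : R) f : Prop :=
  if k is k'.+1 then f 0 = 0 /\ vanishes k' c (derive1 f) else f 0 = c.

Definition bounded_derivs f := forall n, bounded_upto n f.

Lemma bounded_derivs_der f : bounded_derivs f -> fun_der f (derive1 f).
Proof. by move=> /(_ 1%N) [_ [g [fg _]]]; rewrite (fun_der_derive1 fg). Qed.

Lemma bounded_derivs_derive1 f : bounded_derivs f -> bounded_derivs (derive1 f).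
Proof.
move=> h n; have [_ [g [fg Bg]]] := h n.+1.
by rewrite (fun_der_derive1 fg).
Qed.

Lemma vanishes_add k c d f g : bounded_derivs f -> bounded_derivs g -> vanishes k c f -> vanishes k d g ->
  vanishes k (c + d) (fun t => f t + g t).
Proof.
elim: k c d f g => [|k IH] c d f g Bf Bg /=; first by move=> -> ->.
move=> [f0 lf] [g0 lg]; rewrite f0 g0 addr0; split => //.
rewrite (fun_der_derive1 (fun_der_add (bounded_derivs_der Bf) (bounded_derivs_der Bg))).
by apply: IH => //; exact: bounded_derivs_derive1.
Qed.

Lemma vanishes_weaken k c f : vanishes k.+1 c f -> vanishes k 0 f.
Proof.
elim: k f => [|k IH] f [f0 lf] //=; split => //; exact: IH.
Qed.

Lemma vanishes_mul k c f g : bounded_derivs f -> bounded_derivs g -> vanishes k c f ->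
  vanishes k (c * g 0) (fun t => f t * g t).
Proof.
elim: k c f g => [|k IH] c f g Bf Bg; first by move=> /= ->.
move=> lf; have lf0 := vanishes_weaken lf; case: lf => f0 lf /=.
rewrite f0 mul0r; split => //.
rewrite (fun_der_derive1 (fun_der_mul (bounded_derivs_der Bf) (bounded_derivs_der Bg))).
rewrite -[c * g 0]addr0 -[X in _ + X](mul0r (derive1 g 0)).
have Bf' := bounded_derivs_derive1 Bf; have Bg' := bounded_derivs_derive1 Bg.
by apply: vanishes_add; [move=> n; exact: bounded_upto_mul|move=> n; exact: bounded_upto_mul|exact: IH|exact: IH].
Qed.

Lemma bounded_derivs_sin : bounded_derivs (@sin R). Proof. by move=> n; case: (bounded_upto_sincos n). Qed.
Lemma bounded_derivs_cos : bounded_derivs (@cos R). Proof. by move=> n; case: (bounded_upto_sincos n). Qed.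

Lemma vanishes_mul_sin k c f : bounded_derivs f -> vanishes k c f ->
  vanishes k.+1 (k.+1%:R * c) (fun t => f t * sin t).
Proof.
elim: k c f => [|k IH] c f Bf lf /=; rewrite sin0 mulr0; split => //.
  rewrite (fun_der_derive1 (fun_der_mul (bounded_derivs_der Bf) fun_der_sin)) sin0 cos0 mulr0 add0r.
  by rewrite mulr1 mul1r.
rewrite (fun_der_derive1 (fun_der_mul (bounded_derivs_der Bf) fun_der_sin)).
have lc : vanishes k.+1 c (fun t => f t * cos t).
  by rewrite -[c]mulr1 -cos0; apply: vanishes_mul => //; exact: bounded_derivs_cos.
have Bf' := bounded_derivs_derive1 Bf.
have ls := IH c _ Bf' lf.2.
rewrite (_ : k.+2%:R * c = k.+1%:R * c + c); last by rewrite -[k.+2]addn1 natrD mulrDl mul1r.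
apply: (@vanishes_add k.+1) => //.
  by move=> n; apply: bounded_upto_mul => //; exact: bounded_derivs_sin.
by move=> n; apply: bounded_upto_mul => //; exact: bounded_derivs_cos.
Qed.

Lemma bounded_derivs_sinX k : bounded_derivs (fun t : R => sin t ^+ k).
Proof.
elim: k => [|k IH] n.
  have B1 : bounded_derivs (fun=> 1 : R).
    suff h c m : bounded_upto m (fun=> c : R) by exact: h.
    elim: m c => [|m IH] c; (split; first by exists `|c|) => //.
    by exists (fun=> 0); split => // t; exact: cder_cst.
  exact: B1.
under [X in bounded_upto _ X]funext do rewrite exprSr.
by apply: bounded_upto_mul => //; exact: bounded_derivs_sin.
Qed.

Lemma vanishes_sinX k : vanishes k k`!%:R (fun t : R => sin t ^+ k).
Proof.
elim: k => [//|k IH]; rewrite factS natrM.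
rewrite (_ : (fun t => _) = fun t => sin t ^+ k * sin t).
  by apply: vanishes_mul_sin => //; exact: bounded_derivs_sinX.
by apply/funext => t; rewrite exprSr.
Qed.

Lemma vanishes_derive1n k c f : vanishes k c f ->
  (forall m, (m < k)%N -> derive1n m f 0 = 0) /\ derive1n k f 0 = c.
Proof.
elim: k f => [//|k IH] f [f0 /IH [h1 h2]]; split; last by rewrite derive1Sn.
by case=> [//|m] mk; rewrite derive1Sn; exact: h1.
Qed.

Lemma bounded_derivs_derive1n f m : bounded_derivs f -> bounded_derivs (derive1n m f).
Proof. by move=> Bf; elim: m => // m IH; exact: bounded_derivs_derive1. Qed.

End Scalar.

(** * Borel's lemma *)

(** Each value may depend on all preceding ones; the sequence is built as a growing
list. *)
Lemma strong_recursion (T : Type) (x0 : T) (F : nat -> (nat -> T) -> T) :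
  (forall n u v, (forall k, (k < n)%N -> u k = v k) -> F n u = F n v) ->
  exists u, forall n, u n = F n u.
Proof.
move=> hF; pose s := fix s n := if n is n'.+1 then rcons (s n') (F n' (nth x0 (s n'))) else [::].
have sz n : size (s n) = n by elim: n => //= n IH; rewrite size_rcons IH.
pose u n := nth x0 (s n.+1) n.
have su n k : (k < n)%N -> nth x0 (s n) k = u k.
  elim: n => // n IH; rewrite ltnS leq_eqVlt => /predU1P[->//|kn].
  by rewrite /= nth_rcons sz kn IH.
exists u => n; rewrite {1}/u /= nth_rcons sz ltnn eqxx.
by apply: hF => k kn; exact: su.
Qed.

Section Series.
Context (R : realType) (E : completeNormedModType R).

Lemma cder_mean (V : normedModType R) (f f' : R -> V) (t s : R) (w : V) (C : R) :
  (forall u, cder f u (f' u)) ->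
  (forall r, 0 <= r <= 1 -> `|s *: f' (t + r * s) - w| <= C) ->
  `|f (t + s) - f t - w| <= C.
Proof.
move=> hf hC.
have hd := @cder_has_derivative R V setT f f' (fun u _ => hf u).
exact: (@mean_value_segment R R^o V setT f _ t s w C hd (fun _ _ => Logic.I)).
Qed.

Lemma cder_taylor2 (V : normedModType R) (f f' f2 : R -> V) (t s C : R) :
  (forall u, cder f u (f' u)) -> (forall u, cder f' u (f2 u)) ->
  (forall u, `|f2 u| <= C) -> `|f (t + s) - f t - s *: f' t| <= `|s| ^+ 2 * C.
Proof.
move=> hf hf' hC; have C0 : 0 <= C by apply: le_trans (hC 0).
apply: (cder_mean hf) => r /andP[r0 r1].
rewrite -scalerBr normrZ expr2 -mulrA ler_wpM2l //.
have := @cder_mean V f' f2 t (r * s) 0 (`|s| * C) hf'.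
rewrite subr0; apply => q _; rewrite subr0 normrZ.
apply: ler_pM => //; rewrite normrM ler_piMl // ger0_norm //.
Qed.

(** Summable bounds on the second derivatives give
|F (t + s) - F t - s F' t| <= K s^2 for the sums, hence differentiability of the
sum without any uniform convergence argument. *)
Lemma series_tower (h : nat -> nat -> R -> E) (M : nat -> nat -> R) :
  (forall k m t, cder (h k m) t (h k m.+1 t)) ->
  (forall k m t, `|h k m t| <= M k m) ->
  (forall m, exists K, forall n, \sum_(0 <= k < n) M k m <= K) ->
  exists F : nat -> R -> E, (forall m t, cder (F m) t (F m.+1 t)) /\
    forall m t, series (fun k => h k m t) @ \oo --> F m t.
Proof.
move=> hd hM hK.
have cv m t : cvgn (series (fun k => h k m t)).
  apply: normed_cvg; have [K HK] := hK m; apply: nondecreasing_is_cvgn.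
    apply/nondecreasing_seqP => n; rewrite /= /series /= big_nat_recr //=.
    by rewrite lerDl.
  exists K => _ [n _ <-]; apply: le_trans (HK n).
  by rewrite /= /series /=; apply: ler_sum => k _; exact: hM.
pose F m t := limn (series (fun k => h k m t)).
have cF m t : series (fun k => h k m t) @ \oo --> F m t by exact: cv.
exists F; split => // m t.
have [K HK] := hK m.+2.
have K0 : 0 <= K by have := HK 0%N; rewrite big_geq.
(* the remainder of each term is bounded by its second derivative *)
have bnd s : `|F m (t + s) - F m t - s *: F m.+1 t| <= `|s| ^+ 2 * K.
  have c : (fun n => series (fun k => h k m (t + s)) n - series (fun k => h k m t) n
      - s *: series (fun k => h k m.+1 t) n) @ \oo -->
      F m (t + s) - F m t - s *: F m.+1 t.
    apply: cvgB; first by apply: cvgB.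
    by apply: cvgZr; exact: cF.
  apply: (cvgr_to_le (cvg_norm c)); apply: filterE => n.
  rewrite /series /= scaler_sumr -!sumrB.
  apply: le_trans (ler_norm_sum _ _ _) _.
  apply: (@le_trans _ _ (\sum_(0 <= k < n) `|s| ^+ 2 * M k m.+2)).
    by apply: ler_sum => k _; apply: cder_taylor2 => u; [exact: hd|exact: hd|exact: hM].
  by rewrite -mulr_sumr ler_wpM2l // sqr_ge0.
apply/cvgrPdist_le => e e0.
have : \forall s \near (0 : R)^', `|s| * K <= e.
  apply: nbhs_dnbhs; apply/nbhs_ballP; exists (e / (K + 1)) => /=.
    by rewrite divr_gt0 //; lra.
  move=> s; rewrite -ball_normE /= sub0r normrN => hs.
  apply: (@le_trans _ _ (`|s| * (K + 1))); first by rewrite ler_wpM2l //; lra.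
  by apply/ltW; rewrite -ltr_pdivlMr //; lra.
apply: filterS2 (near_neq0 R) => s s0 sK; apply: le_trans sK.
have -> : F m.+1 t - s^-1 *: (F m (t + s) - F m t) =
    - (s^-1 *: (F m (t + s) - F m t - s *: F m.+1 t)).
  by rewrite [in RHS]scalerBr scalerA mulVf // scale1r opprB.
rewrite normrN normrZ normfV ler_pdivrMl ?normr_gt0 // mulrA -expr2.
exact: bnd.
Qed.

Lemma cder_rescale (V : normedModType R) (f f' : R -> V) (l t : R) :
  (forall u, cder f u (f' u)) -> cder (fun t => f (l * t)) t (l *: f' (l * t)).
Proof.
move=> hf.
have hd := @cder_has_derivative R V setT f f' (fun u _ => hf u).
have hl : cder (fun t : R => l * t : R^o) t (l : R^o).
  have c : cder (id : R -> R^o) t (1 : R^o).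
    apply: is_derive_cder; exact: is_derive_id.
  by have := cderZ (a := l) c; rewrite [l *: _]mulr1.
exact: (cder_comp hd Logic.I hl).
Qed.

(** The curve is the sum over k of (phi_k (lam_k t) / lam_k ^+ k) b_k with phi_k the
k-th power of sin. The scale lam_k is chosen after b_k, large enough to bound the
derivatives of order less than k of the k-th term by 2 ^- k. The k-th term does
not contribute to the derivatives of order less than k at 0, so b_k can be chosen
recursively to correct the contribution of the preceding terms to the derivative
of order k. *)
Lemma borel (a : nat -> E) : exists g : R -> E,
  smooth_on setT (g : R^o -> E) /\ forall k, derive1n k g 0 = k`!%:R *: a k.
Proof.
pose phi k m := derive1n m (fun t : R => sin t ^+ k).
have Bphi k m : bounded_derivs (phi k m) by apply: bounded_derivs_derive1n; exact: bounded_derivs_sinX.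
have phiD k m u : cder (phi k m : R -> R^o) u (phi k m.+1 u : R^o).
  exact: (bounded_derivs_der (Bphi k m)).
have [C hC] : exists C : nat -> nat -> R, forall k m t, `|phi k m t| <= C k m.
  have h k m : exists C, forall t, `|phi k m t| <= C by exact: (Bphi k m 0%N).1.
  exists (fun k m => proj1_sig (cid (h k m))) => k m; exact: (proj2_sig (cid (h k m))).
have C0 k m : 0 <= C k m by apply: le_trans (hC k m 0).
have phi0 k m : (m < k)%N -> phi k m 0 = 0 by exact: (vanishes_derive1n (vanishes_sinX R k)).1.
have phik k : phi k k 0 = k`!%:R by exact: (vanishes_derive1n (vanishes_sinX R k)).2.
(* large enough for the bound M2 below *)
pose lam k (b : E) : R := 1 + 2 ^+ k * (`|b| * \sum_(0 <= m < k) C k m).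
have lam1 k b : 1 <= lam k b.
  by rewrite lerDl mulr_ge0 // mulr_ge0 //; apply: sumr_ge0.
have lam0 k b : 0 < lam k b by apply: lt_le_trans (lam1 k b).
pose co (b : nat -> E) k m : R := lam k (b k) ^+ m / lam k (b k) ^+ k.
have [b hb] := @strong_recursion E 0 (fun m b => a m - m`!%:R^-1 *:
    \sum_(0 <= k < m) (co b k m * phi k m 0) *: b k)
  (ltac:(move=> n u v uv; congr (_ - _ *: _); apply: eq_big_nat => k /andP[_ kn];
         by rewrite /co uv)).
pose h k m (t : R) : E := (co b k m * phi k m (lam k (b k) * t)) *: b k.
pose M k m := co b k m * C k m * `|b k|.
have co0 k m : 0 <= co b k m by rewrite divr_ge0 // exprn_ge0 // ltW.
have hd k m t : cder (h k m) t (h k m.+1 t).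
  have c := cder_rescale (l := lam k (b k)) (t := t) (phiD k m).
  have c1 := cderZ (a := co b k m) c.
  have hl : continuous (fun r : R^o => (r : R) *: b k).
    by move=> r; apply: cvgZtvs; [exact: cvg_id|exact: cvg_cst].
  have ll : linear (fun r : R^o => (r : R) *: b k).
    by move=> x y z; rewrite scalerDl scalerA.
  pose L : {linear R^o -> E} := HB.pack (fun r : R^o => (r : R) *: b k)
    (GRing.isLinear.Build R R^o E *:%R _ ll).
  have e : co b k m.+1 * phi k m.+1 (lam k (b k) * t) =
      co b k m * (lam k (b k) * phi k m.+1 (lam k (b k) * t)).
    by rewrite mulrA; congr (_ * _); rewrite /co exprSr mulrAC.
  by rewrite /h e; exact: (cder_lin (f := L) hl c1).
have hM k m t : `|h k m t| <= M k m.
  by rewrite normrZ normrM ger0_norm // ler_wpM2r // ler_wpM2l.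
have M0 k m : 0 <= M k m by apply: mulr_ge0 => //; exact: mulr_ge0.
have M2 k m : (m < k)%N -> M k m <= (2 ^+ k)^-1.
  move=> mk; rewrite /M /co.
  set l := lam k (b k); have l0 : 0 < l := lam0 k (b k).
  have lk : l ^+ m / l ^+ k <= l^-1.
    rewrite ler_pdivrMr ?exprn_gt0 // ler_pdivlMl // -exprS.
    exact: ler_weXn2l (lam1 _ _) _ _ mk.
  have Cb : 2 ^+ k * (C k m * `|b k|) <= l.
    rewrite /l /lam; apply: (@le_trans _ _ (2 ^+ k * (`|b k| * \sum_(0 <= m < k) C k m))).
      rewrite ler_wpM2l // mulrC ler_wpM2l // (big_rem m) ?mem_index_iota //=.
      by rewrite lerDl sumr_ge0.
    by rewrite lerDr.
  rewrite -mulrA; apply: (@le_trans _ _ (l^-1 * (C k m * `|b k|))).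
    by rewrite ler_wpM2r // mulr_ge0.
  rewrite ler_pdivrMl // -[leRHS]mulrC ler_pdivlMl ?exprn_gt0 //.
have hK m : exists K, forall n, \sum_(0 <= k < n) M k m <= K.
  exists (\sum_(0 <= k < m.+1) M k m + 1) => n.
  have mono n1 n2 : (n1 <= n2)%N ->
      \sum_(0 <= k < n1) M k m <= \sum_(0 <= k < n2) M k m.
    move=> n12; rewrite (@big_cat_nat _ _ _ n1 0 n2) //=.
    by rewrite lerDl sumr_ge0.
  apply: le_trans (mono n (m.+1 + n)%N (leq_addl _ _)) _.
  suff : \sum_(0 <= k < m.+1 + n) M k m <= \sum_(0 <= k < m.+1) M k m + (1 - (2 ^+ n)^-1).
    by move=> /le_trans; apply; rewrite lerD2l gerBl invr_ge0 exprn_ge0.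
  elim: n => [|n IH]; first by rewrite addn0 expr0 invr1 subrr addr0.
  rewrite addnS big_nat_recr //=; apply: le_trans (lerD IH (M2 _ _ _)) _.
    by rewrite addSn ltnS leq_addr.
  rewrite -addrA lerD2l exprS invfM.
  have : (2 ^+ (m.+1 + n))^-1 <= 2^-1 * (2 ^+ n)^-1 :> R.
    rewrite -invfM -exprS lef_pV2 ?posrE ?exprn_gt0 //.
    by apply: ler_weXn2l; [lra|lia].
  lra.
have [F [Fd Fs]] := series_tower hd hM hK.
have F0 m : F m 0 = m`!%:R *: a m.
  apply: (cvg_unique (@norm_hausdorff _ E) (Fs m 0)).
  apply: cvg_near_cst; exists m.+1 => // n /= mn.
  rewrite /series /= (@big_cat_nat _ _ _ m.+1 0 n) //= [X in _ + X]big1_seq; last first.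
    move=> k /andP[_]; rewrite mem_index_iota => /andP[mk _].
    by rewrite /h mulr0 phi0 // mulr0 scale0r.
  rewrite addr0 big_nat_recr //= {2}/h mulr0 phik /co divff ?expf_neq0 ?gt_eqF // mul1r.
  rewrite [in X in _ + X]hb scalerBr scalerA divff; last first.
    by rewrite pnatr_eq0 -lt0n fact_gt0.
  rewrite scale1r [X in X + _](_ : _ = \sum_(0 <= k < m) (co b k m * phi k m 0) *: b k).
    by rewrite addrC subrK.
  by apply: eq_big_nat => k _; rewrite /h mulr0.
exists (F 0%N); split; first exact: (cder_smooth openT (fun m t _ => Fd m t)).
have FE k : derive1n k (F 0%N) = F k.
  elim: k => // k IH; rewrite derive1nS IH; apply/funext => t.
  exact: cder_derive1 (Fd k t).
by move=> k; rewrite FE.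
Qed.

End Series.

(** * Frechet spaces *)

Section Frechet.
Context (R : realType).

Lemma filter_upto (T : Type) (F : set_system T) (f : nat -> set T) (n : nat) :
  Filter F -> (forall k, (k <= n)%N -> F (f k)) ->
  F [set x | forall k, (k <= n)%N -> f k x].
Proof.
move=> FF; elim: n => [|n IH] h.
  by have := h 0%N (leqnn _); apply: filterS => x fx k; rewrite leqn0 => /eqP ->.
have := IH (fun k kn => h k (leqW kn)).
apply: filterS2 (h n.+1 (leqnn _)) => x h1 h2 k.
by rewrite leq_eqVlt => /predU1P[->|]; [|exact: h2].
Qed.

Lemma cauchy_map (S T : uniformType) (f : S -> T) (F : set_system S) : Filter F ->
  (forall B, entourage B -> entourage [set xy | B (f xy.1, f xy.2)]) ->
  cauchy F -> cauchy (f @ F).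
Proof.
move=> FF hf cF B /hf /cF [[P Q] /= [FP FQ] PQB].
exists (f @` P, f @` Q) => /=.
  by split; [apply: filterS FP|apply: filterS FQ] => x; exists x.
by move=> -[_ _] [/= [x Px <-] [y Qy <-]]; exact: (PQB (x, y)).
Qed.

Lemma frechet_prod (X Y : tvsType R) :
  frechet_space X -> frechet_space Y -> frechet_space (X * Y)%type.
Proof.
move=> [hX cX cmX] [hY cY cmY]; split.
- move=> [x1 y1] [x2 y2] cl; congr (_, _).
    apply: hX => A B Ax Bx.
    have [||p [[Ap _] [Bp _]]] := cl (A `*` setT) (B `*` setT).
    + by exists (A, setT) => //; split => //; exact: filterT.
    + by exists (B, setT) => //; split => //; exact: filterT.
    + by exists p.1.
  apply: hY => A B Ay By.
  have [||p [[_ Ap] [_ Bp]]] := cl (setT `*` A) (setT `*` B).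
  + by exists (setT, A) => //; split => //; exact: filterT.
  + by exists (setT, B) => //; split => //; exact: filterT.
  + by exists p.2.
- have [f fe ff] := iffLR countable_uniformityP cX.
  have [g ge gg] := iffLR countable_uniformityP cY.
  pose f' n := [set x | forall k, (k <= n)%N -> f k x].
  pose g' n := [set x | forall k, (k <= n)%N -> g k x].
  have f'e n : entourage (f' n) by apply: filter_upto => k _; exact: ff.
  have g'e n : entourage (g' n) by apply: filter_upto => k _; exact: gg.
  apply/countable_uniformityP.
  exists (fun n => [set xy | f' n (xy.1.1, xy.2.1) /\ g' n (xy.1.2, xy.2.2)]).
    move=> A [[B C] /= [/fe[n fB] /ge[m gC]] BCA].
    exists (maxn n m) => -[[x1 y1] [x2 y2]] /= [fx gy].
    have [|[[a1 b1] [a2 b2]] Aab [<- <- <- <-] //] := BCA ((x1, x2), (y1, y2)).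
    by split => /=; [apply: fB; apply: fx|apply: gC; apply: gy];
      rewrite ?leq_maxl ?leq_maxr.
  by move=> n; exact: prod_entP.
- move=> F FF cF.
  have c1 : cauchy (fst @ F).
    apply: cauchy_map cF => B eB.
    apply: filterS (prod_entP eB (@entourageT Y)) => -[[? ?] [? ?]] /=; by case.
  have c2 : cauchy (snd @ F).
    apply: cauchy_map cF => B eB.
    apply: filterS (prod_entP (@entourageT X) eB) => -[[? ?] [? ?]] /=; by case.
  have [x Fx] := cmX _ (fmap_proper_filter _ FF) c1.
  have [y Fy] := cmY _ (fmap_proper_filter _ FF) c2.
  exists (x, y) => A [[P Q] /= [Px Qy] PQA].
  have h : F ((fst @^-1` P) `&` (snd @^-1` Q)).
    by apply: filterI; [exact: Fx|exact: Fy].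
  by apply: (filterS _ h) => -[a b] [? ?]; exact: PQA.
Qed.

Lemma frechet_banach (E : completeNormedModType R) : frechet_space E.
Proof.
split; first exact: norm_hausdorff.
- exact: countable_uniformity_metric.
- by move=> F FF cF; exists (lim F); exact: (cauchy_cvg F cF).
Qed.

(** The sets where the first n.+1 coordinates are at most 1 / n.+1 form a countable
basis at 0, and a Cauchy filter converges coordinate by coordinate. *)
Lemma frechet_Fspace (E : completeNormedModType R) : frechet_space (Fspace E).
Proof.
(* the uniform structure is defined by the neighbourhoods of 0 *)
have entE (B : set (Fspace E * Fspace E)) : entourage B =
  (exists U : set (Fspace E), nbhs (0 : Fspace E) U /\
     (forall xy : Fspace E * Fspace E, (xy.1 - xy.2) \in U -> xy \in B)) by [].
have cont k := @Fcoord_continuous R E k.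
split.
- move=> v w cl; apply: Fcoord_inj => k; apply: (@norm_hausdorff _ E) => A B Av Bw.
  have [z [Az Bz]] := cl (Fcoord E k @^-1` A) (Fcoord E k @^-1` B) (cont k v A Av) (cont k w B Bw).
  by exists (Fcoord E k z).
- pose B n := [set v : Fspace E | forall k, (k <= n)%N -> `|Fcoord E k v| <= n.+1%:R^-1].
  have Bmono n m : (n <= m)%N -> B m `<=` B n.
    move=> nm v Bv k kn; apply: le_trans (Bv k (leq_trans kn nm)) _.
    by rewrite lef_pV2 ?posrE // ler_nat.
  apply/countable_uniformityP; exists (fun n => [set xy | B n (xy.1 - xy.2)]).
    move=> A; rewrite entE => -[U [U0 UA]].
    pose F := filter_from [set: nat] B.
    have FF : Filter F.
      apply: filter_from_filter; first by exists 0%N.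
      move=> n m _ _; exists (maxn n m) => // v Bv.
      by split; apply: Bmono Bv; rewrite ?leq_maxl ?leq_maxr.
    have F0 : F --> (0 : Fspace E).
      have [_ _ ini _] := @F_initial R E; apply: ini => k.
      rewrite (linear0 (Fcoord E k)).
      apply/cvgr0Pnorm_le => e e0.
      have [n ne] : exists n, n.+1%:R^-1 <= e.
        exists (Num.trunc e^-1); rewrite -[leRHS]invrK lef_pV2 ?posrE ?invr_gt0 //.
        by apply/ltW; apply: truncnS_gt.
      exists (maxn n k) => // v /= Bv; apply: le_trans (Bv k (leq_maxr _ _)) _.
      apply: le_trans ne; rewrite lef_pV2 ?posrE // ler_nat ltnS; exact: leq_maxl.
    have [n _ nU] := F0 U U0; exists n => -[x y] /= Bxy.
    by apply/set_mem/UA/mem_set; exact: nU.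
  move=> n; rewrite entE; exists (B n); split; last by move=> xy /set_mem h; exact/mem_set.
  have h k : (k <= n)%N -> \forall v \near (0 : Fspace E), `|Fcoord E k v| <= n.+1%:R^-1.
    move=> _; have := cont k 0; rewrite /continuous_at (linear0 (Fcoord E k)).
    by move=> /cvgr0Pnorm_le; apply; rewrite invr_gt0.
  exact: filter_upto.
- move=> F FF cF.
  have ck k : cauchy (Fcoord E k @ F).
    apply: cauchy_map cF => A; rewrite -entourage_ballE => -[e /= e0 eA].
    rewrite entE; exists (Fcoord E k @^-1` [set x : E | `|x| < e]); split.
      apply: cont; rewrite (linear0 (Fcoord E k)); apply/nbhs_ballP; exists e => //.
      by move=> x; rewrite -ball_normE /= sub0r normrN.
    move=> [x y] /set_mem /= h; apply/mem_set/eA; rewrite /= -ball_normE /=.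
    by rewrite -(linearB (Fcoord E k)).
  have hl k : exists z : E, Fcoord E k @ F --> z.
    by exists (lim (Fcoord E k @ F)); exact: (cauchy_cvg _ (ck k)).
  exists (mkF (fun k => proj1_sig (cid (hl k)))).
  have [_ _ ini _] := @F_initial R E; apply: ini => k.
  by rewrite Fcoord_mkF; case: cid.
Qed.

Section Shift.
Context (E : completeNormedModType R).

(** The homeomorphism of E x F with the limit of the E^(n+2) puts x in front of v. *)
Definition Fcons (p : E * Fspace E) (k : nat) : E :=
  if k is k'.+1 then Fcoord E k' p.2 else p.1.

Lemma consF_subproof (p : E * Fspace E) :
  @plim_npow_set R E 2 (fun n => [ffun i : 'I_(2 + n) => Fcons p i]).
Proof. by move=> n m h; apply/ffunP => i; rewrite !ffunE. Qed.

Definition consF (p : E * Fspace E) : plim_npow E 2 :=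
  Subfam (S := plim_npow_subspace E 2) (consF_subproof p).

Definition unconsF (v : plim_npow E 2) : E * Fspace E :=
  (coordF v 0 ord0, mkF (fun k => coordF v k ord_max)).

Lemma consF_linear : linear consF.
Proof.
move=> a p q; apply: fam_inj => n; apply/ffunP => i; rewrite !ffunE.
by case: (i : nat) => [|k] //=; rewrite !ffunE.
Qed.

Lemma unconsF_linear : linear unconsF.
Proof.
move=> a v w; congr (_, _); first by rewrite /= !ffunE.
by apply: fam_inj => n; apply/ffunP => i; rewrite !ffunE.
Qed.

Lemma plim2_coord (v : plim_npow E 2) n (i : 'I_(2 + n)) :
  coordF v n i = Fcons (unconsF v) i.
Proof.
have [->|i0] := eqVneq i ord0.
  have h : (2 + 0 <= 2 + n)%N by [].
  have e : rho h (coordF v n) = coordF v 0 := famP v n 0%N h.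
  by rewrite /= -e ffunE; congr (coordF v n _); exact: val_inj.
case: i i0 => -[//|k] kn _ /=; rewrite ffunE.
have h : (2 + k <= 2 + n)%N by [].
have e : rho h (coordF v n) = coordF v k := famP v n k h.
by rewrite -e ffunE; congr (coordF v n _); exact: val_inj.
Qed.

Lemma lin_homeo_cons : lin_homeo (E * Fspace E)%type (plim_npow E 2).
Proof.
pose f : {linear (E * Fspace E)%type -> plim_npow E 2} := HB.pack consF
  (GRing.isLinear.Build R (E * Fspace E)%type (plim_npow E 2) *:%R _ consF_linear).
pose g : {linear plim_npow E 2 -> (E * Fspace E)%type} := HB.pack unconsF
  (GRing.isLinear.Build R (plim_npow E 2) (E * Fspace E)%type *:%R _ unconsF_linear).
exists f, g; split.
- move=> [x v]; rewrite /= /unconsF /coordF /=; congr (_, _); first by rewrite ffunE.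
  by apply: Fcoord_inj => k; rewrite Fcoord_mkF ffunE.
- move=> v; apply: fam_inj => n; apply/ffunP => i.
  by rewrite /= ffunE -plim2_coord.
- move=> p; apply: cvg_subprod => n; apply: (initial_cvg (@npow_initial R E (2 + n))) => i.
  have e q : npow_coord E i (fam (f q) n) = Fcons q i by rewrite /= ffunE.
  suff c : (fun q => npow_coord E i (fam (f q) n)) @ p --> npow_coord E i (fam (f p) n).
    exact: c.
  have -> : (fun q => npow_coord E i (fam (f q) n)) = (fun q => Fcons q i).
    by apply/funext => q; exact: e.
  rewrite e.
  case: (nat_of_ord i) => [|k] /=; first exact: cvg_fst.
  by apply: (@cvg_comp _ _ _ snd (Fcoord E k) _ (nbhs p.2));
    [exact: cvg_snd|exact: Fcoord_continuous].
- move=> v.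
  have c1 : (fun w : plim_npow E 2 => coordF w 0 ord0) @ v --> coordF v 0 ord0.
    have c := @Defs.coord_continuous R nat (fun n => npow E (2 + n))
      (plim_npow_subspace E 2) 0%N v.
    exact: (cvg_comp _ _ c (@npow_coord_continuous R E 2 ord0 (coordF v 0))).
  have c2 : (fun w : plim_npow E 2 => mkF (fun k => coordF w k ord_max)) @ v -->
      mkF (fun k => coordF v k ord_max).
    have FF : Filter (nbhs (v : plim_npow E 2)) by exact: nbhs_filter.
    apply: (@initial_cvg R _ _ _ _ (@F_initial R E) _ (nbhs (v : plim_npow E 2)) _ _ FF) => k.
    rewrite Fcoord_mkF; have -> : (fun w : plim_npow E 2 => Fcoord E k (mkF (fun k => coordF w k ord_max))) =
        (fun w : plim_npow E 2 => coordF w k ord_max).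
      by apply/funext => w; rewrite Fcoord_mkF.
    have c := @Defs.coord_continuous R nat (fun n => npow E (2 + n))
      (plim_npow_subspace E 2) k v.
    exact: (cvg_comp _ _ c (@npow_coord_continuous R E (2 + k) ord_max (coordF v k))).
  exact: (cvg_pair c1 c2).
Qed.

End Shift.

End Frechet.

(** * Jets of curves *)

Section Atlases.
Context (R : realType) (X Y : tvsType R) (M N : Type).
Variables (A : atlas X M) (B : atlas Y N).
Hypothesis chart_injective : forall a : ix A, {in dom a &, injective (chart a)}.

Lemma local_repE (S : set M) (f : M -> N) (a : ix A) (b : ix B) m :
  rep_dom S f a b m -> local_rep S f a b (chart a m) = chart b (f m).
Proof.
move=> rm; rewrite /local_rep; case: xgetP => [y _ [m' [rm' e ->]]|/(_ (chart b (f m)))].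
  by congr (chart b (f _)); apply: (chart_injective (a := a)) => //;
    apply/mem_set; [case: rm' => -[]|case: rm => -[]].
by case; exists m.
Qed.

(** The local representative is picked by xget; on its domain it agrees with any
explicit formula, whose smoothness is then enough. *)
Lemma smooth_mapI (S : set M) (f : M -> N) :
  (forall (a : ix A) (b : ix B), exists (O : set X) (g : X -> Y), [/\ open O, smooth_on O g,
     chart a @` rep_dom S f a b = O &
     forall m, rep_dom S f a b m -> g (chart a m) = chart b (f m)]) ->
  smooth_map A B S f.
Proof.
move=> h a b; have [D [g [Dop Sg OE gE]]] := h a b.
rewrite OE; split => //; apply: smooth_eq Sg => // e; rewrite -OE => -[m rm <-].
by rewrite gE // local_repE.
Qed.

End Atlases.

Section JetEq.
Context (R : realType).

(** Equality at 0 of two curves and of their derivatives up to order k, in a form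
that makes sense in the spaces X, X * X, and so on, that the chain rule visits. *)
Fixpoint same_jet (k : nat) (X : tvsType R) (f g : R -> X) : Prop :=
  f 0 = g 0 /\
  if k is k'.+1 then exists f' g', [/\ \forall t \near (0 : R), cder f t (f' t),
    \forall t \near (0 : R), cder g t (g' t) & same_jet k' f' g'] else True.

Lemma same_jet0 k (X : tvsType R) (f g : R -> X) : same_jet k f g -> f 0 = g 0.
Proof. by case: k => [|k] []. Qed.

Lemma same_jet_pred k (X : tvsType R) (f g : R -> X) : same_jet k.+1 f g -> same_jet k f g.
Proof.
elim: k f g => [|k IH] f g [e [f' [g' [hf hg j]]]]; split => //.
by exists f', g'; split => //; exact: IH.
Qed.

Lemma same_jet_pair k (X Y : tvsType R) (f g : R -> X) (p q : R -> Y) :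
  same_jet k f g -> same_jet k p q -> same_jet k (fun t => (f t, p t)) (fun t => (g t, q t)).
Proof.
elim: k f g p q => [|k IH] f g p q [e1 h1] [e2 h2]; split; rewrite ?e1 ?e2 //.
case: h1 => f' [g' [hf hg j1]]; case: h2 => p' [q' [hp hq j2]].
exists (fun t => (f' t, p' t)), (fun t => (g' t, q' t)); split; last exact: IH.
  by apply: filterS2 hf hp => t; exact: cder_pair.
by apply: filterS2 hg hq => t; exact: cder_pair.
Qed.

(** The derivative of F \o f is dF \o (f, f'), and the curves (f, f') and (g, g')
have the same jet of order one less. *)
Lemma same_jet_comp k (X Y : tvsType R) (U : set X) (F : X -> Y) (f g : R -> X) :
  Cn k U F -> (\forall t \near (0 : R), U (f t)) -> (\forall t \near (0 : R), U (g t)) ->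
  same_jet k f g -> same_jet k (fun t => F (f t)) (fun t => F (g t)).
Proof.
elim: k X U F f g => [|k IH] X U F f g CF Uf Ug j.
  by split => //; rewrite (same_jet0 j).
split; first by rewrite (same_jet0 j).
have jp := same_jet_pred j; case: CF => _ [dF [hF CdF]]; case: j => e [f' [g' [hf hg j]]].
exists (fun t => dF (f t, f' t)), (fun t => dF (g t, g' t)); split.
- by apply: filterS2 Uf hf => t Uft ht; exact: cder_comp hF Uft ht.
- by apply: filterS2 Ug hg => t Ugt ht; exact: cder_comp hF Ugt ht.
- apply: (IH _ (U `*` [set: X]) dF (fun t => (f t, f' t)) (fun t => (g t, g' t))) => //.
  + by apply: filterS Uf => t Ut; split.
  + by apply: filterS Ug => t Ut; split.
  + exact: same_jet_pair.
Qed.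

Lemma near_derive1n (V : normedModType R) (f g : R -> V) (t : R) j :
  (\forall s \near t, f s = g s) -> \forall s \near t, derive1n j f s = derive1n j g s.
Proof.
move=> fg; elim: j => // j IH; have := near_join IH; apply: filterS => s hs.
rewrite !derive1nS /derive1; set q1 := fun h : R => _; set q2 := fun h : R => _.
suff -> : q1 @ (0 : R)^' = q2 @ (0 : R)^' by [].
have h0 : \forall h \near (0 : R)^', q1 h = q2 h.
  have := near_translate hs; apply: filterS => h.
  by rewrite /q1 /q2 [s + h]addrC => ->; rewrite (nbhs_singleton hs).
have h1 : \forall h \near (0 : R)^', q2 h = q1 h.
  by move: h0; apply: filterS => h.
rewrite predeqE => B; split => hB.
  exact: (@near_eq_cvg _ _ (0 : R)^' (dnbhs_filter _) q1 q2 h0 B hB).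
exact: (@near_eq_cvg _ _ (0 : R)^' (dnbhs_filter _) q2 q1 h1 B hB).
Qed.

Lemma near_derive1n_at (V : normedModType R) (f g : R -> V) (t : R) j :
  (\forall s \near t, f s = g s) -> derive1n j f t = derive1n j g t.
Proof. by move=> /(near_derive1n j) /nbhs_singleton. Qed.

Lemma same_jet_derive1n k (V : normedModType R) (f g : R -> V) : same_jet k f g ->
  forall j, (j <= k)%N -> derive1n j f 0 = derive1n j g 0.
Proof.
elim: k f g => [|k IH] f g; first by move=> [e _] j; rewrite leqn0 => /eqP ->.
move=> [e [f' [g' [hf hg /IH h]]]] [|j] jk //.
have ef : \forall t \near (0 : R), derive1 f t = f' t.
  by apply: filterS hf => t; exact: cder_derive1.
have eg : \forall t \near (0 : R), derive1 g t = g' t.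
  by apply: filterS hg => t; exact: cder_derive1.
by rewrite !derive1Sn (near_derive1n_at j ef) (near_derive1n_at j eg) h.
Qed.

Lemma derive1n_same_jet k (V : normedModType R) (I : set R^o) (f g : R -> V) :
  open I -> I 0 -> smooth_on I (f : R^o -> V) -> smooth_on I (g : R^o -> V) ->
  (forall j, (j <= k)%N -> derive1n j f 0 = derive1n j g 0) -> same_jet k f g.
Proof.
move=> oI I0; elim: k f g => [|k IH] f g Sf Sg h; first by split => //; exact: (h 0%N).
split; first exact: (h 0%N).
have [Sf' hf] := smooth_derive1 oI Sf; have [Sg' hg] := smooth_derive1 oI Sg.
have nI : \forall t \near (0 : R), I t by exact: open_nbhs_nbhs.
exists (derive1 f), (derive1 g); split.
- by apply: filterS nI => t; exact: hf.
- by apply: filterS nI => t; exact: hg.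
- by apply: IH => // j jk; rewrite -!derive1Sn; exact: h.
Qed.

End JetEq.

Section Quot.
Context (T : Type) (r : T -> set T).
Hypotheses (rr : forall c, r c c) (rs : forall c d, r c d -> r d c)
  (rt : forall c d e, r c d -> r d e -> r c e).

Lemma qclass_eq c d : r c d -> qclass r c = qclass r d.
Proof.
move=> cd; rewrite /qclass.
have e : r c = r d.
  by apply/seteqP; split => x; [exact: rt (rs cd)|exact: rt cd].
by move: (ex_intro _ c _) (ex_intro _ d _); rewrite e => p q; congr exist; exact: Prop_irrelevance.
Qed.

Lemma qclass_inj c d : qclass r c = qclass r d -> r c d.
Proof. by case=> e; rewrite e; exact: rr. Qed.

Lemma qrepK K : qclass r (qrep K) = K.
Proof.
rewrite /qrep; case: cid => c /= e; case: K e => K p /= e; subst K.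
by rewrite /qclass; congr exist; exact: Prop_irrelevance.
Qed.

Lemma qrep_class c : r c (qrep (qclass r c)).
Proof. by apply: qclass_inj; rewrite qrepK. Qed.

End Quot.

Section Jets.
Context (R : realType) (E : completeNormedModType R) (M : Type) (A : atlas E M).
Hypothesis hA : smooth_atlas A.

Definition transition (a b : ix A) : E -> E := @local_rep R E E M M A A setT id a b.
Definition overlap (a b : ix A) : set E := chart a @` (dom a `&` dom b).

Lemma chart_injective (a : ix A) : {in dom a &, injective (chart a)}.
Proof. by case: hA => _ + _ _; exact. Qed.

Lemma chart_inj (a : ix A) m n : dom a m -> dom a n -> chart a m = chart a n -> m = n.
Proof. by move=> am an; apply: chart_injective; exact/mem_set. Qed.

Lemma chart_cover m : exists a : ix A, dom a m.
Proof. by case: hA => + _ _ _; exact. Qed.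

Lemma open_chart_image (a : ix A) : open (chart a @` dom a).
Proof. by case: hA => _ _ + _; exact. Qed.

Lemma rep_domE a b : rep_dom setT (@id M) (a : ix A) (b : ix A) = dom a `&` dom b.
Proof. by rewrite /rep_dom setTI. Qed.

Lemma transitionE a b m : dom a m -> dom b m -> transition a b (chart a m) = chart b m.
Proof.
move=> am bm; rewrite /transition (@local_repE R E E M M A A chart_injective setT id a b m) //.
Qed.

Lemma open_overlap a b : open (overlap a b).
Proof. by case: hA => _ _ _ /(_ a b) []; rewrite rep_domE. Qed.

Lemma smooth_transition a b : smooth_on (overlap a b) (transition a b).
Proof. by case: hA => _ _ _ /(_ a b) []; rewrite rep_domE. Qed.

Lemma overlap_dom a b : overlap a b `<=` chart a @` dom a.
Proof. by move=> _ [m [am bm] <-]; exists m. Qed.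

Section OneCurve.
Variables (c : curve A) (a : ix A).

Definition cdom : set R^o :=
  [set t | - curve_eps c < t < curve_eps c /\ dom a (c t)].

Lemma cdom0 : dom a (c 0) -> cdom 0.
Proof.
move=> a0; split => //; have := curve_eps_gt0 c; lra.
Qed.

Lemma curve_cdom : open cdom /\ smooth_on cdom ((chart a \o c) : R^o -> E).
Proof.
have [op sm] := curve_smooth c tt a.
have e : chart (tt : ix (vec_atlas R^o)) @` rep_dom [set t : R^o | - curve_eps c < t < curve_eps c] c
    (tt : ix (vec_atlas R^o)) a = cdom.
  by apply/seteqP; split => [_ [t [[ht _] at_] <-]|t [ht at_]] //; exists t.
rewrite e in op sm; split => //; apply: smooth_eq sm => // t [ht at_].
have := @local_repE R _ _ _ _ (vec_atlas R^o) A _ _ c tt a t.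
by apply => // ? x y _ _.
Qed.

End OneCurve.

Lemma curve_near (c : curve A) (a : ix A) : dom a (c 0) ->
  \forall t \near (0 : R), dom a (c t).
Proof.
move=> ac; have h : nbhs (0 : R) (cdom c a).
  by apply: open_nbhs_nbhs; split; [exact: (curve_cdom c a).1|exact: cdom0].
by apply: (filterS _ h) => t [].
Qed.

(** Near 0 the curves in the chart b are the images of those in the chart a by the
transition map, which preserves jets by same_jet_comp. *)
Lemma jet_transfer (c d : curve A) (a b : ix A) k : c 0 = d 0 ->
  dom a (c 0) -> dom b (c 0) ->
  (forall j, (1 <= j <= k)%N ->
      derive1n j (chart a \o c) 0 = derive1n j (chart a \o d) 0) ->
  forall j, (j <= k)%N -> derive1n j (chart b \o c) 0 = derive1n j (chart b \o d) 0.
Proof.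
move=> cd ac bc h j jk.
have ad : dom a (d 0) by rewrite -cd. have bd : dom b (d 0) by rewrite -cd.
have [oc sc] := curve_cdom c a; have [od sd] := curve_cdom d a.
pose I := cdom c a `&` cdom d a.
have oI : open I by exact: openI.
have I0 : I 0 by split; exact: cdom0.
have J : same_jet k (chart a \o c) (chart a \o d).
  apply: (derive1n_same_jet oI I0).
  - by apply: smooth_sub sc => t [].
  - by apply: smooth_sub sd => t [].
  - by case=> [|i] ik; [rewrite /= cd|exact: h].
have nc : \forall t \near (0 : R), dom a (c t) /\ dom b (c t).
  exact: filterI (curve_near ac) (curve_near bc).
have nd : \forall t \near (0 : R), dom a (d t) /\ dom b (d t).
  exact: filterI (curve_near ad) (curve_near bd).
have JJ : same_jet k (fun t => transition a b ((chart a \o c) t)) (fun t => transition a b ((chart a \o d) t)).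
  apply: (@same_jet_comp R k E E (overlap a b) (transition a b) (chart a \o c) (chart a \o d)
    (@smooth_transition a b k)) => //.
    by apply: filterS nc => t [? ?]; exists (c t).
  by apply: filterS nd => t [? ?]; exists (d t).
have e1 : \forall t \near (0 : R), transition a b ((chart a \o c) t) = (chart b \o c) t.
  by apply: filterS nc => t [? ?]; rewrite /= transitionE.
have e2 : \forall t \near (0 : R), transition a b ((chart a \o d) t) = (chart b \o d) t.
  by apply: filterS nd => t [? ?]; rewrite /= transitionE.
by rewrite -(near_derive1n_at j e1) -(near_derive1n_at j e2) (same_jet_derive1n JJ).
Qed.

Lemma jet_eq_chart k (c d : curve A) (a : ix A) : jet_eq k c d -> dom a (c 0) ->
  forall j, (j <= k)%N -> derive1n j (chart a \o c) 0 = derive1n j (chart a \o d) 0.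
Proof. by move=> [cd [b bc h]] ac; exact: (jet_transfer cd bc ac h). Qed.

Lemma jet_eq_refl k (c : curve A) : jet_eq k c c.
Proof. by split => //; have [a ac] := chart_cover (c 0); exists a. Qed.

Lemma jet_eq_sym k (c d : curve A) : jet_eq k c d -> jet_eq k d c.
Proof.
move=> [cd [a ac h]]; split => //; exists a; first by rewrite -cd.
by move=> j jk; rewrite h.
Qed.

Lemma jet_eq_trans k (c d e : curve A) : jet_eq k c d -> jet_eq k d e -> jet_eq k c e.
Proof.
move=> [cd [a ac h]] hde; split; first by rewrite cd; case: hde.
exists a => // j jk; rewrite h //; apply: (jet_eq_chart hde); first by rewrite -cd.
by case/andP: jk.
Qed.

Lemma jet_eq_le k l (c d : curve A) : (k <= l)%N -> jet_eq l c d -> jet_eq k c d.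
Proof.
move=> kl [cd [a ac h]]; split => //; exists a => // j /andP[j1 jk].
by apply: h; rewrite j1 (leq_trans jk kl).
Qed.

Lemma jet_eqI k (c d : curve A) (a : ix A) : c 0 = d 0 -> dom a (c 0) ->
  (forall j, (j <= k)%N ->
     derive1n j (chart a \o c) 0 = derive1n j (chart a \o d) 0) -> jet_eq k c d.
Proof. by move=> cd ac h; split => //; exists a => // j /andP[_ /h]. Qed.

Lemma oo_refl (c : curve A) : jet_eq_oo c c.
Proof. by move=> k _; exact: jet_eq_refl. Qed.
Lemma oo_sym (c d : curve A) : jet_eq_oo c d -> jet_eq_oo d c.
Proof. by move=> h k /h; exact: jet_eq_sym. Qed.
Lemma oo_trans (c d e : curve A) : jet_eq_oo c d -> jet_eq_oo d e -> jet_eq_oo c e.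
Proof. by move=> h1 h2 k k1; exact: jet_eq_trans (h1 k k1) (h2 k k1). Qed.

(** Borel's lemma in a chart, restricted to an interval on which the curve stays in
the image of the chart. *)
Lemma curve_exists (a : ix A) (x : M) (u : nat -> E) : dom a x -> u 0%N = chart a x ->
  exists c : curve A, c 0 = x /\ forall k, derive1n k (chart a \o c) 0 = k`!%:R *: u k.
Proof.
move=> ax u0; have [g [Sg hg]] := borel u.
have g0 : g 0 = chart a x by have := hg 0%N; rewrite /= scale1r u0.
have cg : {for (0 : R^o), continuous g} by exact: (smooth_cont Sg (x := 0)).
have : \forall t \near (0 : R), (chart a @` dom a) (g t).
  by apply: cg; apply: open_nbhs_nbhs; split; [exact: open_chart_image|exists x].
move=> /nbhs_ballP[e /= e0 he].
have inv t : exists m, (chart a @` dom a) (g t) -> dom a m /\ chart a m = g t.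
  have [[m am e1]|n] := pselect ((chart a @` dom a) (g t)); first by exists m.
  by exists x.
pose cf t := proj1_sig (cid (inv t)).
have cfE t : -e < t < e -> dom a (cf t) /\ chart a (cf t) = g t.
  move=> te; rewrite /cf; case: cid => m /= ; apply; apply: he.
  by rewrite -ball_normE /= sub0r normrN ltr_norml.
have sc : smooth_map (vec_atlas R^o) A [set t : R^o | - e < t < e] cf.
  apply: smooth_mapI => [? ? ? _ _ //|[] b].
  exists ([set t : R^o | - e < t < e] `&` g @^-1` overlap a b), (transition a b \o g).
  have oI : open [set t : R^o | - e < t < e].
    rewrite (_ : mkset _ = ball (0 : R^o) e); first exact: ball_open.
    by apply/seteqP; split => t; rewrite -ball_normE /= sub0r normrN ltr_norml.
  split.
  - apply: openI => //; apply: open_comp; last exact: open_overlap.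
    by move=> t _; exact: (smooth_cont Sg (x := t)).
  - apply: (smooth_comp (V := overlap a b)); [by move=> t []| |exact: smooth_transition].
    by apply: smooth_sub Sg.
  - apply/seteqP; split => [_ [t [[te _] bt] <-]|t [te [m [am bm] mE]]].
      by split => //; have [h1 h2] := cfE t te; exists (cf t).
    have [h1 h2] := cfE t te.
    by exists t => //; split => //; rewrite /= (chart_inj h1 am) // h2.
  - move=> t [[te _] bt]; have [h1 h2] := cfE t te.
    by rewrite /= -h2 transitionE.
have e00 : - e < 0 < e by lra.
exists (Curve e0 sc); split => /=.
  by have [h1 h2] := cfE 0 e00; apply: (chart_inj h1 ax); rewrite h2.
move=> k; rewrite -hg; apply: near_derive1n_at.
apply/nbhs_ballP; exists e => // t; rewrite -ball_normE /= sub0r normrN ltr_norml => te.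
by case: (cfE t te).
Qed.

End Jets.

(** * Charts of the infinite tangent bundle *)

Section Charts.
Context (R : realType) (E : completeNormedModType R) (M : Type) (A : atlas E M).
Variable Gam : ix A -> E -> clin E (clin E E).
Hypotheses (hA : smooth_atlas A) (hGam : linear_connection Gam).

Let jrefl k := @jet_eq_refl R E M A hA k.
Let jsym k := @jet_eq_sym R E M A k.
Let jtrans k := @jet_eq_trans R E M A hA k.
Let orefl := @oo_refl R E M A hA.
Let osym := @oo_sym R E M A.
Let otrans := @oo_trans R E M A hA.

(** z^i depends on the jet of order i of the curve only; this makes the charts
independent of the chosen representatives. *)
Lemma zcoord_ext (G : E -> clin E (clin E E)) (g h : R -> E) i :
  (forall j, (j <= i)%N -> derive1n j g 0 = derive1n j h 0) ->
  zcoord G g i = zcoord G h i.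
Proof.
move=> gh; rewrite /zcoord gh //; congr (_ *: (_ + _)).
apply: eq_big_nat => j /andP[j0 ji]; congr (_ *: _).
rewrite gh ?leq_subr //; apply: connM_ext => k kj.
by rewrite /taylor gh //; lia.
Qed.

Definition zcoords (a : ix A) (w : Too A) (k : nat) : E :=
  zcoord (Gam a) (chart a \o qrep w) k.+1.

Definition Phi_oo (a : ix A) (w : Too A) : E * Fspace E :=
  (chart a (pi_oo w), mkF (zcoords a w)).

Definition tau_oo (a : ix A) (w : Too A) : M * Fspace E :=
  (pi_oo w, mkF (zcoords a w)).

Lemma pi_qclass (c : curve A) : pi_oo (qclass _ c) = c 0.
Proof.
have h : jet_eq_oo c (qrep (qclass (@jet_eq_oo R E M A) c)) := qrep_class orefl c.
by have [] := h 1%N isT.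
Qed.

Lemma zcoords_qclass (a : ix A) (c : curve A) : dom a (c 0) ->
  zcoords a (qclass _ c) = fun k => zcoord (Gam a) (chart a \o c) k.+1.
Proof.
move=> ac; apply/funext => k; apply: zcoord_ext => j jk.
have h : jet_eq_oo c (qrep (qclass (@jet_eq_oo R E M A) c)) := qrep_class orefl c.
by rewrite (jet_eq_chart hA (h k.+1 isT) ac).
Qed.

Lemma jet_class_proj (w : Too A) n :
  jet_eq n.+1 (qrep w) (qrep (to_plim_T w n)).
Proof. exact: (qrep_class (@jrefl n.+1)). Qed.

Lemma Phi_oo_plim (a : ix A) :
  is_plim (pi_oo (A := A) @^-1` dom a) (Phi Gam a) (Phi_oo a).
Proof.
move=> w aw n; have h := jet_class_proj w n.
rewrite /Phi /Phi_oo /pi_oo; congr (_, _); first by case: h => <-.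
apply/ffunP => i; rewrite !ffunE; apply: zcoord_ext => j ji.
by apply: (jet_eq_chart hA h aw); apply: leq_trans ji _.
Qed.

Lemma tau_oo_plim (a : ix A) :
  is_plim (pi_oo (A := A) @^-1` dom a) (tau Gam a) (tau_oo a).
Proof.
move=> w aw n; have h := jet_class_proj w n.
have aw' : dom a (qrep (to_plim_T w n) 0) by case: h => <-.
rewrite /tau [in RHS]/Phi /=; congr (_, _).
  rewrite /tau_oo /= pinvKV //; [by case: h | exact: (chart_injective hA (a := a)) | exact/mem_set].
apply/ffunP => i; rewrite !ffunE; apply: zcoord_ext => j ji.
by apply: (jet_eq_chart hA h aw); apply: leq_trans ji _.
Qed.

(** A compatible sequence of jets prescribes, in a chart, all derivatives at 0;
surjectivity is Borel's lemma. *)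
Lemma to_plim_T_bij : set_bij [set: Too A] (plim_T (A := A)) (to_plim_T (A := A)).
Proof.
split.
- move=> w _ j i ij; apply: (qclass_eq (@jsym _) (@jtrans _)).
  apply: jsym; exact: jet_eq_le (jet_class_proj w j).
- move=> w w' _ _ e.
  rewrite -(qrepK w) -(qrepK w'); apply: (qclass_eq osym otrans) => -[//|k] _.
  apply: (qclass_inj (@jrefl _)).
  have := congr1 (fun t : forall n, Tk A n.+1 => t k) e.
  exact.
- move=> t tP.
  have base i j : qrep (t i) 0 = qrep (t j) 0.
    have b0 k : qrep (t k) 0 = qrep (t 0%N) 0.
      have e := tP k 0%N (leq0n _).
      have := qrep_class (@jrefl 1%N) (qrep (t k)).
      by rewrite -[X in jet_eq _ _ (qrep X)]/(conn_map 1 (t k)) e => -[].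
    by rewrite !b0.
  have jj i j : (i <= j)%N -> jet_eq i.+1 (qrep (t j)) (qrep (t i)).
    move=> ij; have e := tP j i ij.
    have := qrep_class (@jrefl i.+1) (qrep (t j)).
    by rewrite -[X in jet_eq _ _ (qrep X)]/(conn_map i.+1 (t j)) e.
  have [a ax] := chart_cover hA (qrep (t 0%N) 0).
  pose u k := k`!%:R^-1 *: derive1n k (chart a \o qrep (t k)) 0.
  have u0 : u 0%N = chart a (qrep (t 0%N) 0) by rewrite /u invr1 scale1r.
  have [c [c0 hc]] := curve_exists hA ax u0.
  exists (qclass _ c) => //; apply: functional_extensionality_dep => n.
  rewrite /to_plim_T -[RHS](qrepK (t n)).
  apply: (qclass_eq (@jsym _) (@jtrans _)).
  have h : jet_eq_oo c (qrep (qclass (@jet_eq_oo R E M A) c)) := qrep_class orefl c.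
  apply: jtrans (jsym (h n.+1 isT)) _.
  apply: (@jet_eqI R E M A _ _ _ a); first by rewrite c0.
    by rewrite c0.
  move=> j jn; rewrite hc /u scalerA mulfV ?scale1r; last first.
    by rewrite pnatr_eq0 -lt0n fact_gt0.
  have [jn'|nj] := leqP j n.
    symmetry; apply: (jet_eq_chart hA (jj _ _ jn')); first by rewrite (base n 0%N).
    exact: leqnSn.
  have e : j = n.+1 by lia.
  rewrite e; apply: (jet_eq_chart hA (jj _ _ (leqnSn n))) => //.
  by rewrite (base _ 0%N).
Qed.

Lemma smooth_Gam a : smooth_on (chart a @` dom a) (Gam a).
Proof. by case: hGam => h _; exact: h. Qed.

Lemma zcoords_inj (a : ix A) (w w' : Too A) : dom a (pi_oo w) -> pi_oo w = pi_oo w' ->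
  (forall k, zcoords a w k = zcoords a w' k) -> w = w'.
Proof.
move=> aw e hz; rewrite -(qrepK w) -(qrepK w').
apply: (qclass_eq osym otrans) => k _.
have aw' : dom a (pi_oo w') by rewrite -e.
pose u := taylor (chart a \o qrep w); pose u' := taylor (chart a \o qrep w').
have uu n : forall j, (j <= n)%N -> u j = u' j.
  elim: n => [|n IH] j.
    rewrite leqn0 => /eqP ->; rewrite /u /u' /taylor /=; congr (_ *: chart a _).
    exact: e.
  rewrite leq_eqVlt => /predU1P[->|]; last exact: IH.
  have := hz n; rewrite /zcoords.
  rewrite !(zcoord_taylor _ (open_chart_image hA a) (smooth_Gam a));
    [|by exists (pi_oo w')|by exists (pi_oo w)].
  by rewrite -/u -/u' (zlow_ext _ IH) => /addIr.
apply: (jet_eqI (a := a)) => // j _.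
have := uu j j (leqnn _); rewrite /u /u' /taylor => /scalerI; apply.
by rewrite invr_eq0 pnatr_eq0 -lt0n fact_gt0.
Qed.

(** The Taylor coefficients are recovered recursively from the z-coordinates by
zcoord_taylor, and Borel's lemma provides a curve with these coefficients. *)
Lemma zcoords_surj (a : ix A) (m : M) (v : Fspace E) : dom a m ->
  exists w : Too A, pi_oo w = m /\ mkF (zcoords a w) = v.
Proof.
move=> am.
have [u hu] := @strong_recursion E 0
  (fun n u => if n is n'.+1 then Fcoord E n' v - zlow (Gam a) n' u else chart a m)
  (ltac:(by case=> // n u u' uu'; congr (_ - _); apply: zlow_ext => k kn; exact: uu')).
have [c [c0 hc]] := curve_exists hA am (hu 0%N).
have ac : dom a (c 0) by rewrite c0.
exists (qclass _ c); rewrite pi_qclass c0; split => //.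
apply: Fcoord_inj => k; rewrite Fcoord_mkF zcoords_qclass //.
have tE : taylor (chart a \o c) = u.
  by apply/funext => j; rewrite /taylor hc scalerA mulVf ?scale1r //.
rewrite (zcoord_taylor _ (open_chart_image hA a) (smooth_Gam a)); last by exists (c 0).
by rewrite tE hu subrK.
Qed.

Lemma Phi_oo_bij (a : ix A) : set_bij (pi_oo (A := A) @^-1` dom a)
  ((chart a @` dom a) `*` setT) (Phi_oo a).
Proof.
split.
- by move=> w aw; split => //; exists (pi_oo w).
- move=> w w' /set_mem aw /set_mem aw' e.
  have e1 : chart a (pi_oo w) = chart a (pi_oo w') := congr1 fst e.
  have e2 : mkF (zcoords a w) = mkF (zcoords a w') := congr1 snd e.
  apply: (zcoords_inj aw (chart_inj hA aw aw' e1)) => k.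
  by have := congr1 (Fcoord E k) e2; rewrite !Fcoord_mkF.
- move=> [x v] [[m am /= <-] _]; have [w [pw zw]] := zcoords_surj v am.
  by exists w; rewrite /Phi_oo /= ?pw ?zw.
Qed.

Lemma dtransition_exists (a b : ix A) : exists d : E * E -> E,
  has_derivative (overlap a b) (transition a b) d /\ smooth_on (overlap a b `*` [set: E]) d.
Proof. exact: smooth_derivative (open_overlap hA a b) (smooth_transition hA a b). Qed.

Definition dtransition (a b : ix A) : E * E -> E := proj1_sig (cid (dtransition_exists a b)).

Lemma dtransition_der a b : has_derivative (overlap a b) (transition a b) (dtransition a b).
Proof. by rewrite /dtransition; case: cid => d []. Qed.

Lemma dtransition_smooth a b : smooth_on (overlap a b `*` [set: E]) (dtransition a b).
Proof. by rewrite /dtransition; case: cid => d []. Qed.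

Lemma dtransition_linear a b x : overlap a b x -> linear (fun v => dtransition a b (x, v)).
Proof. by move=> Wx; have [] := dtransition_der Wx. Qed.

(** Chain rule for the composition of the two transition maps. *)
Lemma dtransitionK a b x v : overlap a b x -> dtransition b a (transition a b x, dtransition a b (x, v)) = v.
Proof.
move=> Wx.
have W' y : overlap a b y -> overlap b a (transition a b y).
  by move=> [m [am bm] <-]; rewrite transitionE //; exists m.
have h1 := has_derivative_comp W' (@dtransition_der a b) (@dtransition_der b a).
have h2 : has_derivative (overlap a b) (@idfun E) (fun p => p.2).
  exact: (has_derivative_lin (U := overlap a b) (f := @idfun E) (fun x => @cvg_id _ (nbhs x))).
have h3 : has_derivative (overlap a b) (@idfun E) (fun p => dtransition b a (transition a b p.1, dtransition a b p)).
  by apply: (has_derivative_eq (open_overlap hA a b) _ h1) => _ [m [am bm] <-]; rewrite /= !transitionE.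
exact: (has_derivative_unique v h3 h2 Wx).
Qed.

(** All fibre coordinates transform by the same operator, the derivative of the
transition map of M. *)
Lemma zcoords_transition (a b : ix A) (w : Too A) k : dom a (pi_oo w) -> dom b (pi_oo w) ->
  zcoords b w k = dtransition a b (chart a (pi_oo w), zcoords a w k).
Proof.
move=> aw bw; pose c := qrep w; pose I := cdom c a `&` cdom c b.
have [oa sa] := curve_cdom c a; have [ob _] := curve_cdom c b.
have oI : open I by exact: openI.
have I0 : I 0 by split; exact: cdom0.
have Sg : smooth_on I ((chart a \o c) : R^o -> E) by apply: smooth_sub sa => t [].
have gU t : I t -> overlap a b ((chart a \o c) t) by move=> [[_ ?] [_ ?]]; exists (c t).
have UU2 x : overlap a b x -> (chart b @` dom b) (transition a b x).
  by move=> [m [am bm] <-]; rewrite transitionE //; exists m.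
have compat x : overlap a b x -> forall xi y : E,
  'D_(Gam a x xi y) (transition a b) x =
  'D_xi (fun z => 'D_y (transition a b) z) x +
    Gam b (transition a b x) ('D_xi (transition a b) x) ('D_y (transition a b) x).
  by move=> [m [am bm] <-] xi y; case: hGam => _ /(_ a b m am bm xi y).
have := zcoord_covariant (open_overlap hA a b) (open_chart_image hA a) (open_chart_image hA b)
  (@overlap_dom _ _ _ A a b) UU2 (smooth_Gam a) (smooth_Gam b) (smooth_transition hA a b)
  compat oI Sg gU k I0.
rewrite (has_derivative_derive _ (@dtransition_der a b) (gU 0 I0)).2 => <-.
apply: zcoord_ext => j _; apply: near_derive1n_at.
have : nbhs (0 : R) I by exact: open_nbhs_nbhs.
by apply: filterS => t [[_ ?] [_ ?]]; rewrite /= transitionE.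
Qed.

Definition transition_oo (a b : ix A) (e : E * Fspace E) : E * Fspace E :=
  (transition a b e.1, mkF (fun k => dtransition a b (e.1, Fcoord E k e.2))).

Lemma Phi_oo_transition (a b : ix A) (w : Too A) : dom a (pi_oo w) -> dom b (pi_oo w) ->
  Phi_oo b w = transition_oo a b (Phi_oo a w).
Proof.
move=> aw bw; rewrite /transition_oo /Phi_oo /=; congr (_, _); first by rewrite transitionE.
apply: Fcoord_inj => k; rewrite Fcoord_mkF [RHS]Fcoord_mkF [X in (_, X)]Fcoord_mkF.
exact: zcoords_transition.
Qed.

Lemma open_overlapF a b : open (overlap (A := A) a b `*` [set: Fspace E]).
Proof. by apply: openX; [exact: open_overlap|exact: openT]. Qed.

Lemma smooth_fibre_part (X : tvsType R) (U : set X) (f : X -> E) (g : X -> Fspace E) a b :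
  open U -> (forall x, U x -> overlap (A := A) a b (f x)) -> smooth_on U f -> smooth_on U g ->
  smooth_on U (fun x => mkF (fun k => dtransition a b (f x, Fcoord E k (g x)))).
Proof.
move=> oU UW Sf Sg; apply: (smooth_initial (@F_initial R E) oU) => k.
apply: (smooth_eq (f := fun x => dtransition a b (f x, Fcoord E k (g x))) oU).
  by move=> x _; rewrite Fcoord_mkF.
apply: (smooth_comp (V := overlap a b `*` setT) (f := fun x => (f x, Fcoord E k (g x)))
  _ _ (@dtransition_smooth a b)); first by move=> x /UW.
apply: smooth_pair => //; apply: (smooth_comp (V := setT)) Sg _ => //.
by apply: smooth_lin; exact: Fcoord_continuous.
Qed.

Lemma smooth_transition_oo a b : smooth_on (overlap (A := A) a b `*` [set: Fspace E]) (transition_oo a b).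
Proof.
apply: smooth_pair.
  apply: (smooth_comp (V := overlap a b) (f := fst)); [by move=> x []| |exact: smooth_transition].
  by apply: smooth_fst; exact: smooth_id.
apply: smooth_fibre_part; [exact: open_overlapF|by move=> x []| |].
  by apply: smooth_fst; exact: smooth_id.
by apply: smooth_snd; exact: smooth_id.
Qed.

End Charts.

(** * The generalized vector bundle structure *)

Section Bundle.
Context (R : realType) (E : completeNormedModType R) (M : Type) (A : atlas E M).
Variable Gam : ix A -> E -> clin E (clin E E).
Hypotheses (hA : smooth_atlas A) (hGam : linear_connection Gam).

Let B : atlas (E * Fspace E)%type (Too A) :=
  Atlas (fun a => pi_oo (A := A) @^-1` dom a) (Phi_oo Gam).

Lemma Phi_oo_injective (a : ix B) : {in dom a &, injective (chart a)}.
Proof. by have [_ + _] := Phi_oo_bij hA hGam a. Qed.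

Lemma Phi_oo_image (a : ix A) (S : set M) : S `<=` dom a ->
  Phi_oo Gam a @` (pi_oo (A := A) @^-1` S) = (chart a @` S) `*` setT.
Proof.
move=> Sa; apply/seteqP; split => [_ [w Sw <-]|[x v] [[m Sm /= <-] _]].
  by split => //; exists (pi_oo w).
have [w [pw zw]] := zcoords_surj hA hGam v (Sa _ Sm).
by exists w; rewrite /Phi_oo /= ?pw ?zw.
Qed.

Lemma smooth_atlas_B : smooth_atlas B.
Proof.
split.
- by move=> w; have [a aw] := chart_cover hA (pi_oo w); exists a.
- exact: Phi_oo_injective.
- move=> a; rewrite /= Phi_oo_image //; apply: openX; last exact: openT.
  exact: (open_chart_image hA a).
- apply: (smooth_mapI Phi_oo_injective) => a b.
  exists (overlap (A := A) a b `*` setT), (transition_oo hA a b); split.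
  + exact: open_overlapF.
  + exact: smooth_transition_oo.
  + rewrite -Phi_oo_image; last by move=> m [].
    by congr image; apply/seteqP; split => [w [[_ ?] ?]|w [? ?]] //; split.
  + by move=> w [[_ aw] bw]; rewrite -(Phi_oo_transition hA hGam aw bw).
Qed.

Lemma open_preimage_on (X Y : topologicalType) (D : set X) (f : X -> Y) (V : set Y) :
  open D -> (forall x, D x -> {for x, continuous f}) -> open V -> open (D `&` f @^-1` V).
Proof.
move=> oD cf oV; rewrite openE => x [Dx Vx]; apply: filterI; first exact: open_nbhs_nbhs.
by apply: cf => //; exact: open_nbhs_nbhs.
Qed.

(** Points over distinct base points are separated in M, points of the same fibre
are separated in a chart. *)
Lemma hausdorff_B : atlas_hausdorff A -> atlas_hausdorff B.
Proof.
move=> HA w w' ww'; have [e|pp] := pselect (pi_oo w = pi_oo w'); last first.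
  have [Q [Q' [oQ oQ' Qx Qy QQ]]] := HA _ _ pp.
  have op (O : set M) : atlas_open A O -> atlas_open B (pi_oo (A := A) @^-1` O).
    move=> oO a; rewrite /= -preimage_setI Phi_oo_image; last by move=> m [].
    by apply: openX; [exact: oO|exact: openT].
  exists (pi_oo (A := A) @^-1` Q), (pi_oo (A := A) @^-1` Q').
  split => //; try exact: op.
  by rewrite -preimage_setI QQ preimage_set0.
(* points of the same fibre lie in a common chart, and E x F is separated *)
have [a aw] := chart_cover hA (pi_oo w).
have aw' : dom a (pi_oo w') by rewrite -e.
have PP : Phi_oo Gam a w <> Phi_oo Gam a w'.
  by move=> P; apply: ww'; apply: (Phi_oo_injective (a := a)) P; exact/mem_set.
have [hEF _ _] := frechet_prod (frechet_banach E) (frechet_Fspace E).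
move: hEF; rewrite open_hausdorff => /(_ _ _ (introN eqP PP)) [[V V'] /= [Vx V'x]].
move=> [oV oV' VV'].
pose O (V : set (E * Fspace E)%type) := [set u : Too A | dom a (pi_oo u) /\ V (Phi_oo Gam a u)].
have op (U : set (E * Fspace E)%type) : open U -> atlas_open B (O U).
  move=> oU b.
  rewrite (_ : _ @` _ = (overlap (A := A) b a `*` setT) `&` transition_oo hA b a @^-1` U).
    apply: open_preimage_on => //; first exact: open_overlapF.
    by move=> x Wx; exact: (smooth_cont (smooth_transition_oo hA b a) Wx).
  rewrite -Phi_oo_image; last by move=> m [].
  apply/seteqP; split => [_ [u [[au Uu] bu] <-]|_ [[u [bu au] <-]]] /=.
    by split; [exists u|rewrite -(Phi_oo_transition hA hGam bu au)].
  by rewrite -(Phi_oo_transition hA hGam bu au) => Uu; exists u.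
exists (O V), (O V'); split; [exact: op|exact: op| | |].
- by split => //; exact/set_mem.
- by split => //; exact/set_mem.
- apply/seteqP; split => // u [[_ Vu] [_ V'u]].
  have : (V `&` V') (Phi_oo Gam a u) by [].
  by rewrite (eqP VV').
Qed.

Lemma overlap_inter (a b c : ix A) : overlap (A := A) c a `&` overlap c b = chart c @` (dom c `&` dom a `&` dom b).
Proof.
apply/seteqP; split => [_ [[m [cm am] <-] [n [cn bn] e]]|_ [m [[cm am] bm] <-]].
  by exists m => //; split => //; rewrite -(chart_inj hA cn cm e).
by split; exists m.
Qed.

Lemma open_overlap_inter (a b c : ix A) : open (overlap (A := A) c a `&` overlap c b).
Proof. by apply: openI; exact: open_overlap. Qed.

Let P := prod_atlas A (vec_atlas (Fspace E)).

Lemma prod_chart_injective (p : ix P) : {in dom p &, injective (chart p)}.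
Proof.
case: p => c [] [m v] [n w] /set_mem [/= cm _] /set_mem [/= cn _] e.
have e1 : chart c m = chart c n := congr1 fst e.
have e2 : v = w := congr1 snd e.
by rewrite e2 (chart_inj hA cm cn e1).
Qed.

Lemma smooth_transition_fst (a b : ix A) (U : set (E * Fspace E)%type) :
  (forall p, U p -> overlap a b p.1) -> smooth_on U (fun p => transition a b p.1).
Proof.
move=> UW; apply: (smooth_comp (V := overlap a b) (f := fst)) => //; last exact: smooth_transition.
by apply: smooth_fst; exact: smooth_id.
Qed.

(** In the charts of Too A, the trivialization over chart a is
(x, v) |-> (psi_cb x, dpsi_ca x v), and its inverse is
(x, v) |-> (psi_cb x, dpsi_ab (psi_ca x) v). *)
Lemma tau_diffeo (a : ix A) :
  diffeo B P (pi_oo (A := A) @^-1` dom a) (dom a `*` setT) (tau_oo Gam a).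
Proof.
have surj (p : M * Fspace E) : exists w : Too A, dom a p.1 -> tau_oo Gam a w = p.
  case: p => m v; have [am|nam] := pselect (dom a m).
    have [w [pw zw]] := zcoords_surj hA hGam v am.
    by exists w; rewrite /tau_oo pw zw.
  (* outside dom a, any point of Too A serves as a value of the inverse *)
  have [b bm] := chart_cover hA m; have [w _] := zcoords_surj hA hGam v bm.
  by exists w.
pose g p := proj1_sig (cid (surj p)).
have gE p : dom a p.1 -> tau_oo Gam a (g p) = p by rewrite /g; case: cid.
have pg p : dom a p.1 -> pi_oo (g p) = p.1 by move=> /gE {2}<-.
have tinj w w' : dom a (pi_oo w) -> tau_oo Gam a w = tau_oo Gam a w' -> w = w'.
  move=> aw e; have e1 : pi_oo w = pi_oo w' := congr1 fst e.
  have e2 : mkF (zcoords Gam a w) = mkF (zcoords Gam a w') := congr1 snd e.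
  apply: (zcoords_inj hA hGam aw e1) => k.
  by have := congr1 (Fcoord E k) e2; rewrite !Fcoord_mkF.
split.
- split; first by move=> w aw; split.
    by move=> w w' /set_mem aw _; exact: tinj.
  by move=> p [ap _]; exists (g p); [rewrite /= pg|exact: gE].
- apply: (smooth_mapI Phi_oo_injective) => c [b []].
  exists ((overlap (A := A) c a `&` overlap c b) `*` setT),
    (fun p => (transition c b p.1, mkF (fun k => dtransition hA c a (p.1, Fcoord E k p.2)))).
  split.
  + by apply: openX; [exact: open_overlap_inter|exact: openT].
  + apply: smooth_pair; first by apply: smooth_transition_fst => p [[]].
    apply: smooth_fibre_part; first by apply: openX; [exact: open_overlap_inter|exact: openT].
    * by move=> p [[]].
    * by apply: smooth_fst; exact: smooth_id.
    * by apply: smooth_snd; exact: smooth_id.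
  + rewrite overlap_inter -Phi_oo_image; last by move=> m [[]].
    congr image; apply/seteqP; split => [w [[aw cw] [bw _]]|w [[cw aw] bw]].
      by split.
    by split.
  + move=> w [[aw cw] [bw _]].
    have := Phi_oo_transition hA hGam cw aw; rewrite /Phi_oo /transition_oo /= => e.
    have e2 := congr1 snd e; rewrite /= in e2.
    by rewrite e2; congr (_, _); rewrite transitionE.
- exists g; split.
    by move=> w aw; apply: tinj; [rewrite pg|rewrite gE].
  apply: (smooth_mapI prod_chart_injective) => -[c []] b.
  exists ((overlap (A := A) c a `&` overlap c b) `*` setT),
    (fun p => transition_oo hA a b (transition c a p.1, p.2)).
  have oW : open ((overlap (A := A) c a `&` overlap c b) `*` [set: Fspace E]).
    by apply: openX; [exact: open_overlap_inter|exact: openT].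
  split => //.
  + apply: (smooth_comp (V := overlap a b `*` setT)
      (f := fun p : (E * Fspace E)%type => (transition c a p.1, p.2))); last exact: smooth_transition_oo.
      move=> p [+ _]; rewrite overlap_inter => -[m [[cm am] bm] <-]; split => //=.
      by rewrite transitionE //; exists m.
    apply: smooth_pair; first by apply: smooth_transition_fst => p [[]].
    by apply: smooth_snd; exact: smooth_id.
  + rewrite overlap_inter; apply/seteqP; split.
      move=> _ [[m v] [[[am _] [cm _]] bm] <-]; rewrite /= pg // in bm.
      by split => //=; exists m.
    move=> [_ v] [[m [[cm am] bm] /= <-] _]; exists (m, v) => //.
    by split => //; rewrite /= pg.
  + move=> [m v] [[[am _] [cm _]] bm]; rewrite /= in am cm bm.
    have bm' := bm; rewrite pg // in bm'.
    rewrite /= transitionE // -[LHS]/(transition_oo hA a b (chart a m, v)).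
    rewrite -[RHS]/(Phi_oo Gam b (g (m, v))).
    have ag : dom a (pi_oo (g (m, v))) by rewrite pg.
    rewrite (Phi_oo_transition hA hGam ag bm); congr transition_oo.
    by have := gE (m, v) am; rewrite /tau_oo /Phi_oo => -[-> ->].
Qed.

Section Cocycle.
Variables a b : ix A.

Definition dtransition_pow (k : nat) (x : E) (v : npow E k.+1) : npow E k.+1 :=
  [ffun i => dtransition hA a b (x, v i)].

Lemma dtransition_pow_smooth k :
  smooth_on (overlap a b `*` [set: npow E k.+1]) (fun p => @dtransition_pow k p.1 p.2).
Proof.
have oW : open (overlap a b `*` [set: npow E k.+1]).
  by apply: openX; [exact: open_overlap|exact: openT].
apply: (smooth_initial (@npow_initial R E k.+1) oW) => i.
apply: (smooth_eq (f := fun p => dtransition hA a b (p.1, npow_coord E i p.2)) oW).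
  by move=> p _; rewrite /dtransition_pow /= ffunE.
apply: (smooth_comp (V := overlap a b `*` setT)
  (f := fun p : (E * npow E k.+1)%type => (p.1, npow_coord E i p.2)) _ _
  (@dtransition_smooth R E M A hA a b)); first by move=> p [].
apply: smooth_pair; first by apply: smooth_fst; exact: smooth_id.
apply: (smooth_comp (V := setT) (f := snd) (g := npow_coord E i)) => //.
  by apply: smooth_snd; exact: smooth_id.
by apply: smooth_lin; exact: npow_coord_continuous.
Qed.

Lemma dtransition_pow_clin k x : overlap a b x -> clin_set (@dtransition_pow k x).
Proof.
move=> Wx; split.
  move=> t v w; apply/ffunP => i; rewrite !ffunE.
  exact: (@dtransition_linear R E M A hA a b x Wx t).
move=> v; have c := smooth_cont (@dtransition_pow_smooth k) (x := (x, v)) (conj Wx Logic.I).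
have FF : Filter (nbhs (v : npow E k.+1)) by exact: nbhs_filter.
have c' : (fun w : npow E k.+1 => (x, w)) @ nbhs v --> (x, v).
  exact: (@cvg_pair _ _ _ _ _ _ FF _ _ (fun=> x) id (@cvg_cst _ x _ (nbhs v) FF) (@cvg_id _ (nbhs v))).
exact: (cvg_comp _ _ c' c).
Qed.

(** Set to 0 outside the overlap, where the derivative of the transition map is
unspecified. *)
Definition dtransition_clin k (x : E) : clin (npow E k.+1) (npow E k.+1) :=
  if pselect (overlap a b x) is left Wx
  then Subfam (S := clin_subspace (npow E k.+1) (npow E k.+1)) (dtransition_pow_clin k Wx) else 0.

Lemma dtransition_clinE k x v : overlap a b x -> fam (@dtransition_clin k x) v = dtransition_pow x v.
Proof. by move=> Wx; rewrite /dtransition_clin; case: pselect. Qed.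

Lemma dtransition_clin_compat x (j k : nat) (h : (k.+1 <= j.+1)%N) (v : npow E j.+1) :
  rho h (fam (@dtransition_clin j x) v) = fam (@dtransition_clin k x) (rho h v).
Proof.
rewrite /dtransition_clin; case: pselect => Wx; last by apply/ffunP => i; rewrite !ffunE.
by apply/ffunP => i; rewrite !ffunE.
Qed.

Definition cocycle (x : E) : plim_end E := mk_end (@dtransition_clin_compat x).

(** Smoothness for the operator norms, by Cn_curry. *)
Lemma cocycle_smooth : smooth_on (overlap a b) cocycle.
Proof.
apply: (smooth_initial (@plim_end_initial R E) (open_overlap hA a b)) => k n.
have -> : (fun x => plim_coord E k (cocycle x)) = @dtransition_clin k by [].
apply: (Cn_curry (g := fun p => @dtransition_pow k p.1 p.2) n (open_overlap hA a b)).
  by move=> x v Wx; rewrite dtransition_clinE.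
exact: dtransition_pow_smooth.
Qed.

Lemma cocycle_act x v : overlap a b x ->
  act (cocycle x) v = mkF (fun k => dtransition hA a b (x, Fcoord E k v)).
Proof.
move=> Wx; apply: Fcoord_inj => k; rewrite Fcoord_mkF.
rewrite -[LHS]/((fam (@dtransition_clin k x) (coordF v k)) ord_max) dtransition_clinE //.
by rewrite /dtransition_pow ffunE.
Qed.

End Cocycle.

(** The inverse operators come from the transition map in the other direction. *)
Lemma cocycle_H0 (a b : ix A) x : overlap a b x -> H0lim (cocycle a b x).
Proof.
move=> Wx n j; exists (@dtransition_clin b a j (transition a b x)).
have Wx' : overlap b a (transition a b x).
  by case: Wx => m [am bm] <-; rewrite transitionE //; exists m.
have xx : transition b a (transition a b x) = x.
  by case: Wx => m [am bm] <-; rewrite !transitionE.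
rewrite -[tuple_end _ _]/(@dtransition_clin a b j x); split => v; rewrite !dtransition_clinE //;
  apply/ffunP => i; rewrite !ffunE.
  by rewrite -[X in dtransition hA a b (X, _)]xx dtransitionK.
by rewrite dtransitionK.
Qed.

Lemma bundle_B : gen_vector_bundle B (pi_oo (A := A)) (tau_oo Gam).
Proof.
split; first by move=> a; split; [exact: tau_diffeo|].
move=> a b; exists (fun m => cocycle a b (chart a m)); split.
- apply: (smooth_mapI (chart_injective hA)) => c [].
  exists (overlap (A := A) c a `&` overlap c b), (fun x => cocycle a b (transition c a x)); split.
  + exact: open_overlap_inter.
  + apply: (smooth_comp (V := overlap a b)); last exact: cocycle_smooth.
      by move=> x; rewrite overlap_inter => -[m [[cm am] bm] <-]; rewrite transitionE //; exists m.
    by apply: smooth_sub (smooth_transition hA c a) => x [].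
  + rewrite overlap_inter; congr image; apply/seteqP.
    by split => [m [[[am bm] cm] _]|m [[cm am] bm]]; split.
  + by move=> m [[[am bm] cm] _]; rewrite transitionE.
- by move=> m am bm; apply: cocycle_H0; exists m.
- move=> m v w am bm pw tw.
  have <- : mkF (zcoords Gam a w) = v := congr1 snd tw.
  have aw : dom a (pi_oo w) by rewrite pw.
  have bw : dom b (pi_oo w) by rewrite pw.
  rewrite /tau_oo pw cocycle_act; last by exists m.
  have e2 := congr1 snd (Phi_oo_transition hA hGam aw bw).
  by congr (_, _); rewrite -pw; exact: e2.
Qed.

End Bundle.

Theorem mainTheorem8 (R : realType) (E : completeNormedModType R) (M : Type)
    (A : atlas E M) (Gam : ix A -> E -> clin E (clin E E))
    (hA : smooth_atlas A) (hGam : linear_connection Gam) :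
  [/\ frechet_space (Fspace E),
      frechet_space (E * Fspace E)%type,
      lin_homeo (E * Fspace E)%type (plim_npow E 2),
      set_bij [set: Too A] (plim_T (A := A)) (to_plim_T (A := A)) &
      exists (Phi_oo : ix A -> Too A -> E * Fspace E)
             (tau_oo : ix A -> Too A -> M * Fspace E),
        let B : atlas (E * Fspace E)%type (Too A) :=
          Atlas (fun a => pi_oo (A := A) @^-1` dom a) Phi_oo in
        ((forall a, is_plim (pi_oo (A := A) @^-1` dom a)
                      (Phi Gam a) (Phi_oo a)) /\
         (forall a, is_plim (pi_oo (A := A) @^-1` dom a)
                      (tau Gam a) (tau_oo a))) /\
        [/\ forall a, set_bij (pi_oo (A := A) @^-1` dom a)
                        ((chart a @` dom a) `*` setT) (Phi_oo a),
            smooth_atlas B,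
            atlas_hausdorff A -> atlas_hausdorff B &
            gen_vector_bundle B (pi_oo (A := A)) tau_oo]].

Proof.
split.
- exact: frechet_Fspace.
- exact: frechet_prod (frechet_banach E) (frechet_Fspace E).
- exact: lin_homeo_cons.
- exact: to_plim_T_bij.
- exists (Phi_oo Gam), (tau_oo Gam) => B; split; first split.
  + exact: Phi_oo_plim.
  + exact: tau_oo_plim.
  + split.
    * exact: Phi_oo_bij.
    * exact: smooth_atlas_B.
    * exact: hausdorff_B.
    * exact: bundle_B.
Qed.
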